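(* Let $D=[0,1]\times[-\pi,\pi]$, let $\{U_n\}_n$ be a sequence of unitary matrices with $U_n$ of order $n$, and let $P_{U_n}$ be the associated orthogonal projections. Let $\{f_1,f_2,\dots,f_k\}\subseteq L^\infty(D)$, and for each $i$ let $\{A_n(f_i)\}_n\sim_{\mathrm{GLT}}f_i$ be norm bounded; let also $\{A_n(\sum_{i=1}^kf_if_i^* )\}_n\sim_{\mathrm{GLT}}\sum_{i=1}^kf_if_i^*$ be norm bounded. Suppose that $\{P_{U_n}(A_n(g))-A_n(g)\}_n$ converges to $\{O_n\}_n$ in Type 2 weak cluster sense for every $g\in\{f_1,f_2,\dots,f_k,\sum_{i=1}^kf_if_i^*\}$. Then for every $f$ in the $C^*$-algebra generated by $\{f_1,f_2,\dots,f_k\}$ and every norm bounded sequence $\{A_n(f)\}_n\sim_{\mathrm{GLT}}f$, the sequence $\{P_{U_n}(A_n(f))-A_n(f)\}_n$ converges to $\{O_n\}_n$ in Type 2 weak cluster sense.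
   Context: $\|\cdot\|$ is the spectral norm, $O_n$ the $n\times n$ zero matrix, $f^*=\bar f$ the complex conjugate. Matrix sequences $\{A_n\}_n$ have $A_n\in M_n(\mathbb C)$; norm bounded means $\sup_n\|A_n\|<\infty$. The $C^*$-algebra generated by $f_1,\dots,f_k$ is taken inside $L^\infty(D)$. For a function $g$, $A_n(g)$ denotes the $n$-th term of the chosen GLT sequence with symbol $g$. Projections. $M_n(\mathbb C)$ is equipped with the inner product $\langle A,B\rangle=\operatorname{trace}(B^*A)$ (Frobenius norm). For the unitary $U_n$, $M_{U_n}=\{A\in M_n(\mathbb C):U_n^*AU_n\text{ is diagonal}\}$ and $P_{U_n}$ is the orthogonal projection of $M_n(\mathbb C)$ onto $M_{U_n}$. Type 2 weak cluster convergence. $\{A_n-B_n\}_n$ converges to $\{O_n\}_n$ in Type 2 weak cluster sense if for every $\epsilon>0$ there exist integers $n_{1,\epsilon}$ and $n_{2,\epsilon}$, where $n_{1,\epsilon}=n_{1,\epsilon}(n)$ may depend on both $n$ and $\epsilon$ and is $o(n)$ as $n\to\infty$, such that for all $n>n_{2,\epsilon}$ one has $A_n-B_n=R_n+N_n$ with $\operatorname{rank}R_n\le n_{1,\epsilon}$ and $\|N_n\|<\epsilon$. Approximating class of sequences (a.c.s.). $\{\{B_{n,m}\}_n\}_m$ (with $B_{n,m}\in M_n(\mathbb C)$) is an a.c.s. for $\{A_n\}_n$ if for every $m$ there is $n_m$ such that for $n\ge n_m$, $A_n=B_{n,m}+R_{n,m}+N_{n,m}$ with $\operatorname{rank}(R_{n,m})\le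 c(m)n$ and $\|N_{n,m}\|\le\omega(m)$, where $n_m,c(m),\omega(m)$ depend only on $m$ and $\lim_{m\to\infty}c(m)=\lim_{m\to\infty}\omega(m)=0$. LT sequences. For $h\in L^1([-\pi,\pi])$, $T_n(h)=(h_{i-j})_{i,j=1}^n$ is the Toeplitz matrix with $h_k=\frac1{2\pi}\int_{-\pi}^{\pi}h(\theta)e^{-\mathrm i k\theta}\,d\theta$. For $a:[0,1]\to\mathbb C$ Riemann integrable, $D_m(a)=\operatorname{diag}_{i=1,\dots,m}a(i/m)$, and $LT_n^m(a,h)=[D_m(a)\otimes T_{\lfloor n/m\rfloor}(h)]\oplus O_{n\,(\mathrm{mod}\,m)}$. $\{A_n\}_n\sim_{\mathrm{LT}}a\otimes h$ means that $\{\{LT_n^m(a,h)\}_n\}_{m\in\mathbb N}$ is an a.c.s. for $\{A_n\}_n$; here $(a\otimes h)(x,\theta)=a(x)h(\theta)$. GLT sequences. For measurable $\kappa:D\to\mathbb C$, $\{A_n\}_n\sim_{\mathrm{GLT}}\kappa$ means: for every $m$ in some infinite subset of $\mathbb N$ there are finitely many LT sequences $\{A_n^{(i,m)}\}_n\sim_{\mathrm{LT}}a_{i,m}\otimes h_{i,m}$, $i=1,\dots,k_m$, such that $\sum_{i=1}^{k_m}a_{i,m}\otimes h_{i,m}\to\kappa$ in measure on $D$ as $m\to\infty$, and $\{\{\sum_{i=1}^{k_m}A_n^{(i,m)}\}_n\}_m$ is an a.c.s. for $\{A_n\}_n$. *)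

(* Defs.v *)
From HB Require Import structures.
From mathcomp Require Export all_boot all_order all_algebra.
From mathcomp Require Export complex mxtens.
From mathcomp Require Export all_classical all_reals all_analysis ess_sup_inf.

Set Implicit Arguments.
Unset Strict Implicit.
Unset Printing Implicit Defensive.

Export Order.TTheory GRing.Theory Num.Theory.
Export numFieldNormedType.Exports.

Open Scope classical_set_scope.
Open Scope ring_scope.
Open Scope sesquilinear_scope.

Definition mxseq (R : realType) : Type := forall n : nat, 'M[R[i]]_n.

Definition l2norm (R : realType) (n : nat) (x : 'cV[R[i]]_n) : R :=
  Num.sqrt (\sum_(i < n) Normc.normc (x i ord0) ^+ 2).

Definition spectral_norm (R : realType) (n : nat) (A : 'M[R[i]]_n) : R :=
  sup [set l2norm (A *m x) | x in [set x | l2norm x <= 1]].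

Definition norm_bounded (R : realType) (A : mxseq R) : Prop :=
  exists C : R, forall n, spectral_norm (A n) <= C.

Definition frob_inner (R : realType) (n : nat) (A B : 'M[R[i]]_n) : R[i] :=
  \tr (B^t* *m A).

Definition diagonalized_by (R : realType) (n : nat) (U : 'M[R[i]]_n) :
    set 'M[R[i]]_n :=
  [set A | is_diag_mx (U^t* *m A *m U)].

Definition orthogonal_projection_onto (R : realType) (n : nat)
    (V : set 'M[R[i]]_n) (P : 'M[R[i]]_n -> 'M[R[i]]_n) : Prop :=
  forall A, V (P A) /\ (forall B, V B -> frob_inner (A - P A) B = 0).

Definition type2_weak_cluster (R : realType) (A B : mxseq R) : Prop :=
  forall e : R, 0 < e ->
    exists (n1 : nat -> nat) (n2 : nat),
      ((n1 n)%:R / n%:R @[n --> \oo] --> (0 : R)) /\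
      (forall n, (n2 < n)%N ->
         exists Rn Nn : 'M[R[i]]_n,
           [/\ A n - B n = Rn + Nn, (\rank Rn <= n1 n)%N
             & spectral_norm Nn < e]).

(* B_(n,m) is [B m n]; only the indices m in [M] matter, and the limits are
   for m -> oo along [M]. *)
Definition acs (R : realType) (M : set nat) (B : nat -> mxseq R)
    (A : mxseq R) : Prop :=
  exists (nm : nat -> nat) (c w : nat -> R),
    [/\ c m @[m --> within M \oo] --> (0 : R),
        w m @[m --> within M \oo] --> (0 : R)
      & forall m, M m -> forall n, (nm m <= n)%N ->
          exists Rnm Nnm : 'M[R[i]]_n,
            [/\ A n = B m n + Rnm + Nnm, (\rank Rnm)%:R <= c m * n%:R
              & spectral_norm Nnm <= w m]].

(* "Measurable" is Lebesgue, not Borel, measurable (a Riemann integrable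
   function need not be Borel): R and R^2 carry the completed Lebesgue measure
   on its Caratheodory sigma-algebra. *)
Notation plane R := (caratheodory_type
  ((@lebesgue_measure R \x @lebesgue_measure R)%E^*)%mu).

Definition completed_lebesgue_measure2 {R : realType} :
    set (plane R) -> \bar R :=
  @completed_measure_extension _ (measurableTypeR R * measurableTypeR R)%type R
    (@lebesgue_measure R \x @lebesgue_measure R)%E.
HB.instance Definition _ (R : realType) :=
  Measure.on (@completed_lebesgue_measure2 R).

Definition domD (R : realType) : set (plane R) := `[0, 1] `*` `[- pi, pi].
Arguments domD : clear implicits.

(* A function on D is represented by a total function on the plane; everything
   below depends only on its restriction to D. *)
Definition Dfun (R : realType) : Type := plane R -> R[i].

Definition measurable_on_D (R : realType) (f : Dfun R) : Prop :=
  measurable_fun (domD R) (fun z => complex.Re (f z) : R) /\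
  measurable_fun (domD R) (fun z => complex.Im (f z) : R).

Definition Linfty_norm (R : realType) (f : Dfun R) : \bar R :=
  ess_sup completed_lebesgue_measure2
    (EFin \o ((fun z => Normc.normc (f z)) \_ (domD R))).

Definition Linfty (R : realType) : set (Dfun R) :=
  [set f | measurable_on_D f /\ (Linfty_norm f < +oo)%E].
Arguments Linfty : clear implicits.

(* Not necessarily unital. Since [Linfty_norm] only sees almost everywhere
   classes, [Cstar_closed] also makes [B] stable under a.e. equality on D. *)
Record is_Cstar_subalgebra (R : realType) (B : set (Dfun R)) : Prop := {
  Cstar_sub : B `<=` Linfty R;
  Cstar0 : B (fun=> 0);
  CstarD : forall f g, B f -> B g -> B (fun z => f z + g z);
  CstarZ : forall (c : R[i]) f, B f -> B (fun z => c * f z);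
  CstarM : forall f g, B f -> B g -> B (fun z => f z * g z);
  Cstar_conj : forall f, B f -> B (fun z => (f z)^*);
  Cstar_closed : forall (g : nat -> Dfun R) f, (forall j, B (g j)) ->
    Linfty R f ->
    Linfty_norm (fun z => g j z - f z) @[j --> \oo] --> (0 : \bar R) ->
    B f
}.

Definition Cstar_generated (R : realType) (S : set (Dfun R)) : set (Dfun R) :=
  smallest (@is_Cstar_subalgebra R) S.

Definition cvg_in_measure_on_D (R : realType) (M : set nat)
    (g : nat -> Dfun R) (f : Dfun R) : Prop :=
  forall e : R, 0 < e ->
    completed_lebesgue_measure2
      (domD R `&` [set z | e < Normc.normc (g m z - f z)])
    @[m --> within M \oo] --> (0 : \bar R).

Definition riemann_integrable01 (R : realType) (a : R -> R[i]) : Prop :=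
  exists I : R[i], forall e : R, 0 < e -> exists2 d : R, 0 < d &
    forall (n : nat) (x t : nat -> R), x 0%N = 0 -> x n = 1 ->
      (forall j, (j < n)%N ->
         [/\ x j <= t j, t j <= x j.+1 & x j.+1 - x j < d]) ->
      Normc.normc (\sum_(j < n) a (t j) * (x j.+1 - x j)%:C%C - I) < e.

Definition cintegrable_pi (R : realType) (h : R -> R[i]) : Prop :=
  completed_lebesgue_measure.-integrable `[- pi, pi]
    (fun t => (complex.Re (h t))%:E) /\
  completed_lebesgue_measure.-integrable `[- pi, pi]
    (fun t => (complex.Im (h t))%:E).

Definition cintegral_pi (R : realType) (h : R -> R[i]) : R[i] :=
  ((\int[completed_lebesgue_measure]_(t in `[- pi, pi]) complex.Re (h t)) +i*
   (\int[completed_lebesgue_measure]_(t in `[- pi, pi]) complex.Im (h t)))%C.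

Definition fourier_coef (R : realType) (h : R -> R[i]) (k : int) : R[i] :=
  ((2 * pi)^-1)%:C%C *
  cintegral_pi (fun t => h t * (cos (k%:~R * t) -i* sin (k%:~R * t))%C).

Definition toeplitz (R : realType) (n : nat) (h : R -> R[i]) : 'M[R[i]]_n :=
  \matrix_(i < n, j < n) fourier_coef h (i%:Z - j%:Z).

Definition diag_sampling (R : realType) (m : nat) (a : R -> R[i]) :
    'M[R[i]]_m :=
  diag_mx (\row_(i < m) a (i.+1%:R / m%:R)).

Lemma LT_order (n m : nat) : (m * (n %/ m) + n %% m = n)%N.
Proof. by rewrite mulnC -divn_eq. Qed.

Definition LT_mx (R : realType) (n m : nat) (a h : R -> R[i]) : 'M[R[i]]_n :=
  castmx (LT_order n m, LT_order n m)
    (block_mx (diag_sampling m a *t toeplitz (n %/ m) h) 0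
              0 (0 : 'M[R[i]]_(n %% m))).

(* m ranges over the positive integers: n %/ m is not meaningful for m = 0. *)
Definition is_LT (R : realType) (A : mxseq R) (a h : R -> R[i]) : Prop :=
  [/\ riemann_integrable01 a, cintegrable_pi h
    & acs [set m | (0 < m)%N] (fun m n => LT_mx n m a h) A].

Definition is_GLT (R : realType) (A : mxseq R) (f : Dfun R) : Prop :=
  measurable_on_D f /\
  exists (M : set nat) (k : nat -> nat) (a h : nat -> nat -> R -> R[i])
      (L : nat -> nat -> mxseq R),
    [/\ infinite_set M,
        forall m, M m -> forall i, (i < k m)%N -> is_LT (L m i) (a m i) (h m i),
        cvg_in_measure_on_D M
          (fun m z => \sum_(i < k m) a m i z.1 * h m i z.2) f
      & acs M (fun m n => \sum_(i < k m) L m i n) A].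

(* Main.v *)
Require Import Defs.
From mathcomp Require Import measurable_realfun zify ring lra.
Set Implicit Arguments.
Unset Strict Implicit.
Unset Printing Implicit Defensive.

(** Everything happens up to the error allowed by an a.c.s.: a sequence [Y] is
    [small e] when, for large n, [Y n] is a matrix of rank at most [e * n] plus
    a matrix of norm at most [e]. The theorem follows from two facts.

    The first is that a GLT symbol determines its sequence up to this error.
    Finite sums of c 1_(x <= t) e^(i j theta) form a *-algebra of
    step-trigonometric symbols. To such a symbol [pval l] corresponds an
    explicit sequence [lmat l], the sum of the products c D Z_j of a truncated
    identity D and a shift Z_j, and this correspondence respects products and
    adjoints up to matrices of bounded rank ([lmat_mul], [lmat_adj]). If such a
    symbol is small in measure, its sequence is small ([small_of_measure]): the
    normalized trace of a power of W = 1 - X^* X / K, for X = [lmat l n], tends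
    to the mean of the corresponding power of 1 - |p|^2 / K, which is close to 1
    since p is small off a small set, and this leaves room for few large
    singular values of X. Say that [A] has the symbol [f], [approx A f], when
    for each e > 0 some step-trigonometric symbol is e-close to f in measure
    while its sequence is e-close to [A]. An LT sequence has the symbol a(x)
    h(theta) ([is_LT_approx]): a Riemann integrable a is close to step functions
    on fine grids, h is L1-close to a trigonometric polynomial ([trig_dense]),
    and a Toeplitz matrix with an L1-small symbol is small ([toeplitz_small]).
    Passing to sums and to limits, every GLT sequence has its symbol
    ([is_GLT_approx]). Hence two sequences whose symbols are uniformly close
    differ by a small one ([approx_small]).

    The second is that the norm bounded sequences which are nearly diagonal in
    the basis given by U, that is, small-close to sequences diagonal in that
    basis, are closed under sums, products and adjoints. Products need norm
    bounded diagonal approximants. They exist because a diagonal matrix that is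
    close to a bounded one has few large entries, which may be replaced by zero
    ([udiag_trunc], [near_diag_trunc]).

    Therefore the bounded symbols that are uniform limits of symbols of norm
    bounded nearly diagonal sequences form a C*-algebra
    ([cluster_algebra_Cstar]). It contains each f_i, since P_U(A_n(f_i)) is
    diagonal in the basis and clusters to A_n(f_i); so it contains the algebra
    that the f_i generate. If g belongs to it, the first fact makes every
    sequence with symbol g nearly diagonal ([cluster_algebra_near_diag]). At
    last, P_U gives the best diagonal approximation in Frobenius norm, and for
    norm bounded sequences being small amounts to a Frobenius norm o(sqrt n), so
    a norm bounded nearly diagonal sequence clusters at its own projection
    ([near_diag_cluster]). *)

Local Notation Re := complex.Re.
Local Notation Im := complex.Im.
Local Notation normc := Normc.normc.

(** * Operator bounds *)

Section L2.
Context {R : realType}.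
Local Notation C := R[i].
Implicit Types n : nat.

Lemma normcE (z : C) : ((normc z)%:C)%C = `|z|.
Proof. by []. Qed.

Lemma normC_sqr (z : C) : ((normc z ^+ 2)%:C)%C = z^* * z.
Proof.
by rewrite rmorphXn /= normcE normCK mulrC.
Qed.

Lemma normc_conj (z : C) : normc z^* = normc z.
Proof. by apply: (@complexI R); rewrite !normcE norm_conjC. Qed.

Lemma normc_ge0 (z : C) : 0 <= normc z.
Proof. by case: z => a b; exact: sqrtr_ge0. Qed.

Lemma re_le_normc (z : C) : Re z <= normc z.
Proof.
by case: z => x y /=; rewrite (le_trans (ler_norm x))// -sqrtr_sqr ler_wsqrtr// lerDl sqr_ge0.
Qed.

Lemma im_le_normc (z : C) : Im z <= normc z.
Proof.
by case: z => x y /=; rewrite (le_trans (ler_norm y))// -sqrtr_sqr ler_wsqrtr// lerDr sqr_ge0.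
Qed.

Lemma normc_le_ReIm (z : C) : normc z <= `|Re z| + `|Im z|.
Proof.
case: z => x y /=; rewrite -[leRHS]ger0_norm ?addr_ge0// -sqrtr_sqr ler_wsqrtr//.
rewrite sqrrD !real_normK ?num_real//; have := mulr_ge0 (normr_ge0 x) (normr_ge0 y); lra.
Qed.

Lemma l2norm_ge0 n (x : 'cV[C]_n) : 0 <= l2norm x.
Proof. exact: sqrtr_ge0. Qed.

Lemma sqr_l2norm n (x : 'cV[C]_n) :
  l2norm x ^+ 2 = \sum_(i < n) normc (x i ord0) ^+ 2.
Proof. by rewrite sqr_sqrtr// sumr_ge0// => i _; exact: sqr_ge0. Qed.

Lemma l2normE n (x : 'cV[C]_n) :
  ((l2norm x ^+ 2)%:C)%C = (x^t* *m x) ord0 ord0.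
Proof.
rewrite sqr_l2norm rmorph_sum mxE; apply: eq_bigr => i _ /=.
by rewrite normC_sqr !mxE.
Qed.

Lemma cauchy_sum n (a b : 'I_n -> R) :
  (\sum_i a i * b i) ^+ 2 <= (\sum_i a i ^+ 2) * (\sum_i b i ^+ 2).
Proof.
set P := \sum_i _ * _; set A := \sum_i a i ^+ 2; set B := \sum_i b i ^+ 2.
have B0 : 0 <= B by rewrite sumr_ge0// => i _; exact: sqr_ge0.
have [Bz|Bnz] := eqVneq B 0.
  have b0 i : b i = 0.
    move/eqP: Bz; rewrite psumr_eq0 => [/allP h|j _]; last exact: sqr_ge0.
    by have := h i (mem_index_enum _); rewrite sqrf_eq0 => /eqP.
  by rewrite Bz mulr0 /P big1 ?expr0n// => i _; rewrite b0 mulr0.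
have Bp : 0 < B by rewrite lt_neqAle eq_sym Bnz.
rewrite -subr_ge0 -(pmulr_rge0 _ Bp).
have <- : \sum_i (a i * B - b i * P) ^+ 2 = B * (A * B - P ^+ 2).
  transitivity (\sum_i (a i ^+ 2 * B ^+ 2 - (a i * b i) * (2 * B * P) + b i ^+ 2 * P ^+ 2)).
    by apply: eq_bigr => i _; ring.
  by rewrite big_split /= sumrB -!mulr_suml -/A -/B -/P; ring.
by rewrite sumr_ge0// => i _; exact: sqr_ge0.
Qed.

Lemma cauchy_l2norm n (x y : 'cV[C]_n) :
  \sum_i normc (x i ord0) * normc (y i ord0) <= l2norm x * l2norm y.
Proof.
rewrite -(@ler_pXn2r _ 2)// ?nnegrE ?mulr_ge0 ?l2norm_ge0//.
  by rewrite exprMn !sqr_l2norm cauchy_sum.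
by rewrite sumr_ge0// => i _; rewrite mulr_ge0 ?normc_ge0.
Qed.

Lemma l2normD n (x y : 'cV[C]_n) : l2norm (x + y) <= l2norm x + l2norm y.
Proof.
rewrite -(@ler_pXn2r _ 2)// ?nnegrE ?addr_ge0 ?l2norm_ge0//.
apply: (@le_trans _ _ (\sum_i (normc (x i ord0) + normc (y i ord0)) ^+ 2)).
  rewrite sqr_l2norm ler_sum// => i _; rewrite mxE.
  by rewrite ler_pXn2r ?nnegrE ?addr_ge0 ?normc_ge0// le_normcD.
rewrite (eq_bigr _ (fun i _ => sqrrD _ _)) !big_split /= -!sqr_l2norm sqrrD.
by rewrite lerD// lerD// lerD// cauchy_l2norm.
Qed.

Lemma normc_sum (I : Type) (s : seq I) (P : pred I) (F : I -> C) :
  normc (\sum_(i <- s | P i) F i) <= \sum_(i <- s | P i) normc (F i).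
Proof.
elim/big_rec2: _ => [|i y z _ h]; first by rewrite Normc.normc0.
by rewrite (le_trans (le_normcD _ _))// lerD2l.
Qed.

Lemma l2norm_CS n (x y : 'cV[C]_n) :
  normc ((x^t* *m y) ord0 ord0) <= l2norm x * l2norm y.
Proof.
rewrite mxE (le_trans (normc_sum _ _ _))// (le_trans _ (cauchy_l2norm _ _))//.
by apply: ler_sum => i _; rewrite !mxE Normc.normcM normc_conj.
Qed.

Lemma l2normZ n (c : C) (x : 'cV[C]_n) : l2norm (c *: x) = normc c * l2norm x.
Proof.
rewrite /l2norm; under eq_bigr do rewrite mxE Normc.normcM exprMn.
by rewrite -mulr_sumr sqrtrM ?sqr_ge0// sqrtr_sqr ger0_norm// normc_ge0.
Qed.

Lemma l2norm0 n : l2norm (0 : 'cV[C]_n) = 0.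
Proof. by rewrite -(scale0r (0 : 'cV[C]_n)) l2normZ Normc.normc0 mul0r. Qed.

Lemma l2norm_eq0 n (x : 'cV[C]_n) : l2norm x = 0 -> x = 0.
Proof.
move=> x0; have := sqr_l2norm x; rewrite x0 expr0n /= => /esym/eqP.
rewrite psumr_eq0 => [/allP h|i _]; last exact: sqr_ge0.
apply/matrixP => i j; rewrite ord1 mxE; apply: Normc.eq0_normc.
by have := h i (mem_index_enum _); rewrite sqrf_eq0 => /eqP.
Qed.

Lemma l2norm_le n m (x : 'cV[C]_n) (y : 'cV[C]_m) :
  \sum_i normc (x i ord0) ^+ 2 <= \sum_i normc (y i ord0) ^+ 2 ->
  l2norm x <= l2norm y.
Proof. by move=> h; rewrite ler_wsqrtr. Qed.

(** Bounding the operator pointwise avoids the supremum in [spectral_norm], and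
    [spectral_normP] translates between the two. *)
Definition opb n (A : 'M[C]_n) (c : R) := forall x, l2norm (A *m x) <= c * l2norm x.

Lemma opb_le n (A : 'M[C]_n) c d : opb A c -> c <= d -> opb A d.
Proof. by move=> h cd x; rewrite (le_trans (h x))// ler_wpM2r// l2norm_ge0. Qed.

Lemma opbD n (A B : 'M[C]_n) c d : opb A c -> opb B d -> opb (A + B) (c + d).
Proof.
by move=> hA hB x; rewrite mulmxDl mulrDl (le_trans (l2normD _ _))// lerD.
Qed.

Lemma opbM n (A B : 'M[C]_n) c d : 0 <= c -> opb A c -> opb B d -> opb (A *m B) (c * d).
Proof.
move=> c0 hA hB x; rewrite -mulmxA (le_trans (hA _))// -mulrA ler_wpM2l//.
Qed.

Lemma opbZ n (A : 'M[C]_n) c (z : C) : opb A c -> opb (z *: A) (normc z * c).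
Proof.
by move=> hA x; rewrite -scalemxAl l2normZ -mulrA ler_wpM2l// normc_ge0.
Qed.

Lemma opbN n (A : 'M[C]_n) c : opb A c -> opb (- A) c.
Proof.
by move=> hA x; rewrite mulNmx -scaleN1r l2normZ normcN Normc.normc1 mul1r.
Qed.

Lemma opbB n (A B : 'M[C]_n) c d : opb A c -> opb B d -> opb (A - B) (c + d).
Proof. by move=> hA hB; apply: opbD => //; exact: opbN. Qed.

Lemma opb0 n : opb (0 : 'M[C]_n) 0.
Proof. by move=> x; rewrite mul0mx l2norm0 mul0r. Qed.

Lemma opb1 n : opb (1%:M : 'M[C]_n) 1.
Proof. by move=> x; rewrite mul1mx mul1r. Qed.

Lemma opb_sum n (I : Type) (s : seq I) (F : I -> 'M[C]_n) (c : I -> R) :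
  (forall i, opb (F i) (c i)) -> opb (\sum_(i <- s) F i) (\sum_(i <- s) c i).
Proof.
move=> h; elim: s => [|a s ih]; first by rewrite !big_nil; exact: opb0.
by rewrite !big_cons; apply: opbD.
Qed.

(** With y = A^* x, |y|^2 = <x, A y> <= |x| c |y|. *)
Lemma opb_adj n (A : 'M[C]_n) c : 0 <= c -> opb A c -> opb (A^t*) c.
Proof.
move=> c0 hA x; set y := A^t* *m x.
have [->|y0] := eqVneq (l2norm y) 0; first by rewrite mulr_ge0// l2norm_ge0.
have yp : 0 < l2norm y by rewrite lt_neqAle eq_sym y0 l2norm_ge0.
rewrite -(ler_pM2l yp) -expr2.
have -> : l2norm y ^+ 2 = normc ((x^t* *m (A *m y)) ord0 ord0).
  apply: (@complexI R); rewrite normcE.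
  rewrite {1}[l2norm y ^+ 2]lock; unlock; rewrite l2normE.
  rewrite {1}/y trmx_mul map_mxM trmxCK -mulmxA ger0_norm//.
  rewrite mulmxA; have := l2normE y.
  rewrite {2}/y trmx_mul map_mxM trmxCK => <-.
  by rewrite lecR sqr_ge0.
rewrite (le_trans (l2norm_CS _ _))// [leRHS]mulrCA mulrA [_ * l2norm x]mulrC ler_wpM2l ?l2norm_ge0//.
Qed.

Lemma opb_unitary n (U : 'M[C]_n) : U \is unitarymx -> forall x, l2norm (U *m x) = l2norm x.
Proof.
move=> hU x; apply/eqP; rewrite -(@eqrXn2 _ 2) ?l2norm_ge0//; apply/eqP.
apply: (@complexI R); rewrite !l2normE trmx_mul map_mxM -mulmxA (mulmxA _ U).
move: (hU); rewrite -trmxC_unitary => /unitarymxP; rewrite trmxCK => ->.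
by rewrite mul1mx.
Qed.

Lemma opb_ex n (A : 'M[C]_n) : exists2 c, 0 <= c & opb A c.
Proof.
pose c := \sum_i \sum_j normc (A i j).
have nn : forall i, 0 <= \sum_j normc (A i j).
  by move=> i; rewrite sumr_ge0// => j _; exact: normc_ge0.
exists c; first by rewrite sumr_ge0.
move=> x.
have -> : A = \sum_i \sum_j A i j *: delta_mx i j.
  rewrite [LHS]matrix_sum_delta; apply: eq_bigr => i _; apply: eq_bigr => j _ //.
rewrite /c; apply: (@opb_sum _ _ _ _ (fun i => \sum_j normc (A i j))) => i.
apply: (@opb_sum _ _ _ _ (fun j => normc (A i j))) => j.
rewrite -[X in opb _ X]mulr1; apply: opbZ => y; rewrite mul1r.
apply: l2norm_le; rewrite (bigD1 i)//= big1 ?addr0 => [|k ki].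
  rewrite mxE (bigD1 j)//= big1 ?addr0 => [|k kj].
    by rewrite mxE !eqxx mul1r (bigD1 j)//= lerDl sumr_ge0// => k _; exact: sqr_ge0.
  by rewrite mxE (negbTE kj) andbF mul0r.
by rewrite mxE big1 ?Normc.normc0 ?expr0n// => k' _; rewrite mxE (negbTE ki) mul0r.
Qed.

Lemma spectral_normP n (A : 'M[C]_n) c : 0 <= c -> spectral_norm A <= c <-> opb A c.
Proof.
move=> c0; have [d d0 hd] := opb_ex A.
have hs : has_sup [set l2norm (A *m x) | x in [set x | l2norm x <= 1]].
  split; first by exists (l2norm (A *m 0)), 0 => //=; rewrite l2norm0.
  exists d => _ [x /= x1 <-]; rewrite (le_trans (hd x))//.
  by rewrite -[leRHS]mulr1 ler_wpM2l.
split=> [h x|h].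
  have [x0|x0] := eqVneq (l2norm x) 0.
    by rewrite (l2norm_eq0 x0) mulmx0 l2norm0 mulr0.
  have xp : 0 < l2norm x by rewrite lt_neqAle eq_sym x0 l2norm_ge0.
  pose y := ((l2norm x)^-1%:C)%C *: x.
  have nz : normc ((l2norm x)^-1%:C)%C = (l2norm x)^-1.
    by rewrite /= expr0n addr0 sqrtr_sqr ger0_norm// invr_ge0 ltW.
  have y1 : l2norm y <= 1 by rewrite l2normZ nz mulVf.
  have : l2norm (A *m y) <= c.
    by apply: le_trans h; apply: ub_le_sup; [exact: hs.2|exists y].
  by rewrite -scalemxAr l2normZ nz mulrC ler_pdivrMr.
apply: ge_sup; first exact: hs.1.
by move=> _ [x /= x1 <-]; rewrite (le_trans (h x))// -[leRHS]mulr1 ler_wpM2l.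
Qed.

End L2.

(** * Frobenius norms, ranks and singular values *)

Section Spec.
Context {R : realType}.
Local Notation C := R[i].

Lemma trmxCM n m p (A : 'M[C]_(n, m)) (B : 'M[C]_(m, p)) : (A *m B)^t* = B^t* *m A^t*.
Proof. by rewrite trmx_mul map_mxM. Qed.

Lemma trmxCD n m (A B : 'M[C]_(n, m)) : (A + B)^t* = A^t* + B^t*.
Proof. by rewrite linearD /= map_mxD. Qed.

Lemma trmxCN n m (A : 'M[C]_(n, m)) : (- A)^t* = - A^t*.
Proof. by rewrite linearN /= map_mxN. Qed.

Lemma trmxCZ n m (c : C) (A : 'M[C]_(n, m)) : (c *: A)^t* = c^* *: A^t*.
Proof. by rewrite linearZ /= map_mxZ. Qed.

Lemma unitary_mulV n (U : 'M[C]_n) : U \is unitarymx -> U *m U^t* = 1%:M.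
Proof. by move/unitarymxP. Qed.

Lemma unitary_mulVr n (U : 'M[C]_n) : U \is unitarymx -> U^t* *m U = 1%:M.
Proof. by rewrite -trmxC_unitary => /unitarymxP; rewrite trmxCK. Qed.

Lemma conj_mulmx n (Vs V X Y : 'M[C]_n) : V *m Vs = 1%:M ->
  (Vs *m X *m V) *m (Vs *m Y *m V) = Vs *m (X *m Y) *m V.
Proof. by move=> h; rewrite !mulmxA -(mulmxA _ V Vs) h mulmx1. Qed.

Lemma rank_trmxC n (A : 'M[C]_n) : \rank (A^t*) = \rank A.
Proof. by rewrite mxrank_map mxrank_tr. Qed.

Definition frob2 n (A : 'M[C]_n) : R := \sum_i \sum_j normc (A i j) ^+ 2.

Lemma frob2_ge0 n (A : 'M[C]_n) : 0 <= frob2 A.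
Proof. by rewrite sumr_ge0// => i _; rewrite sumr_ge0// => j _; exact: sqr_ge0. Qed.

Lemma frob2E n (A : 'M[C]_n) : ((frob2 A)%:C)%C = \tr (A^t* *m A).
Proof.
rewrite /frob2 exchange_big rmorph_sum; apply: eq_bigr => i _ /=.
rewrite rmorph_sum mxE; apply: eq_bigr => j _ /=.
by rewrite normC_sqr !mxE.
Qed.

Lemma frob2D n (A B : 'M[C]_n) : frob2 (A + B) <= 2 * frob2 A + 2 * frob2 B.
Proof.
rewrite !mulr_sumr -big_split ler_sum// => i _.
rewrite !mulr_sumr -big_split ler_sum// => j _ /=.
rewrite mxE; have := @le_normcD _ (A i j) (B i j).
move: (normc_ge0 (A i j)) (normc_ge0 (B i j)) (normc_ge0 (A i j + B i j)).
set a := normc _; set b := normc _; set c := normc _.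
move=> a0 b0 c0 h; have : c ^+ 2 <= (a + b) ^+ 2.
  by rewrite ler_pXn2r ?nnegrE ?addr_ge0.
move=> /le_trans; apply; rewrite sqrrD; have := sqr_ge0 (a - b); rewrite sqrrB.
lra.
Qed.

Lemma frob2_col n (A : 'M[C]_n) : frob2 A = \sum_j l2norm (A *m delta_mx j ord0 : 'cV_n) ^+ 2.
Proof.
rewrite /frob2 exchange_big; apply: eq_bigr => j _ /=.
rewrite sqr_l2norm; apply: eq_bigr => i _.
by rewrite -colE mxE.
Qed.

Lemma l2norm_delta n (j : 'I_n) : l2norm (delta_mx j ord0 : 'cV[C]_n) = 1.
Proof.
rewrite /l2norm (bigD1 j)//= big1 => [|i ij].
  by rewrite mxE !eqxx mulr1n Normc.normc1 expr1n addr0 sqrtr1.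
by rewrite mxE (negbTE ij) Normc.normc0 expr0n.
Qed.

Lemma frob2_opb n (A : 'M[C]_n) c : 0 <= c -> opb A c -> frob2 A <= n%:R * c ^+ 2.
Proof.
move=> c0 h; rewrite frob2_col -[n in n%:R]card_ord mulr_natl -sumr_const.
apply: ler_sum => j _; rewrite ler_pXn2r ?nnegrE ?l2norm_ge0//.
by rewrite (le_trans (h _))// l2norm_delta mulr1.
Qed.

Definition diagC n (d : 'I_n -> R) : 'M[C]_n := diag_mx (\row_i ((d i)%:C)%C).

Lemma diagCM n (d e : 'I_n -> R) : diagC d *m diagC e = diagC (fun i => d i * e i).
Proof.
rewrite /diagC mulmx_diag; congr diag_mx; apply/matrixP => i j.
by rewrite !mxE -rmorphM.
Qed.

Lemma diagC1 n : diagC (fun _ : 'I_n => 1) = 1%:M.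
Proof. by apply/matrixP => i j; rewrite !mxE. Qed.

Lemma diagCB n (d e : 'I_n -> R) : diagC d - diagC e = diagC (fun i => d i - e i).
Proof. by rewrite /diagC -linearB; congr diag_mx; apply/matrixP => i j; rewrite !mxE -rmorphB. Qed.

Lemma diagCZ n (a : R) (e : 'I_n -> R) : (a%:C)%C *: diagC e = diagC (fun i => a * e i).
Proof. by rewrite /diagC -linearZ; congr diag_mx; apply/matrixP => i j; rewrite !mxE -rmorphM. Qed.

Lemma mxtrace_diagC n (d : 'I_n -> R) : \tr (diagC d) = ((\sum_i d i)%:C)%C.
Proof.
by rewrite mxtrace_diag rmorph_sum; apply: eq_bigr => i _; rewrite mxE.
Qed.

(** The row selector of S acts as the identity on A. *)
Lemma rank_rows n (A : 'M[C]_n) (S : pred 'I_n) :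
  (forall i, ~~ S i -> forall j, A i j = 0) -> (\rank A <= #|S|)%N.
Proof.
move=> h; have -> : A = (\sum_(i in S) delta_mx i i) *m A.
  apply/matrixP => i j; rewrite mulmx_suml summxE.
  under eq_bigr => k _.
    rewrite mxE (bigD1 k)//= big1 ?addr0 => [|l lk]; last first.
      by rewrite mxE (negbTE lk) andbF mul0r.
    rewrite mxE eqxx andbT; over.
  have [iS|iS] := boolP (S i); last first.
    rewrite h// big1// => k kS; rewrite (_ : i == k = false) ?mul0r//.
    by apply/eqP => ik; move: iS; rewrite ik unfold_in in kS *; rewrite kS.
  rewrite (bigD1 i)//= big1 ?addr0 => [|k /andP[_ ki]]; last first.
    by rewrite eq_sym (negbTE ki) mul0r.
  by rewrite eqxx mul1r.
rewrite (leq_trans (mxrankM_maxl _ _))//.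
rewrite -sum1_card; elim/big_rec2: _ => [|i y z _ ih]; first by rewrite mxrank0.
by rewrite (leq_trans (mxrank_add _ _))// mxrank_delta leq_add2l.
Qed.

Lemma hermitian_spectral n (A : 'M[C]_n) : A^t* = A ->
  exists (V : 'M[C]_n) (d : 'I_n -> R),
    V \is unitarymx /\ A = V^t* *m diagC d *m V.
Proof.
move=> hA; have Ah : A \is hermsymmx.
  by apply/is_hermitianmxP; rewrite expr0 scale1r hA.
have /orthomx_spectralP := hermitian_normalmx Ah.
have := hermitian_spectral_diag_real Ah; have := spectral_unitarymx A.
move: (spectralmx A) (spectral_diag A) => V d hV /mxOverP dr Ae.
exists V, (fun i => Re (d 0 i)); split => //.
have -> : diagC (fun i => Re (d 0 i)) = diag_mx d.
  by congr diag_mx; apply/matrixP => i j; rewrite mxE ord1 RRe_real.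
by rewrite -(invmx_unitary hV).
Qed.

Section gram.
Variables (n : nat) (X V : 'M[C]_n) (d : 'I_n -> R).
Hypothesis hV : V \is unitarymx.
Hypothesis hX : X^t* *m X = V^t* *m diagC d *m V.

Lemma gram_norm (x : 'cV[C]_n) :
  l2norm (X *m x) ^+ 2 = \sum_i d i * normc ((V *m x) i ord0) ^+ 2.
Proof.
apply: (@complexI R); rewrite l2normE trmxCM -mulmxA (mulmxA _ X) hX.
have -> : x^t* *m (V^t* *m diagC d *m V *m x) = (V *m x)^t* *m (diagC d *m (V *m x)).
  by rewrite trmxCM !mulmxA.
rewrite mxE rmorph_sum; apply: eq_bigr => i _ /=.
rewrite rmorphM /= normC_sqr /diagC mul_diag_mx !mxE mulrCA.
by congr (_ * (_ * _)).
Qed.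

Lemma gram_col i : d i = l2norm (X *m (V^t* *m (delta_mx i ord0 : 'cV_n))) ^+ 2.
Proof.
rewrite gram_norm (bigD1 i)//= big1 => [|j ji].
  rewrite mulmxA unitary_mulV// mul1mx mxE !eqxx mulr1n Normc.normc1 expr1n mulr1.
  by rewrite addr0.
rewrite mulmxA unitary_mulV// mul1mx mxE (negbTE ji) Normc.normc0.
by rewrite expr0n mulr0.
Qed.

Lemma gram_ge0 i : 0 <= d i.
Proof. by rewrite gram_col sqr_ge0. Qed.

Lemma gram_le c i : 0 <= c -> opb X c -> d i <= c ^+ 2.
Proof.
move=> c0 h; rewrite gram_col ler_pXn2r ?nnegrE ?l2norm_ge0//.
by rewrite (le_trans (h _))// opb_unitary ?trmxC_unitary// l2norm_delta mulr1.
Qed.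

Lemma gram_sum : frob2 X = \sum_i d i.
Proof.
apply: (@complexI R); rewrite frob2E hX mxtrace_mulC mulmxA unitary_mulV// mul1mx.
by rewrite mxtrace_diagC.
Qed.

(** X is cut along the spectral projectors of X^* X belonging to the indices
    inside and outside S: on the latter X is bounded by sqrt eta. *)
Lemma gram_split (S : pred 'I_n) eta : 0 <= eta ->
  (forall i, ~~ S i -> d i <= eta) ->
  exists Rn Nn, [/\ X = Rn + Nn, (\rank Rn <= #|S|)%N & opb Nn (Num.sqrt eta)].
Proof.
move=> e0 hS; pose E (P : pred 'I_n) := V^t* *m diagC (fun i => (P i)%:R) *m V.
exists (X *m E S), (X *m E (predC S)); split.
- rewrite -mulmxDr /E -mulmxDl -mulmxDr.
  rewrite (_ : _ + _ = 1%:M) ?mulmx1 ?unitary_mulVr ?mulmx1//.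
  apply/matrixP => i j; rewrite !mxE; case: eqP => [->|_]; rewrite ?addr0//.
  by rewrite !mulr1n -rmorphD -natrD /predC /=; case: (S j).
- rewrite (leq_trans (mxrankM_maxr _ _))// /E (leq_trans (mxrankM_maxl _ _))//.
  rewrite (leq_trans (mxrankM_maxr _ _))//; apply: rank_rows => i iS j.
  by rewrite !mxE (negbTE iS); case: eqP.
- move=> x; rewrite -(@ler_pXn2r _ 2)// ?nnegrE ?mulr_ge0 ?l2norm_ge0 ?sqrtr_ge0//.
  rewrite exprMn (sqr_sqrtr e0) -(mulmxA X (E (predC S)) x).
rewrite gram_norm.
  rewrite -(opb_unitary hV x) sqr_l2norm mulr_sumr ler_sum// => i _.
  rewrite /E !mulmxA unitary_mulV// mul1mx -(mulmxA _ V x) /diagC mul_diag_mx.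
  set y := V *m x; rewrite !mxE /predC /=; have [iS|iS] := boolP (S i).
    by rewrite [_%:R]/(0) rmorph0 mul0r Normc.normc0 expr0n mulr0 mulr_ge0// sqr_ge0.
  by rewrite [true%:R]/(1) rmorph1 mul1r ler_wpM2r ?sqr_ge0 ?hS.
Qed.

End gram.

(** The d i are the squared singular values of X. The lemmas above read norms,
    ranks and splittings of X off them, which replaces a singular value
    decomposition. *)
Lemma gram_spectral n (X : 'M[C]_n) : exists (V : 'M[C]_n) (d : 'I_n -> R),
    V \is unitarymx /\ X^t* *m X = V^t* *m diagC d *m V.
Proof. by apply: hermitian_spectral; rewrite trmxCM trmxCK. Qed.

(** At most rank X of the squared singular values are nonzero, and each is at
    most c^2. *)
Lemma frob2_rank n (X : 'M[C]_n) c : 0 <= c -> opb X c ->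
  frob2 X <= (\rank X)%:R * c ^+ 2.
Proof.
move=> c0 h; have [V [d [hV hX]]] := gram_spectral X.
rewrite (gram_sum hV hX) (bigID (fun i => d i == 0))/= big1 ?add0r; last first.
  by move=> i /eqP.
apply: (@le_trans _ _ (\sum_(i | d i != 0) c ^+ 2)).
  by apply: ler_sum => i _; exact: (gram_le hV hX i c0 h).
rewrite sumr_const -[leLHS]mulr_natl ler_wpM2r ?sqr_ge0// ler_nat.
have WE : V *m (X^t* *m X) *m V^t* = diagC d.
  by rewrite hX !mulmxA unitary_mulV// mul1mx -!mulmxA unitary_mulV// mulmx1.
pose S := [pred i | d i != 0].
have rW : (\rank (diagC d) <= \rank X)%N.
  rewrite -WE (leq_trans (mxrankM_maxl _ _))// (leq_trans (mxrankM_maxr _ _))//.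
  by rewrite mxrankM_maxr.
apply: leq_trans rW; pose E := diagC (fun i => (S i)%:R).
have rE : (\rank E <= \rank (diagC d))%N.
  have -> : E = diagC d *m diagC (fun i => (d i)^-1).
    rewrite diagCM; congr diag_mx; apply/matrixP => i j; rewrite !mxE /S /=.
    by have [->|d0] := eqVneq (d j) 0; rewrite ?mul0r// divff.
  exact: mxrankM_maxl.
apply: leq_trans rE.
have rE' : (\rank (1%:M - E)%R <= #|predC S|)%N.
  apply: rank_rows => i; rewrite negbK => iS j; rewrite !mxE.
  case: (i =P j) => [_|_]; last by rewrite mulr0n subrr.
  by rewrite (_ : S i = true)// !mulr1n subrr.
have : (\rank (E + (1%:M - E))%R <= \rank E + #|predC S|)%N.
  by rewrite (leq_trans (mxrank_add _ _))// leq_add2l.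
by rewrite addrC subrK mxrank1 -{1}[n]card_ord -(cardC S) leq_add2r.
Qed.

End Spec.

(** * Norm bounded and small matrix sequences *)

Section Small.
Context {R : realType}.
Local Notation C := R[i].
Implicit Types A B Y : mxseq R.

Definition bounded_by A (c : R) := forall n, opb (A n) c.
Definition bounded A := exists2 c : R, 0 <= c & bounded_by A c.

(** The a.c.s. size of a sequence, with one number e for the rank and for the
    norm: {B_(n,m)} is an a.c.s. for {A_n} when the size of A - B_m tends to 0
    with m. *)
Definition small (e : R) Y := exists n0, forall n, (n0 <= n)%N ->
  exists Rn Nn : 'M[C]_n, [/\ Y n = Rn + Nn, (\rank Rn)%:R <= e * n%:R & opb Nn e].

Lemma norm_boundedP A : norm_bounded A <-> bounded A.
Proof.
split=> [[c hc]|[c c0 hc]]; last first.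
  by exists c => n; apply/spectral_normP.
exists (Num.max 0 c); first by rewrite le_max lexx.
move=> n; apply/spectral_normP; first by rewrite le_max lexx.
by rewrite (le_trans (hc n))// le_max lexx orbT.
Qed.

Lemma bounded_ge1 A : bounded A -> exists2 c : R, 1 <= c & bounded_by A c.
Proof.
move=> [c c0 h]; exists (c + 1); first by rewrite lerDr.
by move=> n; apply: opb_le (h n) _; rewrite lerDl.
Qed.

Lemma boundedD A B : bounded A -> bounded B -> bounded (fun n => A n + B n).
Proof.
move=> [c c0 hc] [d d0 hd]; exists (c + d); first exact: addr_ge0.
by move=> n; apply: opbD.
Qed.

Lemma boundedZ A (z : C) : bounded A -> bounded (fun n => z *: A n).
Proof.
move=> [c c0 hc]; exists (normc z * c); first by rewrite mulr_ge0// normc_ge0.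
by move=> n; apply: opbZ.
Qed.

Lemma boundedN A : bounded A -> bounded (fun n => - A n).
Proof. by move=> [c c0 hc]; exists c => // n; apply: opbN. Qed.

Lemma boundedM A B : bounded A -> bounded B -> bounded (fun n => A n *m B n).
Proof.
move=> [c c0 hc] [d d0 hd]; exists (c * d); first exact: mulr_ge0.
by move=> n; apply: opbM.
Qed.

Lemma bounded_adj A : bounded A -> bounded (fun n => (A n)^t*).
Proof. by move=> [c c0 hc]; exists c => // n; apply: opb_adj. Qed.

Lemma bounded0 : bounded (fun n => (0 : 'M[C]_n)).
Proof. by exists 0 => // n; exact: opb0. Qed.

Lemma small_le e e' Y : e <= e' -> small e Y -> small e' Y.
Proof.
move=> le [n0 h]; exists n0 => n hn; have [Rn [Nn [hY hr hN]]] := h n hn.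
exists Rn, Nn; split=> //; last exact: opb_le hN le.
by rewrite (le_trans hr)// ler_wpM2r.
Qed.

Lemma eq_small e Y Y' : (forall n, Y n = Y' n) -> small e Y -> small e Y'.
Proof.
by move=> h [n0 hs]; exists n0 => n /hs [Rn [Nn [hY hr hN]]]; exists Rn, Nn; rewrite -h.
Qed.

Lemma smallD e e' Y Y' : small e Y -> small e' Y' -> small (e + e') (fun n => Y n + Y' n).
Proof.
move=> [n0 h] [n1 h']; exists (maxn n0 n1) => n; rewrite geq_max => /andP[/h + /h'].
move=> [Rn [Nn [hY hr hN]]] [Rn' [Nn' [hY' hr' hN']]].
exists (Rn + Rn'), (Nn + Nn'); split; last exact: opbD.
  by rewrite hY hY' addrACA.
rewrite mulrDl (le_trans _ (lerD hr hr'))// -natrD ler_nat; exact: mxrank_add.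
Qed.

Lemma smallN e Y : small e Y -> small e (fun n => - Y n).
Proof.
move=> [n0 h]; exists n0 => n /h [Rn [Nn [hY hr hN]]].
exists (- Rn), (- Nn); split; rewrite ?mxrank_opp//; last exact: opbN.
by rewrite hY opprD.
Qed.

Lemma smallB e e' Y Y' : small e Y -> small e' Y' -> small (e + e') (fun n => Y n - Y' n).
Proof. by move=> h /smallN h'; apply: smallD. Qed.

Lemma smallMl e c B Y : 1 <= c -> 0 <= e -> bounded_by B c -> small e Y ->
  small (c * e) (fun n => B n *m Y n).
Proof.
move=> c1 e0 hB [n0 h]; exists n0 => n /h [Rn [Nn [hY hr hN]]].
exists (B n *m Rn), (B n *m Nn); split.
- by rewrite hY mulmxDr.
- rewrite (@le_trans _ _ (\rank Rn)%:R) ?ler_nat ?mxrankM_maxr//.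
  by rewrite (le_trans hr)// ler_wpM2r// ler_peMl.
- by apply: opbM => //; rewrite (le_trans _ c1).
Qed.

Lemma smallMr e c B Y : 1 <= c -> 0 <= e -> bounded_by B c -> small e Y ->
  small (c * e) (fun n => Y n *m B n).
Proof.
move=> c1 e0 hB [n0 h]; exists n0 => n /h [Rn [Nn [hY hr hN]]].
exists (Rn *m B n), (Nn *m B n); split.
- by rewrite hY mulmxDl.
- rewrite (@le_trans _ _ (\rank Rn)%:R) ?ler_nat ?mxrankM_maxl//.
  by rewrite (le_trans hr)// ler_wpM2r// ler_peMl.
- by rewrite mulrC; apply: opbM.
Qed.

Lemma smallZ e c (z : C) Y : 1 <= c -> 0 <= e -> normc z <= c -> small e Y ->
  small (c * e) (fun n => z *: Y n).
Proof.
move=> c1 e0 zc hY; apply: (@eq_small _ (fun n => (z *: 1%:M) *m Y n)).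
  by move=> n; rewrite -scalemxAl mul1mx.
apply: smallMl => // n; apply: opb_le zc; rewrite -[normc z]mulr1.
by apply: opbZ; exact: opb1.
Qed.

Lemma small_adj e Y : 0 <= e -> small e Y -> small e (fun n => (Y n)^t*).
Proof.
move=> e0 [n0 h]; exists n0 => n /h [Rn [Nn [hY hr hN]]].
exists (Rn^t*), (Nn^t*); split; rewrite ?rank_trmxC//; last exact: opb_adj.
by rewrite hY trmxCD.
Qed.

Lemma natr_large (e : R) K : 0 < e -> exists n0, forall n, (n0 <= n)%N -> K <= e * n%:R.
Proof.
move=> e0; exists (Num.bound (K / e)).+1 => n hn.
rewrite mulrC -ler_pdivrMr//.
have := archi_boundP; have [Ke|Ke] := leP 0 (K / e); last first.
  by move=> _; rewrite (le_trans (ltW Ke)).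
move=> /(_ _ _ Ke)/ltW/le_trans; apply; rewrite ler_nat; exact: leq_trans hn.
Qed.

Lemma small_rank K e Y : (forall n, \rank (Y n) <= K)%N -> 0 < e -> small e Y.
Proof.
move=> h e0; have [n0 hn0] := natr_large K%:R e0.
exists n0 => n /hn0 hn; exists (Y n), 0; split.
- by rewrite addr0.
- by rewrite (le_trans _ hn)// ler_nat.
- by apply: opb_le (@opb0 _ _) (ltW e0).
Qed.

Lemma small_zero e Y : 0 < e -> (forall n, Y n = 0) -> small e Y.
Proof. by move=> e0 h; apply: (@small_rank 0) => // n; rewrite h mxrank0. Qed.

(** The low rank part has norm at most c + e, so few singular values, all
    bounded; the other part contributes at most e^2 per column. *)
Lemma small_frob2 e c Y : 0 <= e -> 0 <= c -> bounded_by Y c -> small e Y ->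
  exists n0, forall n, (n0 <= n)%N ->
    frob2 (Y n) <= (2 * e * (c + e) ^+ 2 + 2 * e ^+ 2) * n%:R.
Proof.
move=> e0 c0 hY [n0 h]; exists n0 => n /h [Rn [Nn [hYn hr hN]]].
have hR : opb Rn (c + e).
  have -> : Rn = Y n - Nn by rewrite hYn addrK.
  by apply: opbB.
rewrite hYn (le_trans (frob2D _ _))//.
have h1 := frob2_rank (addr_ge0 c0 e0) hR.
have h2 := frob2_opb e0 hN.
have h3 := ler_wpM2r (sqr_ge0 (c + e)) hr.
set q := (c + e) ^+ 2 in h1 h3 *; nra.
Qed.

Lemma trace_frob2 n (A : 'M[C]_n) : normc (\tr A) ^+ 2 <= n%:R * frob2 A.
Proof.
apply: (@le_trans _ _ ((\sum_i 1 * normc (A i i)) ^+ 2)).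
  rewrite ler_pXn2r ?nnegrE ?normc_ge0 ?sumr_ge0//.
    rewrite (le_trans (normc_sum _ _ _))// ler_sum// => i _.
    by rewrite mul1r.
  by move=> i _; rewrite mul1r normc_ge0.
rewrite (le_trans (cauchy_sum _ _))//.
rewrite (eq_bigr (fun=> 1)) => [|i _]; last by rewrite expr1n.
rewrite sumr_const card_ord ler_wpM2l// ler_sum// => i _.
by rewrite (bigD1 i)//= lerDl sumr_ge0// => j _; exact: sqr_ge0.
Qed.

Lemma trace_rank K c Y : 0 <= c -> bounded_by Y c -> (forall n, \rank (Y n) <= K)%N ->
  forall e, 0 < e -> exists n0, forall n, (n0 <= n)%N ->
    normc (\tr (Y n)) <= e * n%:R.
Proof.
move=> c0 hY hK e e0.
have [n0 hn0] := @natr_large (e ^+ 2) (K%:R * c ^+ 2) (exprn_gt0 _ e0).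
exists n0 => n /hn0 hn.
rewrite -(@ler_pXn2r _ 2)// ?nnegrE ?normc_ge0 ?mulr_ge0 ?(ltW e0)//.
rewrite (le_trans (trace_frob2 _))// exprMn [n%:R ^+ 2]expr2 mulrA mulrC ler_wpM2r//.
rewrite (le_trans _ hn)// (le_trans (frob2_rank c0 (hY n)))//.
by rewrite ler_wpM2r ?sqr_ge0// ler_nat.
Qed.

End Small.

(** * Step-trigonometric symbols and their matrices *)

Section Nice.
Context {R : realType}.
Local Notation C := R[i].

Definition cis (j : int) (th : R) : C := (cos (j%:~R * th) +i* sin (j%:~R * th))%C.

Lemma cis0 th : cis 0 th = 1.
Proof. by rewrite /cis mul0r cos0 sin0. Qed.

Lemma cisD j k th : cis (j + k) th = cis j th * cis k th.
Proof.
by rewrite /cis intrD mulrDl cosD sinD; apply/eqP; rewrite eq_complex /= eqxx /= addrC mulrC [X in _ + X]mulrC addrC eqxx.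
Qed.

Lemma cisN j th : cis (- j) th = (cis j th)^*.
Proof. by rewrite /cis intrN mulNr cosN sinN. Qed.

Lemma normc_cis j th : normc (cis j th) = 1.
Proof. by rewrite /cis /= cos2Dsin2 sqrtr1. Qed.

(** (c, t, j) stands for the symbol c 1_(x <= t) e^(i j theta). *)
Definition mono : Type := (C * R * int)%type.
Definition mval (m : mono) (z : R * R) : C := m.1.1 * (z.1 <= m.1.2)%R%:R * cis m.2 z.2.
Definition pval (l : seq mono) (z : R * R) : C := \sum_(m <- l) mval m z.

Definition mulmono (m m' : mono) : mono :=
  (m.1.1 * m'.1.1, Num.min m.1.2 m'.1.2, m.2 + m'.2).
Definition lmul (l l' : seq mono) := [seq mulmono m m' | m <- l, m' <- l'].
Definition conjmono (m : mono) : mono := (m.1.1^*, m.1.2, - m.2).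
Definition lconj (l : seq mono) := map conjmono l.
Definition scalemono c (m : mono) : mono := (c * m.1.1, m.1.2, m.2).
Definition lscale c (l : seq mono) := map (scalemono c) l.
(** The constant 1 on x <= 1, hence on the domain D. *)
Definition lone : seq mono := [:: (1, 1, 0)].
Definition lsub (l l' : seq mono) := l ++ lscale (-1) l'.
Definition lexp (l : seq mono) k := iter k (lmul l) lone.

Lemma mval_mul m m' z : mval (mulmono m m') z = mval m z * mval m' z.
Proof.
rewrite /mval /= le_min cisD.
by case: (z.1 <= m.1.2); case: (z.1 <= m'.1.2); rewrite /= ?(mulr0, mul0r, mulr1)//; ring.
Qed.

Lemma mval_conj m z : mval (conjmono m) z = (mval m z)^*.
Proof.
rewrite /mval /= cisN !rmorphM.
by rewrite rmorph_nat.
Qed.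

Lemma mval_scale c m z : mval (scalemono c m) z = c * mval m z.
Proof. by rewrite /mval /= -!mulrA. Qed.

Lemma pval_cat l l' z : pval (l ++ l') z = pval l z + pval l' z.
Proof. by rewrite /pval big_cat. Qed.

Lemma pval_mul l l' z : pval (lmul l l') z = pval l z * pval l' z.
Proof.
rewrite /pval /lmul big_allpairs_dep mulr_suml; apply: eq_bigr => m _.
by rewrite mulr_sumr; apply: eq_bigr => m' _; rewrite mval_mul.
Qed.

Lemma pval_conj l z : pval (lconj l) z = (pval l z)^*.
Proof. by rewrite /pval big_map rmorph_sum; apply: eq_bigr => m _; exact: mval_conj. Qed.

Lemma pval_scale c l z : pval (lscale c l) z = c * pval l z.
Proof. by rewrite /pval big_map mulr_sumr; apply: eq_bigr => m _; exact: mval_scale. Qed.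

Lemma pval_sub l l' z : pval (lsub l l') z = pval l z - pval l' z.
Proof. by rewrite pval_cat pval_scale mulN1r. Qed.

Lemma pval_one z : z.1 <= 1 -> pval lone z = 1.
Proof. by move=> h; rewrite /pval big_seq1 /mval /= h cis0 !mulr1. Qed.

Lemma pval_exp l k z : z.1 <= 1 -> pval (lexp l k) z = pval l z ^+ k.
Proof.
by move=> h; elim: k => [|k ih]; rewrite ?expr0 ?pval_one//= pval_mul ih exprS.
Qed.

(** A common bound for the symbol and for the norms of its matrices. *)
Definition lnorm (l : seq mono) : R := \sum_(m <- l) normc m.1.1.

Lemma lnorm_ge0 l : 0 <= lnorm l.
Proof. by rewrite sumr_ge0// => m _; exact: normc_ge0. Qed.

Lemma normc_bool (b : bool) : normc (b%:R : C) = b%:R.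
Proof. by case: b; rewrite ?Normc.normc1 ?Normc.normc0. Qed.

Lemma pval_le l z : normc (pval l z) <= lnorm l.
Proof.
rewrite (le_trans (normc_sum _ _ _))// ler_sum// => m _.
rewrite !Normc.normcM normc_cis mulr1 normc_bool.
by case: (z.1 <= _); rewrite ?mulr1// mulr0 normc_ge0.
Qed.

Definition step n (T : nat) : 'M[C]_n := \matrix_(i, j) ((i == j) && (i < T)%N)%:R.
Definition shift n (j : int) : 'M[C]_n :=
  \matrix_(r, s) ((r : nat)%:Z - (s : nat)%:Z == j)%:R.
(** The number of i >= 1 with i / n <= t. *)
Definition cut n (t : R) : nat := Num.truncn (t * n%:R).
Definition mmat (m : mono) n : 'M[C]_n := m.1.1 *: (step n (cut n m.1.2) *m shift n m.2).
Definition lmat (l : seq mono) : mxseq R := fun n => \sum_(m <- l) mmat m n.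

Lemma mul_step n p T (A : 'M[C]_(n, p)) i j : (step n T *m A) i j = (i < T)%N%:R * A i j.
Proof.
rewrite mxE (bigD1 i)//= big1 ?addr0 => [|k ki]; rewrite mxE ?eqxx//.
by rewrite eq_sym (negbTE ki) mul0r.
Qed.

Lemma mul_mx_step n p T (A : 'M[C]_(p, n)) i j : (A *m step n T) i j = A i j * (j < T)%N%:R.
Proof.
rewrite mxE (bigD1 j)//= big1 ?addr0 => [|k ki]; rewrite mxE ?eqxx//.
by rewrite (negbTE ki) mulr0.
Qed.

Lemma stepM n T T' : step n T *m step n T' = step n (minn T T').
Proof.
apply/matrixP => i j; rewrite mul_step !mxE leq_min; case: eqP => //= _; last by rewrite mulr0.
by rewrite -natrM mulnb.
Qed.

Lemma opb_step n T : opb (step n T) 1.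
Proof.
move=> x; rewrite mul1r; apply: l2norm_le; apply: ler_sum => i _.
rewrite mul_step Normc.normcM normc_bool; case: (i < T)%N; rewrite ?mul1r//.
by rewrite mul0r expr0n sqr_ge0.
Qed.

Lemma opb_shift n j : opb (shift n j) 1.
Proof.
move=> x; rewrite mul1r; apply: l2norm_le.
pose b (r s : 'I_n) := (r : nat)%:Z - (s : nat)%:Z == j.
apply: (@le_trans _ _ (\sum_r \sum_s (b r s)%:R * normc (x s ord0) ^+ 2)).
  apply: ler_sum => r _; rewrite mxE.
  have [s bs|bF] := pickP (b r); last first.
    rewrite big1 ?Normc.normc0 ?expr0n.
      by rewrite sumr_ge0// => s _; rewrite mulr_ge0// sqr_ge0.
    by move=> s _; rewrite mxE -/(b r s) bF mul0r.
  have bs' s' : s' != s -> b r s' = false.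
    move=> ss; apply/negbTE/negP => bs'; move/eqP: ss; apply; apply/val_inj => /=.
    by move: bs bs'; rewrite /b => /eqP h /eqP h'; lia.
  rewrite (bigD1 s)//= big1 ?addr0 => [|s' /bs' h]; last by rewrite mxE -/(b r s') h mul0r.
  rewrite mxE -/(b r s) bs mul1r (bigD1 s)//= bs mul1r lerDl.
  by rewrite sumr_ge0// => s' _; rewrite mulr_ge0// sqr_ge0.
rewrite exchange_big ler_sum// => s _.
rewrite -mulr_suml -[leRHS]mul1r ler_wpM2r ?sqr_ge0//.
have [r br|bF] := pickP (b^~ s); last by rewrite big1// => r _; rewrite bF.
rewrite (bigD1 r)//= big1 ?addr0 ?lern1 ?leq_b1// => r' rr.
rewrite (_ : b r' s = false)//; apply/negbTE/negP => br'.
move/eqP: rr; apply; apply/val_inj => /=.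
by move: br br'; rewrite /b => /eqP h /eqP h'; lia.
Qed.

Lemma opb_mmat m n : opb (mmat m n) (normc m.1.1).
Proof.
rewrite -[normc _]mulr1; apply: opbZ; rewrite -[X in opb _ X]mulr1.
by apply: opbM => //; [exact: opb_step | exact: opb_shift].
Qed.

Lemma opb_lmat l n : opb (lmat l n) (lnorm l).
Proof. by apply: opb_sum => m; exact: opb_mmat. Qed.

Lemma bounded_lmat l : bounded (lmat l).
Proof. by exists (lnorm l); [exact: lnorm_ge0 | move=> n; exact: opb_lmat]. Qed.

(** Bounded rank, uniformly in n: the error made by the symbol calculus. It is
    small at every scale by [small_rank]. *)
Definition bounded_rank (Y : mxseq R) := exists K, forall n, (\rank (Y n) <= K)%N.

Lemma eq_bounded_rank Y Y' : (forall n, Y n = Y' n) -> bounded_rank Y -> bounded_rank Y'.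
Proof. by move=> h [K hK]; exists K => n; rewrite -h. Qed.

Lemma bounded_rankD Y Y' : bounded_rank Y -> bounded_rank Y' -> bounded_rank (fun n => Y n + Y' n).
Proof.
move=> [K h] [K' h']; exists (K + K')%N => n.
by rewrite (leq_trans (mxrank_add _ _))// leq_add.
Qed.

Lemma bounded_rankMl B Y : bounded_rank Y -> bounded_rank (fun n => B n *m Y n).
Proof. by move=> [K h]; exists K => n; rewrite (leq_trans (mxrankM_maxr _ _)). Qed.

Lemma bounded_rankMr B Y : bounded_rank Y -> bounded_rank (fun n => Y n *m B n).
Proof. by move=> [K h]; exists K => n; rewrite (leq_trans (mxrankM_maxl _ _)). Qed.

Lemma bounded_rankZ (c : C) Y : bounded_rank Y -> bounded_rank (fun n => c *: Y n).
Proof. by move=> [K h]; exists K => n; rewrite (leq_trans (mxrank_scale _ _)). Qed.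

Lemma bounded_rank0 : bounded_rank (fun n => 0).
Proof. by exists 0%N => n; rewrite mxrank0. Qed.

Lemma bounded_rank_sum (I : Type) (s : seq I) (F : I -> mxseq R) :
  (forall i, bounded_rank (F i)) -> bounded_rank (fun n => \sum_(i <- s) F i n).
Proof.
move=> h; elim: s => [|a s ih].
  by apply: eq_bounded_rank bounded_rank0 => n; rewrite big_nil.
by apply: eq_bounded_rank (bounded_rankD (h a) ih) => n; rewrite big_cons.
Qed.

Lemma card_ord_itv n a b : (#|[pred r : 'I_n | (a <= r < b)%N]| <= b - a)%N.
Proof.
rewrite cardE -(size_map val) -(size_iota a (b - a)).
apply: uniq_leq_size; first by rewrite map_inj_uniq ?enum_uniq//; exact: val_inj.
move=> x /mapP[r]; rewrite mem_enum inE => /andP[ar rb] ->.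
by rewrite mem_iota ar subnKC// ltnW// (leq_ltn_trans ar).
Qed.

(** Shifting by j moves the end of the truncation by |j| rows. *)
Lemma rank_step_shift n T j :
  (\rank (step n T *m shift n j - shift n j *m step n T)%R <= `|j| + `|j|)%N.
Proof.
apply: (@leq_trans #|[pred r : 'I_n | (T - `|j| <= r < T + `|j|)%N]|).
  apply: rank_rows => r /= hr s.
  rewrite mxE [X in _ + X]mxE mul_step mul_mx_step !mxE.
  case: eqP => [h|_]; last by rewrite mul0r mulr0 subrr.
  rewrite mulr1 mul1r; suff -> : (r < T)%N = (s < T)%N by rewrite subrr.
  by apply/idP/idP => ?; move: hr h; lia.
by rewrite (leq_trans (card_ord_itv _ _ _))//; lia.
Qed.

(** Shifting twice differs from shifting by the sum only in the rows near the
    boundary, where the first shift leaves the range of indices. *)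
Lemma rank_shift_shift n j k :
  (\rank (shift n j *m shift n k - shift n (j + k))%R <= `|j| + `|j|)%N.
Proof.
apply: (@leq_trans (#|[pred r : 'I_n | (0 <= r < `|j|)%N]| + #|[pred r : 'I_n | (n - `|j| <= r < n)%N]|)).
  rewrite -cardUI (leq_trans _ (leq_addr _ _))//; apply: rank_rows => r /= hr s.
  have hr1 : (`|j| <= r < n - `|j|)%N.
    by move: hr; rewrite unfold_in /= !unfold_in /=; have := ltn_ord r; lia.
  have hu : (`|(r : nat)%:Z - j| < n)%N by lia.
  pose u := Ordinal hu; rewrite !mxE (bigD1 u)//= big1 => [|v vu]; last first.
    rewrite !mxE (_ : _ == _ = false) ?mul0r//; apply/negbTE/negP => /eqP h.
    by move/eqP: vu; apply; apply/val_inj => /=; lia.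
  rewrite !mxE addr0 (_ : _ == j = true); last by apply/eqP => /=; lia.
  rewrite mul1r (_ : (_ == k) = ((r : nat)%:Z - (s : nat)%:Z == j + k)) ?subrr//.
  by apply/idP/idP => /eqP h; apply/eqP; move: h => /=; lia.
by rewrite (leq_trans (leq_add (card_ord_itv _ _ _) (card_ord_itv _ _ _)))//; lia.
Qed.

Lemma cut_min n t t' : cut n (Num.min t t') = minn (cut n t) (cut n t').
Proof.
have mono (a b : R) : a <= b -> (cut n a <= cut n b)%N.
  by move=> ab; apply: Num.Theory.le_truncn; rewrite ler_wpM2r.
have [h|/ltW h] := leP t t'; first by rewrite (minn_idPl (mono _ _ h)).
by rewrite (minn_idPr (mono _ _ h)).
Qed.

Lemma trmxC_step n T : (step n T)^t* = step n T.
Proof.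
apply/matrixP => i j; rewrite !mxE conjC_nat eq_sym.
by case: eqP => // ->.
Qed.

Lemma trmxC_shift n j : (shift n j)^t* = shift n (- j).
Proof.
apply/matrixP => r s; rewrite !mxE conjC_nat; congr (_%:R); congr nat_of_bool.
by apply/idP/idP => /eqP h; apply/eqP; lia.
Qed.

Lemma mmat_mul m m' : bounded_rank (fun n => mmat m n *m mmat m' n - mmat (mulmono m m') n).
Proof.
case: m m' => [[c t] j] [[c' t'] k].
have h1 : bounded_rank (fun n => step n (cut n t') *m shift n j - shift n j *m step n (cut n t')).
  by exists (`|j| + `|j|)%N => n; exact: rank_step_shift.
have h2 : bounded_rank (fun n => shift n j *m shift n k - shift n (j + k)).
  by exists (`|j| + `|j|)%N => n; exact: rank_shift_shift.
have h3 := bounded_rankZ (- (c * c')) (bounded_rankMl (fun n => step n (cut n t)) (bounded_rankMr (fun n => shift n k) h1)).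
have h4 := bounded_rankZ (c * c') (bounded_rankMl (fun n => step n (cut n t) *m step n (cut n t')) h2).
apply: eq_bounded_rank (bounded_rankD h3 h4) => n; rewrite /mmat /= cut_min -stepM.
rewrite -scalemxAl -scalemxAr scalerA -scalerBr scaleNr -scalerN -scalerDr.
congr (_ *: _); rewrite mulmxBl mulmxBr opprB mulmxBr !mulmxA.
by rewrite addrA subrK.
Qed.

Lemma mmat_adj m : bounded_rank (fun n => (mmat m n)^t* - mmat (conjmono m) n).
Proof.
case: m => [[c t] j].
have h1 : bounded_rank (fun n => step n (cut n t) *m shift n (- j) - shift n (- j) *m step n (cut n t)).
  by exists (`|- j| + `|- j|)%N => n; exact: rank_step_shift.
apply: eq_bounded_rank (bounded_rankZ (- c^*) h1) => n; rewrite /mmat /=.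
by rewrite trmxCZ trmxCM trmxC_step trmxC_shift -scalerBr scaleNr -scalerN opprB.
Qed.

Lemma lmat_cat l l' n : lmat (l ++ l') n = lmat l n + lmat l' n.
Proof. by rewrite /lmat big_cat. Qed.

Lemma lmat_scale c l n : lmat (lscale c l) n = c *: lmat l n.
Proof.
rewrite /lmat big_map scaler_sumr; apply: eq_bigr => m _.
by rewrite /mmat /= scalerA.
Qed.

Lemma lmat_sub l l' n : lmat (lsub l l') n = lmat l n - lmat l' n.
Proof. by rewrite lmat_cat lmat_scale scaleN1r. Qed.

Lemma lmat_one n : lmat lone n = 1%:M.
Proof.
rewrite /lmat big_seq1 /mmat /= scale1r; apply/matrixP => i j.
rewrite mul_step !mxE /cut mul1r Num.Theory.natrK ltn_ord mul1r.
by rewrite -val_eqE /= subr_eq0 eqz_nat.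
Qed.

Lemma lmat_mul l l' : bounded_rank (fun n => lmat l n *m lmat l' n - lmat (lmul l l') n).
Proof.
apply: eq_bounded_rank (bounded_rank_sum l (fun m => bounded_rank_sum l' (fun m' => mmat_mul m m'))) => n.
rewrite /lmat big_allpairs_dep mulmx_suml -sumrB; apply: eq_bigr => m _.
by rewrite mulmx_sumr -sumrB.
Qed.

Lemma lmat_adj l : bounded_rank (fun n => (lmat l n)^t* - lmat (lconj l) n).
Proof.
apply: eq_bounded_rank (bounded_rank_sum l (fun m => mmat_adj m)) => n.
rewrite /lmat big_map sumrB; congr (_ - _).
elim: l => [|a l ih]; first by rewrite !big_nil; apply/matrixP => i j; rewrite !mxE conjC0.
by rewrite !big_cons trmxCD ih.
Qed.

Definition clamp (t : R) := Num.max 0 (Num.min 1 t).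
(** The mean over D of the symbol, and the limit of the normalized traces of
    its matrices ([trace_lmat], [re_pval_facts]). *)
Definition tau (l : seq mono) : C :=
  \sum_(m <- l) m.1.1 * ((if m.2 == 0 then clamp m.1.2 else 0)%:C)%C.

Lemma sum_lt n T : \sum_(i < n) ((i < T)%N%:R : C) = (minn T n)%:R.
Proof.
rewrite -natr_sum; congr (_%:R).
elim: n => [|n ih]; first by rewrite big_ord0 minn0.
rewrite big_ord_recr /= ih; case: ltnP; lia.
Qed.

Lemma trace_mmat m n : \tr (mmat m n) = m.1.1 * (if m.2 == 0 then (minn (cut n m.1.2) n)%:R else 0).
Proof.
rewrite /mmat mxtraceZ; congr (_ * _).
rewrite /mxtrace; under eq_bigr do rewrite mul_step mxE subrr eq_sym.
case: eqP => _; last by rewrite big1// => i _; rewrite mulr0.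
by under eq_bigr do rewrite mulr1; exact: sum_lt.
Qed.

Lemma cut_clamp n t : `|(minn (cut n t) n)%:R - clamp t * n%:R| <= 1 :> R.
Proof.
rewrite /clamp /cut; have [t0|t0] := leP t 0.
  rewrite (_ : Num.truncn _ = 0%N); last first.
    by apply/eqP; rewrite -leqn0 Num.Theory.truncn_le_nat; apply: le_lt_trans ltr01; rewrite mulr_le0_ge0.
  rewrite min0n [Num.min 1 t]min_r ?(le_trans t0)// max_l// mul0r subr0 normr0//.
have tn0 : 0 <= t * n%:R by rewrite mulr_ge0// ltW.
have /andP[h1 h2] := Num.Theory.truncn_itv tn0.
have [t1|t1] := leP 1 t.
  rewrite (minn_idPr _) ?max_r// ?mul1r ?subrr ?normr0//.
  by rewrite Num.Theory.truncn_ge_nat// ler_peMl.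
rewrite (minn_idPl _); last first.
  rewrite -(@ler_nat R) (le_trans h1)// ler_piMl// ltW//.
rewrite (max_r (ltW t0)) ler_norml; move: h1 h2; rewrite -natr1; lra.
Qed.

Lemma trace_lmat l n : normc (\tr (lmat l n) - tau l * n%:R) <= lnorm l.
Proof.
rewrite /lmat raddf_sum /= /tau mulr_suml -sumrB (le_trans (normc_sum _ _ _))//.
apply: ler_sum => m _; rewrite trace_mmat -mulrA -mulrBr Normc.normcM.
rewrite ler_piMr ?normc_ge0//; case: eqP => _; last first.
  by rewrite mul0r subrr Normc.normc0.
rewrite -[n%:R](rmorph_nat (real_complex R)) -rmorphM.
rewrite -[(minn _ _)%:R](rmorph_nat (real_complex R)) -rmorphB /=.
by rewrite expr0n addr0 sqrtr_sqr cut_clamp.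
Qed.

End Nice.

(** * Integrals of step-trigonometric symbols *)

Section TrigInt.
Context {R : realType}.
Local Notation mu := (@lebesgue_measure R).
Implicit Types (a b th : R) (j : int).

Definition rtrig j a b (th : R) : R := a * cos (j%:~R * th) - b * sin (j%:~R * th).

Lemma is_derive_trig j a b (x : R) :
  is_derive x 1 (rtrig j a b) (rtrig j (- b * j%:~R) (a * j%:~R) x).
Proof.
rewrite /rtrig.
apply: is_derive_eq.
rewrite /GRing.scale /=; ring.
Qed.

Lemma continuous_rtrig j a b : continuous (rtrig j a b).
Proof.
move=> x; apply: differentiable_continuous; apply/derivable1_diffP.
by have [] := is_derive_trig j a b x.
Qed.

Lemma sin_int j : sin (j%:~R * pi : R) = 0.
Proof.
have h (n : nat) : sin (n%:R * pi : R) = 0.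
  elim: n => [|n ih]; first by rewrite mul0r sin0.
  by rewrite -natr1 mulrDl mul1r sinD ih mul0r add0r sinpi mulr0.
case: j => n; first exact: h.
by rewrite NegzE intrN mulNr sinN h oppr0.
Qed.

Lemma int_rtrig j a b :
  (\int[mu]_(th in `[(- pi)%R, pi%R]) (rtrig j a b th)%:E)%E =
  (if j == 0 then 2 * pi * a else 0)%R%:E.
Proof.
have pip := @pi_gt0 R.
case: eqP => [->|/eqP j0].
  rewrite (eq_integral (fun=> a%:E)) => [|x _]; last first.
    by rewrite /rtrig mul0r cos0 sin0 mulr1 mulr0 subr0.
  rewrite integral_cst//= lebesgue_measure_itv /= lte_fin ifT; last by lra.
  by rewrite -EFinB -EFinM; congr (_%:E); ring.
pose F := rtrig j (b / j%:~R) (- (a / j%:~R)).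
have jr : j%:~R != 0 :> R by rewrite intr_eq0.
have dF (x : R) : is_derive x 1 F (rtrig j a b x).
  have := is_derive_trig j (b / j%:~R) (- (a / j%:~R)) x; rewrite -/F.
  suff -> : rtrig j (- - (a / j%:~R) * j%:~R) (b / j%:~R * j%:~R) x = rtrig j a b x by [].
  by rewrite opprK !divfK.
have cF : continuous F by exact: continuous_rtrig.
rewrite (@continuous_FTC2 _ (rtrig j a b) F).
- rewrite /F /rtrig -EFinB mulrN cosN sinN sin_int; congr (_%:E); ring.
- lra.
- by apply: continuous_subspaceT; exact: continuous_rtrig.
- split.
  + by move=> x _; have [] := dF x.
  + by apply: cvg_at_right_filter; exact: cF.
  + by apply: cvg_at_left_filter; exact: cF.
- by move=> x _; rewrite derive1E; have [_ ->] := dF x.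
Qed.

Lemma measurable_rtrig j a b : measurable_fun setT (rtrig j a b).
Proof. by apply: continuous_measurable_fun; exact: continuous_rtrig. Qed.

Lemma rtrig_le j a b th : `|rtrig j a b th| <= `|a| + `|b|.
Proof.
rewrite /rtrig (le_trans (ler_normB _ _))// lerD// normrM ler_piMr//.
  by rewrite ler_norml cos_geN1 cos_le1.
by rewrite ler_norml sin_geN1 sin_le1.
Qed.

Lemma mu_I : mu `[- pi, pi] = (2 * pi)%:E.
Proof.
have pip := @pi_gt0 R.
rewrite lebesgue_measure_itv /= lte_fin ifT; last by lra.
by rewrite -EFinB; congr (_%:E); ring.
Qed.

Lemma integrable_rtrig j a b : mu.-integrable `[- pi, pi] (EFin \o rtrig j a b).
Proof.
apply: measurable_bounded_integrable => //.
- by rewrite [X in (X < _)%E](_ : _ = (2 * pi)%:E) ?ltry//; exact: mu_I.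
- by apply: measurable_funTS; exact: measurable_rtrig.
- exists (`|a| + `|b|); split; first exact: num_real.
  by move=> M hM y _ /=; rewrite (le_trans (rtrig_le _ _ _ _))// ltW.
Qed.

Lemma measurable_set_le (t : R) : measurable ([set x | x <= t] : set (measurableTypeR R)).
Proof.
have -> : [set x | x <= t] = [set` `]-oo, t]] :> set R; last by [].
by apply/seteqP; split => x /=; rewrite in_itv.
Qed.

Lemma int_le_clamp (t : R) :
  mu (`[0, 1] `&` [set x | x <= t]) = (clamp t)%:E.
Proof.
have -> : `[0, 1] `&` [set x | x <= t] = [set` `[0, Num.min 1 t]] :> set R.
  apply/seteqP; split => x /=; rewrite !in_itv /= le_min.
    by move=> [/andP[-> ->] ->].
  by move=> /and3P[-> -> ->].
rewrite lebesgue_measure_itv /= lte_fin /clamp; case: ltP => h.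
  by rewrite -EFinB subr0.
by [].
Qed.

End TrigInt.

Section Plane.
Context {R : realType}.
Local Notation C := R[i].
Local Notation mu := (@lebesgue_measure R).
Local Notation T2 := (measurableTypeR R * measurableTypeR R)%type.
Local Notation mu2 := (mu \x mu)%E.
Let D : set T2 := `[0, 1] `*` `[- pi, pi].

Lemma measurable_D : measurable D.
Proof. by apply: measurableX. Qed.

Lemma mu2_D : mu2 D = (2 * pi)%:E.
Proof.
have pip := @pi_gt0 R.
rewrite product_measure1E//= !lebesgue_measure_itv /= !lte_fin ltr01 ifT; last by lra.
by rewrite -!EFinB -EFinM; congr (_%:E); ring.
Qed.

Definition remono (m : mono) (z : T2) : R := Re (mval m z).

Lemma remonoE (m : mono) z : remono m z =
  (\1_[set x : R | x <= m.1.2] z.1) * rtrig m.2 (Re m.1.1) (Im m.1.1) z.2.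
Proof.
case: m => [[[a b] t] j]; rewrite /remono /mval /rtrig /= indicE.
have -> : (z.1 \in [set x | x <= t]) = (z.1 <= t).
  by apply/idP/idP; rewrite inE.
by case: (z.1 <= t); rewrite /= ?mulr0 ?mul0r ?subr0 ?add0r ?addr0 ?mul0r ?subrr //; ring.
Qed.

Lemma measurable_remono m : measurable_fun setT (remono m).
Proof.
rewrite (funext (remonoE m)); apply: measurable_funM.
  apply: (measurableT_comp (measurable_indic (measurable_set_le _))) => //.
by apply: (measurableT_comp (measurable_rtrig _ _ _)).
Qed.

Lemma remono_bounded m (A : set T2) : [bounded remono m z | z in A].
Proof.
exists (`|Re m.1.1| + `|Im m.1.1|); split; first exact: num_real.
move=> M hM z _ /=; rewrite remonoE normrM; apply: le_trans (ltW hM).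
apply: le_trans (rtrig_le m.2 _ _ z.2); rewrite ler_piMl//.
by rewrite indicE; case: (_ \in _); rewrite /= ?normr1 ?normr0.
Qed.

Lemma integrable_remono m : mu2.-integrable D (EFin \o remono m).
Proof.
apply: measurable_bounded_integrable.
- exact: measurable_D.
- by rewrite [X in (X < _)%E](_ : _ = (2 * pi)%:E) ?ltry//; exact: mu2_D.
- by apply: measurable_funTS; exact: measurable_remono.
- exact: remono_bounded.
Qed.

Lemma int_remono m : (\int[mu2]_(z in D) (remono m z)%:E)%E =
  (2 * pi * Re (tau [:: m]))%:E.
Proof.
rewrite integral_mkcond -integral12_prod_meas1; last first.
  exact: ((integrable_mkcond (EFin \o remono m) measurable_D).1 (integrable_remono m)).
have pip := @pi_gt0 R.
pose A : set R := `[0, 1] `&` [set x | x <= m.1.2].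
have mA : measurable A.
  by apply: measurableI => //; exact: measurable_set_le.
set c := if m.2 == 0 then 2 * pi * Re m.1.1 else 0.
transitivity (\int[mu]_x (c%:E * (\1_A x)%:E))%E.
  apply: eq_integral => x _; rewrite /fubini_F.
  transitivity (\int[mu]_(y in `[(- pi)%R, pi%R]) ((\1_A x)%:E * (rtrig m.2 (Re m.1.1) (Im m.1.1) y)%:E))%E.
    rewrite [RHS]integral_mkcond; apply: eq_integral => y _.
    rewrite !patchE /D in_setX /=.
    have [xI|xI] := boolP (x \in `[0, 1]%classic); last first.
      rewrite /= (_ : \1_A x = 0) ?mul0e ?if_same//.
      by rewrite indicE /A in_setI (negbTE xI).
    rewrite /=; case: ifP => // _.
    by rewrite remonoE /= -EFinM !indicE /A in_setI xI.
  rewrite integralZl//; last exact: integrable_rtrig.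
  by rewrite int_rtrig muleC.
rewrite integralZl//; last first.
  rewrite (_ : (fun x => (\1_A x)%:E) = EFin \o \1_A)//.
  have Af : (mu A < +oo)%E by rewrite int_le_clamp ltry.
  apply/integrableP; split; first exact/measurable_EFinP/measurable_indic.
  rewrite (eq_integral (fun x : measurableTypeR R => (\1_A x)%:E)) => [|t _]; last by rewrite gee0_abs// lee_fin.
  by rewrite integral_indic// setIT.
rewrite integral_indic// setIT.
transitivity (c%:E * (clamp m.1.2)%:E)%E; first by congr (_ * _)%E; exact: int_le_clamp.
rewrite -EFinM; congr (_%:E).
rewrite /tau big_seq1 {}/c; case: m {A mA} => [[[a b] t] j] /=.
by case: (j == 0) => /=; ring.
Qed.

Lemma tau_cons m (l : seq (@mono R)) : tau (m :: l) = tau [:: m] + tau l.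
Proof. by rewrite /tau big_cons big_seq1. Qed.

Lemma re_pval_cons m l z : Re (pval (m :: l) z) = remono m z + Re (pval l z).
Proof.
rewrite /pval big_cons /remono; case: (mval m z) => a b.
by case: (\sum_(j <- l) _).
Qed.

Lemma re_pval_nil z : Re (@pval R [::] z) = 0.
Proof. by rewrite /pval big_nil. Qed.

(** By induction on l; the integral of a monomial splits by Fubini into the
    length of [0, min 1 t] and the integral of a trigonometric function, which
    vanishes unless j = 0. *)
Lemma re_pval_facts l : measurable_fun setT (fun z : T2 => Re (pval l z)) /\
  mu2.-integrable D (fun z => (Re (pval l z))%:E) /\
  (\int[mu2]_(z in D) (Re (pval l z))%:E)%E = (2 * pi * Re (tau l))%:E.
Proof.
elim: l => [|m l [ih1 [ih2 ih3]]].
  rewrite (_ : (fun z => Re (pval [::] z)) = cst 0); last first.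
    by apply/funext => z; rewrite re_pval_nil.
  split; first exact: measurable_cst.
  have -> : (fun z : T2 => (Re (pval [::] z))%:E) = cst 0%E.
    by apply/funext => z; rewrite re_pval_nil.
  split; first exact: integrable0.
  by rewrite integral0 /tau big_nil /= mulr0.
have e1 : (fun z : T2 => Re (pval (m :: l) z)) = remono m \+ (fun z => Re (pval l z)).
  by apply/funext => z; exact: re_pval_cons.
have e2 : (fun z : T2 => (Re (pval (m :: l) z))%:E) =
   (EFin \o remono m) \+ (fun z => (Re (pval l z))%:E).
  by apply/funext => z; rewrite re_pval_cons EFinD.
split; first by rewrite e1; apply: measurable_funD => //; exact: measurable_remono.
have mD := measurable_D; have im := integrable_remono m.
rewrite e2; split; first exact: integrableD.
rewrite integralD// ih3 (int_remono m) -EFinD; congr (_%:E).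
rewrite -mulrDr (tau_cons m l); congr (_ * _).
by case: (tau [:: m]) => ? ?; case: (tau l).
Qed.

Lemma normc_sqr_re (w : C) : normc w ^+ 2 = Re (w * w^*).
Proof. by rewrite mulrC -normC_sqr. Qed.

(** |p|^2 is the real part of p p^*, again a step-trigonometric symbol. *)
Lemma measurable_normc_gt l (e : R) : 0 <= e ->
  measurable (D `&` [set z | e < normc (pval l z)]).
Proof.
move=> e0.
have -> : [set z | e < normc (pval l z)] =
  [set: T2] `&` (fun z => Re (pval (lmul l (lconj l)) z)) @^-1` [set` `]e ^+ 2, +oo[].
  apply/seteqP; split => z /=.
    rewrite in_itv /= andbT pval_mul pval_conj -normc_sqr_re => h; split => //.
    by rewrite ltr_pXn2r ?nnegrE ?normc_ge0//.
  by rewrite in_itv /= andbT pval_mul pval_conj -normc_sqr_re => -[_]; rewrite ltr_pXn2r ?nnegrE ?normc_ge0//.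
apply: measurableI; first exact: measurable_D.
by apply: (re_pval_facts _).1 => //.
Qed.

Lemma outer2E (A : set T2) : measurable A -> completed_lebesgue_measure2 A = mu2 A.
Proof. exact: measurable_mu_extE. Qed.

End Plane.

(** * A symbol small in measure has a small matrix sequence *)

Section Key.
Context {R : realType}.
Local Notation C := R[i].
Local Notation mu := (@lebesgue_measure R).
Local Notation T2 := (measurableTypeR R * measurableTypeR R)%type.
Local Notation mu2 := (mu \x mu)%E.

Lemma bern_ge (x : R) k : -1 <= x -> 1 + k%:R * x <= (1 + x) ^+ k.
Proof.
move=> x0; elim: k => [|k ih]; first by rewrite mul0r addr0 expr0.
rewrite exprS; have : 0 <= (1 + x) * ((1 + x) ^+ k - (1 + k%:R * x)).
  by rewrite mulr_ge0 ?subr_ge0//; lra.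
have : 0 <= k%:R * (x * x) by rewrite mulr_ge0// -expr2 sqr_ge0.
rewrite -natr1; nra.
Qed.

(** By the Bernoulli inequality (1 + y)^N >= 2, and (1 - y) (1 + y) <= 1. *)
Lemma pow1B_half (y : R) N : 0 <= y <= 1 -> 1 <= N%:R * y -> (1 - y) ^+ N <= 1 / 2.
Proof.
move=> /andP[y0 y1] hN.
have h1 : 1 + N%:R * y <= (1 + y) ^+ N by apply: bern_ge; lra.
have h2 : (1 - y) ^+ N * (1 + y) ^+ N <= 1.
  by rewrite -exprMn exprn_ile1//; nra.
have h3 : 0 <= (1 - y) ^+ N by rewrite exprn_ge0// subr_ge0.
nra.
Qed.

Variable l : seq (@mono R).
Let K := lnorm l ^+ 2 + 1.
Let lw := lsub lone (lscale ((K^-1)%:C)%C (lmul (lconj l) l)).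

Let K1 : 1 <= K. Proof. by rewrite lerDr sqr_ge0. Qed.
Let K0 : 0 < K. Proof. exact: lt_le_trans K1. Qed.

Let q (z : R * R) := normc (pval l z) ^+ 2.

Let q_ge0 z : 0 <= q z / K.
Proof. by rewrite divr_ge0 ?sqr_ge0// ltW. Qed.

Let q_le1 z : q z / K <= 1.
Proof.
rewrite ler_pdivrMr// mul1r (@le_trans _ _ (lnorm l ^+ 2))// ?lerDl//.
by rewrite ler_pXn2r ?nnegrE ?normc_ge0 ?lnorm_ge0// pval_le.
Qed.

(** [lw] is 1 - p^* p / K, whose values on D lie in [0, 1] because K exceeds
    the bound [lnorm l] of |p|, squared. *)
Lemma pval_lw N (z : R * R) : z.1 <= 1 ->
  pval (lexp lw N) z = (((1 - q z / K) ^+ N)%:C)%C.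
Proof.
move=> z1; rewrite pval_exp// rmorphXn; congr (_ ^+ _).
rewrite /lw pval_sub pval_scale pval_mul pval_conj pval_one// -normC_sqr.
by rewrite -/(q z) -rmorphM mulrC -rmorphB.
Qed.

(** On the complement of the exceptional set the integrand is at least
    1 - N e^2 / K by Bernoulli, and everywhere it is nonnegative. *)
Lemma tau_lower e N : 0 < e -> e <= 1 / 2 -> N%:R <= 2 * K / e ->
  (completed_lebesgue_measure2 (domD R `&` [set z | (e < normc (pval l z))%R]) <= e%:E)%E ->
  1 - 3 * e <= Re (tau (lexp lw N)).
Proof.
move=> e0 e1 hN hmu; have pip := @pi_ge2 R.
pose D : set T2 := `[0, 1] `*` `[- pi, pi].
pose E : set T2 := D `&` [set z | (e < normc (pval l z))%R].
have mD : measurable D by exact: measurable_D.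
have mE : measurable E by apply: measurable_normc_gt; exact: ltW.
have muE : (mu2 E <= e%:E)%E by rewrite -(outer2E mE).
have [mF [iF intF]] := re_pval_facts (lexp lw N).
have ED : E `<=` D by move=> z [].
pose G := D `\` E.
have mG : measurable G by exact: measurableD.
have muG : ((2 * pi - e)%:E <= mu2 G)%E.
  have -> : mu2 G = (mu2 D - mu2 E)%E.
    rewrite /G measureD//; first by rewrite (setIidr ED).
    by rewrite [X in (X < _)%E](_ : _ = (2 * pi)%:E) ?ltry//; exact: mu2_D.
  rewrite [X in (_ <= X - _)%E](_ : _ = (2 * pi)%:E); last exact: mu2_D.
  by rewrite EFinB leeB.
have F0 z : D z -> 0 <= Re (pval (lexp lw N) z).
  move=> [/= + _]; rewrite in_itv /= => /andP[_ z1].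
  by rewrite pval_lw// exprn_ge0// subr_ge0.
have FG z : G z -> 1 - 2 * e <= Re (pval (lexp lw N) z).
  move=> [Dz nE]; have [/= + _] := Dz; rewrite in_itv /= => /andP[_ z1].
  have ze : normc (pval l z) <= e.
    by rewrite leNgt; apply/negP => h; apply: nE.
  have qe : q z <= e ^+ 2 by rewrite ler_pXn2r ?nnegrE ?normc_ge0// ltW.
  rewrite pval_lw//=; apply: le_trans (bern_ge N _); last by rewrite lerN2 q_le1.
  rewrite mulrN lerB// mulrA ler_pdivrMr//.
  apply: (@le_trans _ _ (2 * K / e * e ^+ 2)); last first.
    by rewrite expr2 mulrA divfK ?gt_eqF// mulrAC.
  by rewrite ler_pM// sqr_ge0.
have : ((1 - 2 * e)%:E * mu2 G <= (2 * pi * Re (tau (lexp lw N)))%:E)%E.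
  rewrite -intF.
  apply: (@le_trans _ _ (\int[mu2]_(z in G) (Re (pval (lexp lw N) z))%:E)%E).
    rewrite -integral_cst//; apply: ge0_le_integral => //.
    - by move=> z _; rewrite lee_fin; lra.
    - by apply/measurable_EFinP; exact: measurable_funTS.
  apply: ge0_subset_integral => //.
  - by apply/measurable_EFinP; exact: measurable_funTS.
  - by move=> z [].
move=> h; have : ((1 - 2 * e) * (2 * pi - e) <= 2 * pi * Re (tau (lexp lw N)))%R.
  rewrite -lee_fin; apply: le_trans h; rewrite EFinM; apply: lee_wpmul2l => //.
  by rewrite lee_fin; lra.
move=> h'; nra.
Qed.

Definition mpow n (W : 'M[C]_n) k := iter k (mulmx W) 1%:M.

Let W n : 'M[C]_n := 1%:M - ((K^-1)%:C)%C *: ((lmat l n)^t* *m lmat l n).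

Lemma bounded_rank_W : bounded_rank (fun n => W n - lmat lw n).
Proof.
have h1 := bounded_rankMr (fun n => lmat l n) (lmat_adj l).
have h := bounded_rankD h1 (lmat_mul (lconj l) l).
apply: eq_bounded_rank (bounded_rankZ (- ((K^-1)%:C)%C) h) => n.
rewrite /W lmat_sub lmat_one lmat_scale mulmxBl addrA subrK scaleNr scalerBr !opprB.
by rewrite [RHS]addrC addrA subrK.
Qed.

Lemma bounded_W : bounded W.
Proof.
have h := boundedM (bounded_adj (bounded_lmat l)) (bounded_lmat l).
have h1 : bounded (fun n => (1%:M : 'M[C]_n)) by exists 1 => // n; exact: opb1.
have := boundedD h1 (boundedN (boundedZ ((K^-1)%:C)%C h)).
by [].
Qed.

(** Telescoping with [lmat_mul]: the powers of W follow the powers of its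
    symbol. *)
Lemma bounded_rank_Wpow k : bounded_rank (fun n => mpow (W n) k - lmat (lexp lw k) n).
Proof.
elim: k => [|k ih].
  by apply: eq_bounded_rank bounded_rank0 => n; rewrite /= lmat_one subrr.
have h1 := bounded_rankMl W ih.
have h2 := bounded_rankMr (lmat (lexp lw k)) bounded_rank_W.
have h3 := lmat_mul lw (lexp lw k).
apply: eq_bounded_rank (bounded_rankD h1 (bounded_rankD h2 h3)) => n.
rewrite [mpow _ _.+1]/= [lexp _ _.+1]/= -/(mpow _ k) -/(lexp lw k) mulmxBr (mulmxBl (W n) (lmat lw n)).
by rewrite !addrA !subrK.
Qed.

Lemma bounded_Wpow k : bounded (fun n => mpow (W n) k).
Proof.
elim: k => [|k ih]; first by exists 1 => // n; exact: opb1.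
exact: boundedM bounded_W ih.
Qed.

Lemma mpow_conj n (Vs V X : 'M[C]_n) k : V *m Vs = 1%:M -> Vs *m V = 1%:M ->
  mpow (Vs *m X *m V) k = Vs *m mpow X k *m V.
Proof.
move=> h h'; elim: k => [|k ih]; first by rewrite /= mulmx1 h'.
have E n' (A : 'M[C]_n') : mpow A k.+1 = A *m mpow A k by [].
by rewrite !E ih (conj_mulmx _ _ h).
Qed.

Lemma mpow_diagC n (d : 'I_n -> R) k : mpow (diagC d) k = diagC (fun i => d i ^+ k).
Proof.
elim: k => [|k ih]; first by rewrite /= -diagC1.
have E n' (A : 'M[C]_n') : mpow A k.+1 = A *m mpow A k by [].
by rewrite E ih diagCM; congr diagC; apply/funext => i; rewrite exprS.
Qed.

(** With N of order K / e, each squared singular value above e costs at least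
    1/2 in the trace of W^N. As this trace is n tau (lw^N) up to o(n), and tau
    is at least 1 - 3 e, there are at most 10 e n of them. *)
Theorem small_of_measure e : 0 < e -> e <= 1 / 2 ->
  (completed_lebesgue_measure2 (domD R `&` [set z | (e < normc (pval l z))%R]) <= e%:E)%E ->
  small (10 * Num.sqrt e) (lmat l).
Proof.
move=> e0 e1 hmu.
pose N := (Num.truncn (K / e)).+1.
have Ke1 : 1 <= K / e by rewrite ler_pdivlMr// mul1r (le_trans e1)// (le_trans _ K1)//; lra.
have N1 : K / e <= N%:R by exact/ltW/Num.Theory.truncnS_gt.
have N2 : N%:R <= 2 * K / e.
  have := Num.Theory.truncn_itv (le_trans ler01 Ke1).
  rewrite /N -natr1 -mulrA; lra.
have htau := tau_lower e0 e1 N2 hmu.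
have [Kr hKr] := bounded_rank_Wpow N.
have [c c0 hc] := boundedD (bounded_Wpow N) (boundedN (bounded_lmat (lexp lw N))).
have [n0 hn0] := trace_rank c0 hc hKr e0.
have [n1 hn1] := natr_large (lnorm (lexp lw N)) e0.
exists (maxn n0 n1) => n; rewrite geq_max => /andP[/hn0 h0 /hn1 h1].
have h2 := trace_lmat (lexp lw N) n.
have [V [d [hV hX]]] := gram_spectral (lmat l n).
have d0 := gram_ge0 hV hX.
have dK i : d i / K <= 1.
  rewrite ler_pdivrMr// mul1r (le_trans (gram_le hV hX i (lnorm_ge0 l) (@opb_lmat R l n)))//.
  by rewrite lerDl.
pose S := [pred i | e < d i].
have hW : W n = V^t* *m diagC (fun i => 1 - d i / K) *m V.
  rewrite /W hX; have <- : diagC (fun _ => 1) - ((K^-1)%:C)%C *: diagC d = diagC (fun i => 1 - d i / K).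
    by rewrite diagCZ diagCB; congr diagC; apply/funext => i; rewrite mulrC.
  rewrite diagC1 mulmxBr mulmxBl mulmx1 unitary_mulVr//.
  by rewrite -scalemxAr -scalemxAl.
have trW : \tr (mpow (W n) N) = ((\sum_i (1 - d i / K) ^+ N)%:C)%C.
  rewrite hW (mpow_conj _ _ (unitary_mulV hV) (unitary_mulVr hV)) mpow_diagC mxtrace_mulC mulmxA unitary_mulV// mul1mx.
  by rewrite mxtrace_diagC.
have sumW : \sum_i (1 - d i / K) ^+ N <= n%:R - (#|S|)%:R / 2.
  apply: (@le_trans _ _ (\sum_(i < n) (1 - (S i)%:R / 2))).
    apply: ler_sum => i _; rewrite /S /=; case: ltP => hd; last first.
      by rewrite mul0r subr0 exprn_ile1// ?subr_ge0// lerBlDr lerDl divr_ge0// ltW.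
    have := @pow1B_half (d i / K) N; rewrite dK andbT divr_ge0 ?(ltW K0)//.
    move=> /(_ isT) h; have : 1 <= N%:R * (d i / K).
      apply: (@le_trans _ _ (K / e * (e / K))); first by rewrite mulrA divfK ?gt_eqF// divff ?gt_eqF.
      by rewrite ler_pM ?divr_ge0 ?(ltW e0) ?(ltW K0)// ler_pM2r ?invr_gt0// ltW.
    by move/h; rewrite /=; lra.
  rewrite sumrB sumr_const card_ord lerB// -mulr_suml ler_pM2r// -natr_sum.
  rewrite ler_nat -sum1_card big_mkcond /=.
  by apply: leq_sum => i _; rewrite unfold_in /=; case: (e < d i).
have hS : (#|S|)%:R <= 10 * e * n%:R.
  have h3 := re_le_normc (- (\tr (mpow (W n) N - lmat (lexp lw N) n))).
  have h4 := re_le_normc (- (\tr (lmat (lexp lw N) n) - tau (lexp lw N) * n%:R)).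
  rewrite normcN in h3; rewrite normcN in h4.
  have h5 := le_trans h3 h0; have h6 := le_trans h4 (le_trans h2 h1).
  rewrite !raddfN !raddfB /= trW in h5 *.
  rewrite !raddfN !raddfB /= in h6.
  have e7 : Re (tau (lexp lw N) * n%:R) = Re (tau (lexp lw N)) * n%:R.
    rewrite -[n%:R](rmorph_nat (real_complex R)); case: (tau _) => a b /=; ring.
  rewrite e7 in h6; have n0' : 0 <= n%:R :> R by [].
  have e8 (x : R) : Re (x%:C)%C = x by [].
  rewrite e8 in h5; have := ler_wpM2r n0' htau; lra.
have e' : 0 <= Num.sqrt e by exact: sqrtr_ge0.
have ee : e = Num.sqrt e * Num.sqrt e by rewrite -expr2 sqr_sqrtr// ltW.
have se1 : Num.sqrt e <= 1 by rewrite -[leRHS]sqrtr1 ler_wsqrtr//; lra.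
have [|Rn [Nn [hY hr hN]]] := @gram_split _ _ _ _ _ hV hX S e (ltW e0).
  by move=> i; rewrite /= -leNgt.
exists Rn, Nn; split=> //; last by apply: opb_le hN _; lra.
apply: (@le_trans _ _ (#|S|)%:R); first by rewrite ler_nat.
rewrite (le_trans hS)// ler_wpM2r// ler_wpM2l//; nra.
Qed.

End Key.

(** * Trigonometric polynomials *)

Section Ctrig.
Context {R : realType}.
Local Notation C := R[i].

Definition tsum (s : seq (C * int)) (th : R) : C := \sum_(m <- s) m.1 * cis m.2 th.
Definition ctrig (u : R -> C) := exists s, forall th, u th = tsum s th.

Lemma ctrig_cis c j : ctrig (fun th => c * cis j th).
Proof. by exists [:: (c, j)] => th; rewrite /tsum big_seq1. Qed.

Lemma eq_ctrig u v : (forall th, u th = v th) -> ctrig u -> ctrig v.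
Proof. by move=> h [s hs]; exists s => th; rewrite -h. Qed.

Lemma ctrig_cst c : ctrig (fun=> c).
Proof. by apply: eq_ctrig (ctrig_cis c 0) => th; rewrite cis0 mulr1. Qed.

Lemma ctrigD u v : ctrig u -> ctrig v -> ctrig (fun th => u th + v th).
Proof.
by move=> [s hs] [s' hs']; exists (s ++ s') => th; rewrite /tsum big_cat hs hs'.
Qed.

Lemma ctrigM u v : ctrig u -> ctrig v -> ctrig (fun th => u th * v th).
Proof.
move=> [s hs] [s' hs'].
exists [seq (m.1 * m'.1, m.2 + m'.2) | m <- s, m' <- s'] => th.
rewrite hs hs' /tsum big_allpairs_dep mulr_suml; apply: eq_bigr => m _.
by rewrite mulr_sumr; apply: eq_bigr => m' _; rewrite cisD /=; ring.
Qed.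

Lemma ctrigX u k : ctrig u -> ctrig (fun th => u th ^+ k).
Proof.
move=> h; elim: k => [|k ih]; first by apply: eq_ctrig (ctrig_cst 1) => th; rewrite expr0.
by apply: eq_ctrig (ctrigM h ih) => th; rewrite exprS.
Qed.

Definition rtrigp (u : R -> R) := ctrig (fun th => ((u th)%:C)%C).

Lemma eq_rtrigp u v : (forall th, u th = v th) -> rtrigp u -> rtrigp v.
Proof. by move=> h; apply: eq_ctrig => th; rewrite h. Qed.

Lemma rtrigp_cst c : rtrigp (fun=> c).
Proof. exact: ctrig_cst. Qed.

Lemma rtrigpD u v : rtrigp u -> rtrigp v -> rtrigp (fun th => u th + v th).
Proof. by move=> hu hv; apply: eq_ctrig (ctrigD hu hv) => th; rewrite rmorphD. Qed.

Lemma rtrigpM u v : rtrigp u -> rtrigp v -> rtrigp (fun th => u th * v th).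
Proof. by move=> hu hv; apply: eq_ctrig (ctrigM hu hv) => th; rewrite rmorphM. Qed.

Lemma rtrigpN u : rtrigp u -> rtrigp (fun th => - u th).
Proof.
move=> hu; apply: eq_rtrigp (rtrigpM (rtrigp_cst (-1)) hu) => th.
by rewrite mulN1r.
Qed.

Lemma rtrigpX u k : rtrigp u -> rtrigp (fun th => u th ^+ k).
Proof. by move=> hu; apply: eq_ctrig (ctrigX k hu) => th; rewrite rmorphXn. Qed.

Lemma cis_cos (th : R) : ((cos th)%:C)%C = (cis 1 th + cis (-1) th) / 2.
Proof.
rewrite cisN /cis mul1r; apply: (@mulIf _ 2); first by rewrite pnatr_eq0.
rewrite divfK ?pnatr_eq0//; apply/eqP; rewrite -[2]/(1 + 1) eq_complex /=.
by apply/andP; split; apply/eqP; ring.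
Qed.

Lemma cisB j (s th : R) : cis j (th - s) = cis j (- s) * cis j th.
Proof.
have -> : cis j (th - s) = cis 1 (j%:~R * (- s) + j%:~R * th).
  by rewrite /cis mul1r -mulrDr addrC.
by rewrite {1}/cis mul1r cosD sinD /cis; apply/eqP; rewrite eq_complex /= eqxx /= addrC mulrC [X in _ + X]mulrC addrC.
Qed.

Lemma rtrigp_cos s : rtrigp (fun th => cos (th - s)).
Proof.
have h := ctrigD (ctrig_cis (cis 1 (- s) / 2) 1) (ctrig_cis (cis (-1) (- s) / 2) (-1)).
apply: eq_ctrig h => th; rewrite cis_cos !cisB mulrDl.
by congr (_ + _); rewrite mulrAC.
Qed.

Lemma tsum_bounded s : exists M : R, forall th, normc (tsum s th) <= M.
Proof.
exists (\sum_(m <- s) normc m.1) => th.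
rewrite (le_trans (normc_sum _ _ _))// ler_sum// => m _.
by rewrite Normc.normcM normc_cis mulr1.
Qed.

Lemma re_tsum_rtrig (m : C * int) th :
  Re (m.1 * cis m.2 th) = rtrig m.2 (Re m.1) (Im m.1) th.
Proof. by case: m => [[a b] j]. Qed.

Lemma measurable_re_tsum s :
  measurable_fun [set: measurableTypeR R] (fun th => Re (tsum s th)).
Proof.
elim: s => [|m s ih].
  rewrite (_ : (fun _ => _) = cst 0); first exact: measurable_cst.
  by apply/funext => th; rewrite /tsum big_nil.
rewrite (_ : (fun _ => _) = rtrig m.2 (Re m.1) (Im m.1) \+ (fun th => Re (tsum s th))).
  by apply: measurable_funD => //; exact: measurable_rtrig.
apply/funext => th; rewrite /= -re_tsum_rtrig /tsum big_cons.
by case: (m.1 * _) => a b; case: (\sum_(j <- s) _).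
Qed.

Lemma rtrigp_measurable u : rtrigp u -> measurable_fun [set: measurableTypeR R] u.
Proof.
move=> [s hs]; rewrite (_ : u = fun th => Re (tsum s th)); first exact: measurable_re_tsum.
by apply/funext => th; rewrite -hs.
Qed.

Lemma rtrigp_bounded u : rtrigp u -> exists2 M : R, 0 <= M & forall th, `|u th| <= M.
Proof.
move=> [s hs]; have [M hM] := tsum_bounded s.
have h th : `|u th| <= M.
  have := hM th; rewrite -hs; apply: le_trans.
  by rewrite /= expr0n addr0 sqrtr_sqr.
by exists M => //; apply: le_trans (h 0).
Qed.

End Ctrig.

Section HatPow.
Context {R : realType}.
(** The powers used by Brosowski and Deutsch: they tend to 1 where w < 1/2 and
    to 0 where w > 1/2, so polynomials in w approach the indicator of
    w < 1/2. *)
Definition hat (n : nat) (w : R) : R := (1 - w ^+ n) ^+ (2 ^ n).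

Lemma hat_itv n w : 0 <= w <= 1 -> 0 <= hat n w <= 1.
Proof.
move=> /andP[w0 w1].
have h : 0 <= 1 - w ^+ n <= 1 by rewrite subr_ge0 exprn_ile1//= lerBlDr lerDl exprn_ge0.
have /andP[h0 h1] := h.
by rewrite /hat exprn_ge0// exprn_ile1.
Qed.

(** By Bernoulli, hat n w >= 1 - (2 w)^n. *)
Lemma cvg_hat1 w : 0 <= w -> w < 1 / 2 -> hat n w @[n --> \oo] --> (1 : R).
Proof.
move=> w0 w1; have w1' : w <= 1 by lra.
apply: (@squeeze_cvgr _ _ _ _ (fun n => 1 - (2 * w) ^+ n) (cst 1)).
- apply: nearW => n; have /andP[_ ->] := @hat_itv n w ltac:(by rewrite w0); rewrite andbT.
  have := @bern_ge R (- w ^+ n) (2 ^ n); rewrite /hat natrX => h.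
  rewrite exprMn -mulrN (le_trans (h _))//.
  by rewrite lerN2 exprn_ile1.
- rewrite -[X in _ --> X]subr0; apply: cvgB; first exact: cvg_cst.
  by apply: cvg_expr; rewrite ger0_norm; lra.
- exact: cvg_cst.
Qed.

(** hat n w (1 + w^n)^(2^n) <= 1, and the second factor is at least (2 w)^n. *)
Lemma cvg_hat0 w : 1 / 2 < w -> w <= 1 -> hat n w @[n --> \oo] --> (0 : R).
Proof.
move=> w0 w1; have w0' : 0 <= w by lra.
apply: (@squeeze_cvgr _ _ _ _ (cst 0) (fun n => ((2 * w)^-1) ^+ n)).
- apply: nearW => n; have /andP[h0 _] := @hat_itv n w ltac:(by rewrite w0').
  rewrite h0 /= exprVn -[leRHS]mul1r ler_pdivlMr ?exprn_gt0//; last by lra.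
  have wn : 0 <= w ^+ n by rewrite exprn_ge0.
  have := @bern_ge R (w ^+ n) (2 ^ n) ltac:(lra); rewrite natrX -exprMn => h.
  apply: (@le_trans _ _ (hat n w * (1 + w ^+ n) ^+ (2 ^ n))).
    by rewrite ler_wpM2l//; lra.
  rewrite /hat -exprMn exprn_ile1//; have := @exprn_ile1 _ n w w0' w1; nra.
- exact: cvg_cst.
- apply: cvg_expr; rewrite ger0_norm ?invr_ge0 ?invf_lt1; lra.
Qed.
End HatPow.

(** * The L1 closure of an algebra of bounded functions *)

Section L1.
Context {R : realType} disp (T : measurableType disp) (mu : {measure set T -> \bar R}).
Variables (I : set T) (mI : measurable I) (Ifin : (mu I < +oo)%E).
Variable tst : (T -> R) -> Prop.
Hypothesis tst_cst : forall c, tst (fun=> c).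
Hypothesis tstD : forall u v, tst u -> tst v -> tst (fun x => u x + v x).
Hypothesis tstM : forall u v, tst u -> tst v -> tst (fun x => u x * v x).
Hypothesis tst_meas : forall u, tst u -> measurable_fun I u.
Hypothesis tst_bounded : forall u, tst u -> exists2 M : R, 0 <= M & forall x, `|u x| <= M.
Implicit Types u v w t s : T -> R.
Definition L1d u v : \bar R := (\int[mu]_(x in I) (`|u x - v x|)%:E)%E.

Lemma measurable_dist u v : measurable_fun I u -> measurable_fun I v ->
  measurable_fun I (fun x : T => (`|u x - v x|)%:E).
Proof.
move=> hu hv; apply/measurable_EFinP; apply: measurableT_comp => //.
exact: measurable_funB.
Qed.

Lemma L1d_tri v u w : measurable_fun I u -> measurable_fun I v -> measurable_fun I w ->
  (L1d u w <= L1d u v + L1d v w)%E.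
Proof.
move=> hu hv mw; rewrite /L1d -ge0_integralD//; last 2 first.
- exact: measurable_dist.
- exact: measurable_dist.
apply: ge0_le_integral => //.
- exact: measurable_dist.
- by apply: emeasurable_funD; exact: measurable_dist.
- move=> x _; rewrite -EFinD lee_fin.
  by rewrite (_ : u x - w x = (u x - v x) + (v x - w x)) ?ler_normD//; ring.
Qed.

(** Membership in the L1 closure of the class [tst] of test functions. *)
Definition apx u := forall d : R, 0 < d ->
  exists2 t, tst t & (L1d u t <= d%:E)%E.

Lemma apx_close u : measurable_fun I u ->
  (forall d : R, 0 < d -> exists v, [/\ measurable_fun I v, apx v & (L1d u v <= d%:E)%E]) ->
  apx u.
Proof.
move=> hu h d d0; have d2 : 0 < d / 2 by rewrite divr_gt0.
have [v [hv av uv]] := h _ d2; have [t ht vt] := av _ d2.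
exists t => //; apply: le_trans (L1d_tri hu hv (tst_meas ht)) _.
by rewrite [d]splitr EFinD leeD.
Qed.

Lemma tst_apx u : tst u -> apx u.
Proof.
move=> hu d d0; exists u => //; rewrite /L1d integral0_eq ?lee_fin ?ltW//.
by move=> x _; rewrite subrr normr0.
Qed.

Lemma L1d_le (c1 c2 : R) u v (u1 v1 u2 v2 : T -> R) :
  0 <= c1 -> 0 <= c2 ->
  measurable_fun I u -> measurable_fun I v ->
  measurable_fun I u1 -> measurable_fun I v1 ->
  measurable_fun I u2 -> measurable_fun I v2 ->
  (forall x, I x -> `|u x - v x| <= c1 * `|u1 x - v1 x| + c2 * `|u2 x - v2 x|) ->
  (L1d u v <= c1%:E * L1d u1 v1 + c2%:E * L1d u2 v2)%E.
Proof.
move=> c10 c20 hu hv mu1 mv1 mu2 mv2 h.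
have m1 := measurable_dist mu1 mv1; have m2 := measurable_dist mu2 mv2.
rewrite /L1d -!ge0_integralZl//.
rewrite -ge0_integralD//; last 4 first.
- by move=> x _; rewrite mule_ge0.
- by apply: measurable_funeM.
- by move=> x _; rewrite mule_ge0.
- by apply: measurable_funeM.
apply: ge0_le_integral => //.
- exact: measurable_dist.
- by apply: emeasurable_funD; apply: measurable_funeM.
Qed.

Lemma apxD u v : measurable_fun I u -> measurable_fun I v -> apx u -> apx v ->
  apx (fun x => u x + v x).
Proof.
move=> hu hv au av d d0; have d2 : 0 < d / 2 by rewrite divr_gt0.
have [t ht ut] := au _ d2; have [s hs vs] := av _ d2.
exists (fun x => t x + s x); first exact: tstD.
have mt := tst_meas ht; have ms := tst_meas hs.
apply: (le_trans (@L1d_le 1 1 _ _ u t v s _ _ _ _ _ _ _ _ _)) => //.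
- exact: measurable_funD.
- exact: measurable_funD.
- move=> x _; rewrite !mul1r.
  by rewrite (_ : u x + v x - (t x + s x) = (u x - t x) + (v x - s x)) ?ler_normD//; ring.
- by rewrite !mul1e [d]splitr EFinD leeD.
Qed.

(** The approximant of u is chosen first, since the accuracy required from
    that of v depends on its bound. *)
Lemma apxM u v : measurable_fun I u -> measurable_fun I v ->
  (forall x, `|v x| <= 1) -> apx u -> apx v -> apx (fun x => u x * v x).
Proof.
move=> hu hv v1 au av d d0; have d2 : 0 < d / 2 by rewrite divr_gt0.
have [t ht ut] := au _ d2; have [M M0 hM] := tst_bounded ht.
have dM : 0 < d / 2 / (M + 1) by rewrite divr_gt0// ltr_wpDl.
have [s hs vs] := av _ dM.
exists (fun x => t x * s x); first exact: tstM.
have mt := tst_meas ht; have ms := tst_meas hs.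
apply: (le_trans (@L1d_le 1 (M + 1) _ _ u t v s _ _ _ _ _ _ _ _ _)) => //.
- by rewrite addr_ge0.
- exact: measurable_funM.
- exact: measurable_funM.
- move=> x _.
  rewrite (_ : u x * v x - t x * s x = (u x - t x) * v x + t x * (v x - s x)); last by ring.
  rewrite (le_trans (ler_normD _ _))// !normrM lerD//.
    by rewrite mul1r ler_piMr.
  by rewrite ler_wpM2r// (le_trans (hM x))// lerDl.
- have -> : d%:E = ((d / 2)%:E + (d / 2)%:E)%E by rewrite -EFinD -splitr.
  rewrite mul1e leeD//.
  rewrite (_ : d / 2 = (M + 1) * (d / 2 / (M + 1))).
    by rewrite EFinM lee_pmul2l// lte_fin ltr_wpDl.
  by rewrite [RHS]mulrC divfK// gt_eqF// ltr_wpDl.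
Qed.

Lemma apxZ c v : measurable_fun I v -> (forall x, `|v x| <= 1) -> apx v -> apx (fun x => c * v x).
Proof.
move=> mv v1 av; apply: apxM => //; last by apply: tst_apx; exact: tst_cst.
Qed.

(** Dominated convergence. *)
Lemma apx_lim (f : nat -> T -> R) u (N : set T) :
  measurable_fun I u -> (forall n, measurable_fun I (f n)) ->
  (forall n x, I x -> `|f n x| <= 1) ->
  measurable N -> mu N = 0%E ->
  (forall x, I x -> ~ N x -> f n x @[n --> \oo] --> u x) ->
  (forall n, apx (f n)) -> apx u.
Proof.
move=> hu hf f1 mN N0 fu af; apply: apx_close => // e e0.
have [||||| _ hc _] := @dominated_convergence _ _ _ mu _ mI
   (fun n x => (f n x)%:E) (fun x => (u x)%:E) (cst 1%:E).
- by move=> n; apply/measurable_EFinP; exact: hf.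
- exact/measurable_EFinP.
- exists N; split=> // x /= h; apply: contrapT => Nx; apply: h => Ix.
  by apply: cvg_EFin; [exact: nearW|exact: fu].
- rewrite (_ : cst 1%:E = EFin \o (cst 1 : T -> R))//.
  apply: measurable_bounded_integrable => //; exists 1; split; first exact: num_real.
  by move=> M hM x _ /=; rewrite normr1 ltW.
- by apply: aeW => x n Ix; rewrite lee_fin f1.
have [hfin hd0] := (fine_cvgP _ (0 : R)).1 hc.
have /cvgrPdist_le /(_ e e0) hd := hd0.
near \oo => n.
exists (f n); split => //.
have -> : L1d u (f n) = (\int[mu]_(x in I) `|(f n x)%:E - (u x)%:E|)%E.
  by apply: eq_integral => x _; rewrite -EFinB abse_EFin distrC.
rewrite -[leLHS]fineK; last by near: n.
rewrite lee_fin -[leLHS]ger0_norm; last by rewrite fine_ge0// integral_ge0.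
rewrite -[X in `|X|]opprK normrN -[X in `|X|]add0r; near: n; exact: hd.
Unshelve. all: by end_near. Qed.

Implicit Types A B : set T.

Definition apxset A := measurable A /\ apx (\1_A : T -> R).

Lemma eq_apx u v : (forall x, u x = v x) -> apx u -> apx v.
Proof. by move=> /funext ->. Qed.

Lemma norm_indic_le1 A x : `|\1_A x : R| <= 1.
Proof. by rewrite indicE; case: (_ \in _); rewrite /= ?normr1 ?normr0. Qed.

Lemma measurable_indicI A : measurable A -> measurable_fun I (\1_A : T -> R).
Proof. by move=> mA; apply: measurable_indic. Qed.

Lemma apx_cst (c : R) : apx (fun=> c).
Proof. by apply: tst_apx; exact: tst_cst. Qed.

Lemma apxsetC A : apxset A -> apxset (~` A).
Proof.
move=> [mA aA]; split; first exact: measurableC.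
have mi := measurable_indicI mA.
have h : apx (fun x => -1 * \1_A x) := apxZ (-1) mi (norm_indic_le1 A) aA.
have mh : measurable_fun I (fun x => -1 * \1_A x : R) by apply: measurable_funM.
have m1 : measurable_fun I (fun=> 1 : R) by exact: measurable_cst.
have h' := apxD m1 mh (apx_cst 1) h.
apply: eq_apx h' => x /=; rewrite !indicE in_setC.
by case: (x \in A); rewrite /= ?mulr1 ?mulr0 ?addr0// subrr.
Qed.

Lemma apxsetI A B : apxset A -> apxset B -> apxset (A `&` B).
Proof.
move=> [mA aA] [mB aB]; split; first exact: measurableI.
have h := apxM (measurable_indicI mA) (measurable_indicI mB) (norm_indic_le1 B) aA aB.
by apply: eq_apx h => x; rewrite !indicE in_setI -natrM mulnb.
Qed.

Lemma apxset0 : apxset set0.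
Proof. by split => //; apply: eq_apx (apx_cst 0) => x; rewrite indic0. Qed.

Lemma apxsetU A B : apxset A -> apxset B -> apxset (A `|` B).
Proof.
by move=> aA aB; rewrite -[A `|` B]setCK setCU; apply: apxsetC; apply: apxsetI; exact: apxsetC.
Qed.

Lemma apxset_bigcup (F : (set T)^nat) : (forall n, apxset (F n)) -> apxset (\bigcup_n F n).
Proof.
move=> hF; have mU : measurable (\bigcup_n F n).
  by apply: bigcupT_measurable => n; have [] := hF n.
split=> //; pose W n := \big[setU/set0]_(k < n) F k.
have aW n : apxset (W n).
  rewrite /W; elim/big_ind: _ => //; [exact: apxset0|exact: apxsetU].
apply: (@apx_lim (fun n => \1_(W n) : T -> R) _ set0) => //.
- by move=> n; apply: measurable_indicI; have [] := aW n.
- by move=> n x _; exact: norm_indic_le1.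
- move=> x _ _; rewrite indicE; have [|xU] := boolP (x \in \bigcup_n F n).
    rewrite inE => -[k _ Fkx]; apply: cvg_near_cst; exists k.+1 => // n /= kn.
    rewrite indicE (_ : (x \in W n) = true)//; apply/mem_set; rewrite /W.
    by rewrite -bigcup_mkord; exists k.
  apply: cvg_near_cst; apply: nearW => n; rewrite indicE (_ : (x \in W n) = false)//.
  apply/negbTE; apply: contra xU; rewrite !inE /W -bigcup_mkord => -[k _ ?].
  by exists k.
- by move=> n; have [] := aW n.
Qed.

(** Sets with indicator in the closure form a sigma-algebra, by [apx_lim]. *)
Lemma apxset_sigma (G : set (set T)) : (forall A, G A -> apxset A) ->
  forall A, <<s G >> A -> apxset A.
Proof.
move=> hG A; apply => /=; split; last exact: hG.
split; first exact: apxset0.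
- by move=> B hB; rewrite setTD; exact: apxsetC.
- exact: apxset_bigcup.
Qed.

Lemma apxset_ae A B N : apxset A -> measurable B -> measurable N -> mu N = 0%E ->
  (forall x, I x -> ~ N x -> (x \in A) = (x \in B)) -> apxset B.
Proof.
move=> [mA aA] mB mN N0 h; split=> //.
apply: (@apx_lim (fun n => \1_A : T -> R) _ N) => //.
- by move=> n x _; exact: norm_indic_le1.
- by move=> x Ix Nx; apply: cvg_near_cst; apply: nearW => n; rewrite !indicE h.
Qed.

Hypothesis all_apxset : forall A, measurable A -> apxset A.

Import HBSimple.

Lemma apx_sfun (g : {sfun T >-> R}) : apx g.
Proof.
have -> : (g : T -> R) = (fun x => \sum_(y <- finmap.enum_fset (fset_set (range g))) y * \1_(g @^-1` [set y]) x).
  by apply/funext => x; rewrite [LHS]fimfunE fsbig_finite.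
have mp (y : R) : measurable (g @^-1` [set y]) by exact: measurable_sfunP.
have ind (r : seq R) : measurable_fun I (fun x => \sum_(y <- r) y * \1_(g @^-1` [set y]) x) /\
    apx (fun x => \sum_(y <- r) y * \1_(g @^-1` [set y]) x).
  elim: r => [|y r [ihm iha]].
    rewrite (_ : (fun _ => _) = (fun=> 0 : R)); last by apply/funext => x; rewrite big_nil.
    by split; [exact: measurable_cst|exact: apx_cst].
  have [mA aA] := all_apxset (mp y); have mi := measurable_indicI mA.
  have h := apxZ y mi (norm_indic_le1 _) aA.
  have mh : measurable_fun I (fun x => y * \1_(g @^-1` [set y]) x : R).
    by apply: measurable_funM.
  rewrite (_ : (fun _ => _) = (fun x => y * \1_(g @^-1` [set y]) x + \sum_(y <- r) y * \1_(g @^-1` [set y]) x)).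
    by split; [exact: measurable_funD|exact: apxD mh ihm h iha].
  by apply/funext => x; rewrite big_cons.
exact: (ind _).2.
Qed.

Lemma apx_integrable u : mu.-integrable I (EFin \o u) -> apx u.
Proof.
move=> iu; have [g [ig _ gl]] := approximation_sfun_integrable mI iu.
have mu' : measurable_fun I u by apply/measurable_EFinP; exact: measurable_int iu.
apply: apx_close => // d d0.
have [hfin hd0] := (fine_cvgP _ (0 : R)).1 gl.
have /cvgrPdist_le /(_ d d0) hd := hd0.
near \oo => n.
exists (g n); split.
- exact: measurable_funTS.
- exact: apx_sfun.
have -> : L1d u (g n) = (\int[mu]_(x in I) `|(u x)%:E - (g n x)%:E|)%E.
  by apply: eq_integral => x _; rewrite -EFinB abse_EFin.
rewrite -[leLHS]fineK; last by near: n.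
rewrite lee_fin -[leLHS]ger0_norm; last by rewrite fine_ge0// integral_ge0.
rewrite -[X in `|X|]opprK normrN -[X in `|X|]add0r; near: n; exact: hd.
Unshelve. all: by end_near. Qed.

End L1.

(** * L1 density of the trigonometric polynomials *)

Section TrigDense.
Context {R : realType}.
Local Notation cT := (caratheodory_type ((@wlength R idfun)^*)%mu).
Local Notation cm := (@completed_lebesgue_measure R).

(** The interval [-pi, pi] with the completed Lebesgue measure, the domain of
    the symbols of Toeplitz matrices. *)
Definition circ : set cT := `[- pi, pi].
Local Notation I := circ.

Lemma borel_cara (A : set (measurableTypeR R)) : measurable A -> measurable (A : set cT).
Proof. exact: sub_caratheodory. Qed.

Lemma cm_borel (A : set R) : cm A = lebesgue_measure A.
Proof. by []. Qed.

Lemma measurable_circ : measurable I.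
Proof. by apply: borel_cara; exact: measurable_itv. Qed.

Lemma cm_circ : cm I = (2 * pi)%:E.
Proof. by rewrite cm_borel mu_I. Qed.

Lemma cm_circ_fin : (cm I < +oo)%E.
Proof. by rewrite cm_circ ltry. Qed.

Lemma measurable_cara (u : R -> R) (D : set cT) : measurable D ->
  measurable_fun [set: measurableTypeR R] u -> measurable_fun D u.
Proof.
move=> mD mu _ Y mY; apply: measurableI; first exact: mD.
apply: borel_cara; rewrite -[X in measurable X]setTI.
by apply: mu => //.
Qed.

Lemma rtrigp_meas (t : cT -> R) : rtrigp t -> measurable_fun I t.
Proof.
move=> h; apply: measurable_cara; [exact: measurable_circ|exact: rtrigp_measurable].
Qed.

Local Notation apx := (@apx R _ cT cm I (@rtrigp R)).
Local Notation apxset := (@apxset R _ cT cm I (@rtrigp R)).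

Lemma finite_cara (N : set cT) : finite_set N -> measurable N /\ cm N = 0%E.
Proof.
move=> fN; split.
  apply: borel_cara; apply: countable_measurable; last exact: finite_set_countable.
  by move=> x; exact: measurable_set1.
rewrite cm_borel; apply: countable_lebesgue_measure0; exact: finite_set_countable.
Qed.

Lemma cos_lt_arc (al y : R) : 0 < al -> al <= pi -> `|y| < al -> cos al < cos y.
Proof.
move=> a0 api ya; have -> : cos y = cos `|y|.
  by case: ger0P => // _; rewrite cosN.
by rewrite ltr_cos// in_itv /= ?normr_ge0 ?(ltW a0) ?api//= (le_trans (ltW ya)).
Qed.

Lemma cos_gt_arc (al y : R) : 0 < al -> al <= pi -> al < `|y| -> `|y| < 2 * pi - al ->
  cos y < cos al.
Proof.
move=> a0 api ya y2; have -> : cos y = cos `|y|.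
  by case: ger0P => // _; rewrite cosN.
have [ypi|ypi] := leP `|y| pi.
  by rewrite ltr_cos// in_itv /= ?normr_ge0 ?(ltW a0) ?api.
have -> : cos `|y| = cos (2 * pi - `|y|).
  by rewrite -[RHS]cosN opprB -[in LHS](subrK (2 * pi) `|y|) [X in cos (_ + X)]mulr_natl cosD2pi.
rewrite ltr_cos; last 2 first.
- by rewrite in_itv /=; apply/andP; split; lra.
- by rewrite in_itv /=; apply/andP; split; lra.
lra.
Qed.

(** Let s be the midpoint and al the half length. Then w = 1/2 + (cos al -
    cos (x - s)) / 4 takes values in [0, 1] and is below 1/2 exactly on the
    arc, up to the end points. *)
Lemma apxset_arc (c d : R) : - pi <= c -> c < d -> d <= pi -> apxset `]c, d[%classic.
Proof.
move=> c1 cd d1; have mA : measurable (`]c, d[%classic : set cT).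
  by apply: borel_cara; exact: measurable_itv.
split=> //.
pose s := (c + d) / 2; pose al := (d - c) / 2.
have a0 : 0 < al by rewrite /al; lra.
have api : al <= pi by rewrite /al; lra.
pose w (x : cT) : R := 1 / 2 + (cos al - cos (x - s)) / 4.
have w01 x : 0 <= w x <= 1.
  have := cos_geN1 al; have := cos_le1 al; have := cos_geN1 (x - s); have := cos_le1 (x - s).
  by rewrite /w => *; apply/andP; split; lra.
have tw : rtrigp w.
  have h := rtrigpD (rtrigp_cst (1 / 2 + cos al / 4)) (rtrigpM (rtrigp_cst (- (1 / 4))) (rtrigp_cos s)).
  by apply: eq_rtrigp h => x; rewrite /w; ring.
have tf n : rtrigp (fun x => hat n (w x)).
  have h := rtrigpX (2 ^ n) (rtrigpD (rtrigp_cst 1) (rtrigpN (rtrigpX n tw))).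
  by apply: eq_rtrigp h => x; rewrite /hat.
have fN : finite_set [set c; d; - pi; pi].
  by rewrite !finite_setU; do !split; exact: finite_set1.
have [mN N0] := finite_cara fN.
apply: (@apx_lim _ _ _ cm _ measurable_circ cm_circ_fin (@rtrigp R) rtrigp_meas (fun n x => hat n (w x)) _ [set c; d; - pi; pi]).
- exact: measurable_indic.
- by move=> n; exact: rtrigp_meas.
- move=> n x _; have /andP[h0 h1] := hat_itv n (w01 x).
  by rewrite ger0_norm.
- exact: mN.
- exact: N0.
- move=> x; rewrite /circ /= in_itv /= => /andP[x1 x2] xN.
  have [xc xd xpi xpi'] : [/\ x != c, x != d, x != - pi & x != pi].
    by split; apply/eqP => xe; apply: xN; rewrite /= xe; [do 3 left|do 2 left; right|left; right|right].
  have /andP[w0 w1] := w01 x.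
  rewrite indicE; have [xA|xA] := boolP (x \in _).
    apply: cvg_hat1 => //; rewrite inE /= in_itv /= in xA; case/andP: xA => xA xA'.
    have : cos al < cos (x - s).
      by apply: cos_lt_arc => //; rewrite ltr_norml /s /al; apply/andP; split; lra.
    rewrite /w; lra.
  apply: cvg_hat0 => //; rewrite notin_setE /= in_itv /= in xA.
  have : cos (x - s) < cos al.
    have xx : - pi < x < pi by rewrite !lt_neqAle eq_sym xpi x1 xpi' x2.
    have [xc'|xc'] : x < c \/ d < x.
      have [h|h] := ltP x c; first by left.
      right; rewrite lt_neqAle eq_sym xd leNgt /=; apply/negP => h'; apply: xA.
      by rewrite h' andbT lt_neqAle eq_sym xc.
    + by apply: cos_gt_arc => //; rewrite ltr0_norm /s /al; lra.
    + by apply: cos_gt_arc => //; rewrite gtr0_norm /s /al; lra.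
  rewrite /w; lra.
- by move=> n; apply: tst_apx.
Qed.

Let ae A B N := @apxset_ae _ _ _ cm _ measurable_circ cm_circ_fin (@rtrigp R) rtrigp_meas A B N.

(** Inside [-pi, pi] the half-open interval is an arc or empty, up to two
    points. *)
Lemma apxset_oc (a b : R) : apxset `]a, b]%classic.
Proof.
have pip := @pi_gt0 R.
have mB : measurable (`]a, b]%classic : set cT).
  by apply: borel_cara; exact: measurable_itv.
pose c := Num.max a (- pi); pose d := Num.min b pi.
have fN : finite_set [set c; d].
  by rewrite finite_setU; split; exact: finite_set1.
have [mN N0] := finite_cara fN.
have ca : a <= c by rewrite /c le_max lexx.
have cp : - pi <= c by rewrite /c le_max lexx orbT.
have db : d <= b by rewrite /d ge_min lexx.
have dp : d <= pi by rewrite /d ge_min lexx orbT.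
have cc x : a < x -> - pi <= x -> c <= x by rewrite /c ge_max => /ltW -> ->.
have dd x : x <= b -> x <= pi -> x <= d by rewrite /d le_min => -> ->.
have [cd|dc] := ltP c d.
  apply: (ae (apxset_arc cp cd dp) mB mN N0) => x.
  rewrite /circ /= in_itv /= => /andP[x1 x2] xN.
  have xc : x != c by apply/eqP => xe; apply: xN; left.
  have xd : x != d by apply/eqP => xe; apply: xN; right.
  apply/idP/idP; rewrite !inE /= !in_itv /= => /andP[h1 h2].
    by rewrite (le_lt_trans ca h1) (le_trans (ltW h2)).
  by rewrite lt_neqAle eq_sym xc cc//= lt_neqAle xd dd.
have s0 : apxset set0 by apply: apxset0; exact: rtrigp_cst.
apply: (ae s0 mB mN N0) => x.
rewrite /circ /= in_itv /= => /andP[x1 x2] xN; rewrite in_set0; apply/esym/negbTE.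
apply/negP; rewrite inE /= in_itv /= => /andP[h1 h2]; apply: xN; left => /=.
by apply/eqP; rewrite eq_le cc// andbT (le_trans _ dc)// dd.
Qed.

(** A set measurable for the completion is Borel up to a null set, and the
    half-open intervals generate the Borel sets. *)
Lemma apxset_cara (E : set cT) : measurable E -> apxset E.
Proof.
move=> mE; have : (completed_algebra_gen (@lebesgue_measure R)) E.
  rewrite -g_sigma_completed_algebra_genE completed_caratheodory_measurable.
  exact: mE.
move=> [A mA [N [B [mB B0 NB]] EAN]].
have sA : apxset A.
  apply: (@apxset_sigma _ _ _ cm _ measurable_circ cm_circ_fin _ (@rtrigp_cst R)
    (@rtrigpD R) (@rtrigpM R) rtrigp_meas (@rtrigp_bounded R) (@ocitv R)); last exact: mA.
  move=> _ [[a b] _ <-]; exact: apxset_oc.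
have cB0 : cm B = 0%E by exact: B0.
apply: (ae sA mE (borel_cara mB) cB0) => x _ xB.
rewrite -EAN in_setU; have [//|/= _] := boolP (x \in A).
by apply/esym/negbTE/negP; rewrite inE => /NB.
Qed.

Theorem trig_dense (u : R -> R) : cm.-integrable `[- pi, pi] (EFin \o u) ->
  forall d : R, 0 < d -> exists2 t, rtrigp t &
    (\int[cm]_(x in `[(- pi)%R, pi%R]) (`|u x - t x|)%:E <= d%:E)%E.
Proof.
move=> iu d d0.
exact: (@apx_integrable _ _ _ cm _ measurable_circ _ (@rtrigp_cst R)
    (@rtrigpD R) (@rtrigpM R) rtrigp_meas (@rtrigp_bounded R) apxset_cara u iu d d0).
Qed.

End TrigDense.

(** * Complex valued integrals *)

Section Cint.
Context {R : realType} disp (T : measurableType disp) (mu : {measure set T -> \bar R}).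
Variables (I : set T) (mI : measurable I).
Local Notation C := R[i].
Implicit Types h g : T -> C.

Definition cintble h :=
  mu.-integrable I (fun x => (Re (h x))%:E) /\
  mu.-integrable I (fun x => (Im (h x))%:E).

Definition cint h : C :=
  ((\int[mu]_(x in I) Re (h x)) +i* (\int[mu]_(x in I) Im (h x)))%C.

Lemma eq_cI h g : (forall x, h x = g x) -> cint h = cint g.
Proof. by move=> e; congr cint; apply/funext. Qed.

Lemma eq_cintble h g : (forall x, h x = g x) -> cintble h -> cintble g.
Proof. by move=> /funext ->. Qed.

Lemma cintble0 : cintble (fun=> 0).
Proof. by split; exact: integrable0. Qed.

Lemma cI0 : cint (fun=> 0) = 0.
Proof.
by rewrite /cint /= !Rintegral_cst// mul0r.
Qed.

Lemma cintbleD h g : cintble h -> cintble g -> cintble (fun x => h x + g x).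
Proof.
move=> [h1 h2] [g1 g2]; split.
- have := integrableD mI h1 g1; apply: eq_integrable => // x _ /=.
  by rewrite -EFinD; case: (h x) => a b; case: (g x).
- have := integrableD mI h2 g2; apply: eq_integrable => // x _ /=.
  by rewrite -EFinD; case: (h x) => a b; case: (g x).
Qed.

Lemma cID h g : cintble h -> cintble g -> cint (fun x => h x + g x) = cint h + cint g.
Proof.
move=> [h1 h2] [g1 g2]; rewrite /cint.
have -> : \int[mu]_(x in I) Re (h x + g x) =
    \int[mu]_(x in I) Re (h x) + \int[mu]_(x in I) Re (g x).
  by rewrite -RintegralD//; apply: eq_Rintegral => x _; case: (h x) => a b; case: (g x).
have -> : \int[mu]_(x in I) Im (h x + g x) =
    \int[mu]_(x in I) Im (h x) + \int[mu]_(x in I) Im (g x).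
  by rewrite -RintegralD//; apply: eq_Rintegral => x _; case: (h x) => a b; case: (g x).
by [].
Qed.

(** Domination by M |u|. *)
Lemma integrable_mulb (u v : T -> R) (M : R) : measurable_fun I v ->
  (forall x, `|v x| <= M) -> mu.-integrable I (fun x => (u x)%:E) ->
  mu.-integrable I (fun x => (v x * u x)%:E).
Proof.
move=> mv hv iu.
have mu' : measurable_fun I u by apply/measurable_EFinP; exact: measurable_int iu.
apply: (@le_integrable _ _ _ _ _ mI _ (fun x => (M%:E * (u x)%:E)%E)).
- by apply/measurable_EFinP; apply: measurable_funM.
- move=> x Ix; rewrite -EFinM !abse_EFin lee_fin !normrM ler_wpM2r//.
  by rewrite (le_trans (hv x))// ler_norm.
- exact: integrableZl.
Qed.

Lemma cintbleM h g (M : R) :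
  measurable_fun I (fun x => Re (g x)) -> measurable_fun I (fun x => Im (g x)) ->
  (forall x, `|Re (g x)| <= M) -> (forall x, `|Im (g x)| <= M) ->
  cintble h -> cintble (fun x => h x * g x).
Proof.
move=> m1 m2 b1 b2 [h1 h2]; split.
- have := integrableB mI (integrable_mulb m1 b1 h1) (integrable_mulb m2 b2 h2).
  apply: eq_integrable => // x _ /=; rewrite -EFinB; congr (_%:E).
  by case: (h x) => a b; case: (g x) => a' b' /=; ring.
- have := integrableD mI (integrable_mulb m2 b2 h1) (integrable_mulb m1 b1 h2).
  apply: eq_integrable => // x _ /=; rewrite -EFinD; congr (_%:E).
  by case: (h x) => a b; case: (g x) => a' b' /=; ring.
Qed.

Lemma cintbleZ (c : C) h : cintble h -> cintble (fun x => c * h x).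
Proof.
move=> hh.
have := @cintbleM h (fun=> c) (`|Re c| + `|Im c|) (measurable_cst _) (measurable_cst _).
move=> /(_ _ _ hh) H; apply: eq_cintble (H _ _) => [x||].
- by rewrite mulrC.
- by move=> _; rewrite lerDl.
- by move=> _; rewrite lerDr.
Qed.

Lemma cIZ (c : C) h : cintble h -> cint (fun x => c * h x) = c * cint h.
Proof.
move=> [h1 h2]; case: c => a b; rewrite /cint.
have ia u : mu.-integrable I (fun x => (u x)%:E) -> forall k : R, mu.-integrable I (EFin \o (fun x => k * u x)).
  by move=> iu k; have := integrableZl mI k iu; apply: eq_integrable.
have -> : \int[mu]_(x in I) Re ((a +i* b)%C * h x) =
   a * \int[mu]_(x in I) Re (h x) - b * \int[mu]_(x in I) Im (h x).
  rewrite -!RintegralZl// -RintegralB//; [|exact: ia|exact: ia].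
  by apply: eq_Rintegral => x _; case: (h x).
have -> : \int[mu]_(x in I) Im ((a +i* b)%C * h x) =
   a * \int[mu]_(x in I) Im (h x) + b * \int[mu]_(x in I) Re (h x).
  rewrite -!RintegralZl// -RintegralD//; [|exact: ia|exact: ia].
  by apply: eq_Rintegral => x _; case: (h x).
by [].
Qed.

Lemma cI_conj h : cintble h -> cint (fun x => (h x)^*) = (cint h)^*.
Proof.
move=> [h1 h2]; rewrite /cint.
rewrite (_ : \int[mu]_(x in I) Re ((h x)^*) = \int[mu]_(x in I) Re (h x)); last first.
  by apply: eq_Rintegral => x _; case: (h x).
rewrite (_ : \int[mu]_(x in I) Im ((h x)^*) = - \int[mu]_(x in I) Im (h x)); last first.
  rewrite -mulN1r -RintegralZl//; apply: eq_Rintegral => x _.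
  by case: (h x) => a b /=; rewrite mulN1r.
by [].
Qed.

Lemma cintble_sum (J : Type) (s : seq J) (F : J -> T -> C) :
  (forall j, cintble (F j)) -> cintble (fun x => \sum_(j <- s) F j x).
Proof.
move=> hF; elim: s => [|j s ih].
  by apply: eq_cintble cintble0 => x; rewrite big_nil.
by apply: eq_cintble (cintbleD (hF j) ih) => x; rewrite big_cons.
Qed.

Lemma cI_sum (J : Type) (s : seq J) (F : J -> T -> C) :
  (forall j, cintble (F j)) -> cint (fun x => \sum_(j <- s) F j x) = \sum_(j <- s) cint (F j).
Proof.
move=> hF; elim: s => [|j s ih].
  by rewrite big_nil -[RHS]cI0; apply: eq_cI => x; rewrite big_nil.
rewrite big_cons -ih -(cID (hF j) (cintble_sum s hF)).
by apply: eq_cI => x; rewrite big_cons.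
Qed.

Lemma cI_ge0 h : (forall x, 0 <= h x) -> 0 <= cint h.
Proof.
move=> h0; rewrite lecE /cint /=; apply/andP; split.
  apply/eqP; transitivity (\int[mu]_(x in I) (0 : R)).
    by apply: eq_Rintegral => x _; exact: ger0_Im.
  by rewrite Rintegral_cst// mul0r.
apply: Rintegral_ge0 => x _; have := h0 x.
by rewrite lecE => /andP[].
Qed.

End Cint.

(** * Toeplitz matrices *)

Section Toep.
Context {R : realType}.
Local Notation C := R[i].
Local Notation cT := (caratheodory_type ((@wlength R idfun)^*)%mu).
Local Notation cm := (@completed_lebesgue_measure R).
Local Notation I := (@circ R).
Local Notation cintble := (@cintble R _ cT cm I).
Local Notation cI := (@cint R _ cT cm I).

Let mI : measurable I := measurable_circ.

Lemma cm_integrable_rtrig j a b : cm.-integrable I (EFin \o rtrig j a b).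
Proof.
apply: measurable_bounded_integrable.
- exact: mI.
- exact: cm_circ_fin.
- by apply: measurable_cara; [exact: mI|exact: measurable_rtrig].
- exists (`|a| + `|b|); split; first exact: num_real.
  by move=> M hM y _ /=; rewrite (le_trans (rtrig_le _ _ _ _))// ltW.
Qed.

(** The completed measure pushes forward to Lebesgue measure on the Borel
    sets, where the integral was computed. *)
Lemma cm_int_rtrig j a b :
  (\int[cm]_(x in I) rtrig j a b x) = if j == 0 then 2 * pi * a else 0.
Proof.
rewrite /Rintegral.
have mphi : measurable_fun [set: cT] (idfun : cT -> measurableTypeR R).
  move=> _ Y mY; rewrite setTI; exact: borel_cara.
have mf : measurable_fun [set: measurableTypeR R] (EFin \o rtrig j a b).
  by apply/measurable_EFinP; exact: measurable_rtrig.
have mIb : measurable (`[- pi, pi]%classic : set (measurableTypeR R)) by exact: measurable_itv.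
have h := @integral_pushforward _ _ cT (measurableTypeR R) R _ mphi cm `[- pi, pi]%classic
  (EFin \o rtrig j a b) mf (cm_integrable_rtrig j a b) mIb.
have h2 : (\int[pushforward cm (idfun : cT -> measurableTypeR R)]_(y in `[(- pi)%R, pi%R]) (EFin \o rtrig j a b) y)%E =
  (\int[lebesgue_measure]_(y in `[(- pi)%R, pi%R]) (EFin \o rtrig j a b) y)%E.
  apply: eq_measure_integral => A mA _.
  by [].
have -> : (\int[cm]_(x in I) (rtrig j a b x)%:E)%E = (if j == 0 then 2 * pi * a else 0)%:E.
  exact: etrans (etrans (esym h) h2) (int_rtrig j a b).
by [].
Qed.

Lemma cintble_cis h j : cintble h -> cintble (fun t => h t * cis j t).
Proof.
apply: (@cintbleM _ _ _ cm _ mI h (fun t => cis j t) 1).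
- apply: measurable_cara; first exact: mI.
  rewrite (_ : (fun _ => _) = rtrig j 1 0); first exact: measurable_rtrig.
  by apply/funext => t; rewrite /rtrig mul0r subr0 mul1r.
- apply: measurable_cara; first exact: mI.
  rewrite (_ : (fun _ => _) = rtrig j 0 (-1)); first exact: measurable_rtrig.
  by apply/funext => t; rewrite /rtrig mul0r sub0r mulN1r opprK.
- by move=> t; rewrite /= ler_norml cos_geN1 cos_le1.
- by move=> t; rewrite /= ler_norml sin_geN1 sin_le1.
Qed.

Lemma cintble_cis1 (j : int) : cintble (fun t => cis j t).
Proof.
split.
- have := cm_integrable_rtrig j 1 0; apply: eq_integrable; first exact: mI.
  by move=> t _; rewrite /= /rtrig mul0r subr0 mul1r.
- have := cm_integrable_rtrig j 0 (-1); apply: eq_integrable; first exact: mI.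
  by move=> t _; rewrite /= /rtrig mul0r sub0r mulN1r opprK.
Qed.

Lemma cI_cis (j : int) : cI (fun t => cis j t) = if j == 0 then ((2 * pi)%:C)%C else 0.
Proof.
rewrite /cint.
have -> : \int[cm]_(x in I) Re (cis j x) = \int[cm]_(x in I) rtrig j 1 0 x.
  by apply: eq_Rintegral => t _; rewrite /= /rtrig mul0r subr0 mul1r.
have -> : \int[cm]_(x in I) Im (cis j x) = \int[cm]_(x in I) rtrig j 0 (-1) x.
  by apply: eq_Rintegral => t _; rewrite /= /rtrig mul0r sub0r mulN1r opprK.
by rewrite !cm_int_rtrig; case: eqP => _; rewrite ?mulr1 ?mulr0.
Qed.

Lemma fourierE h k :
  fourier_coef h k = (((2 * pi)^-1)%:C)%C * cI (fun t => h t * cis (- k) t).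
Proof.
rewrite /fourier_coef; congr (_ * _).
rewrite -[LHS]/(cI (fun t => h t * (cos (k%:~R * t) -i* sin (k%:~R * t))%C)).
apply: eq_cI => t; congr (_ * _).
by rewrite /cis intrN mulNr cosN sinN.
Qed.

Lemma fourierD h g k : cintble h -> cintble g ->
  fourier_coef (fun t => h t + g t) k = fourier_coef h k + fourier_coef g k.
Proof.
move=> hh hg; rewrite !fourierE -mulrDr; congr (_ * _).
rewrite -(cID mI (cintble_cis _ hh) (cintble_cis _ hg)).
by apply: eq_cI => t; rewrite mulrDl.
Qed.

Lemma fourierZ c h k : cintble h -> fourier_coef (fun t => c * h t) k = c * fourier_coef h k.
Proof.
move=> hh; rewrite !fourierE mulrCA; congr (_ * _).
rewrite -(cIZ mI _ (cintble_cis _ hh)).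
by apply: eq_cI => t; rewrite mulrA.
Qed.

Lemma fourier_tsum (s : seq (C * int)) k :
  fourier_coef (tsum s) k = \sum_(m <- s) m.1 * (k == m.2)%:R.
Proof.
have pip : 2 * pi != 0 :> R by rewrite mulf_neq0// gt_eqF// pi_gt0.
rewrite fourierE.
transitivity ((((2 * pi)^-1)%:C)%C * cI (fun t => \sum_(m <- s) m.1 * cis (m.2 - k) t)).
  congr (_ * _); apply: eq_cI => t; rewrite /tsum mulr_suml.
  by apply: eq_bigr => m _; rewrite cisD mulrA.
rewrite (@cI_sum _ _ _ _ _ mI _ s (fun m t => m.1 * cis (m.2 - k) t)); last first.
  by move=> m; apply: cintbleZ; [exact: mI|exact: cintble_cis1].
rewrite mulr_sumr; apply: eq_bigr => m _.
rewrite (cIZ mI _ (cintble_cis1 _)) cI_cis subr_eq0 eq_sym mulrCA; congr (_ * _).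
case: eqP => _; last by rewrite mulr0.
by rewrite -rmorphM mulVf.
Qed.

Lemma toeplitz_tsum n (s : seq (C * int)) : toeplitz n (tsum s) = \sum_(m <- s) m.1 *: shift n m.2.
Proof.
apply/matrixP => i j; rewrite mxE fourier_tsum summxE; apply: eq_bigr => m _.
by rewrite !mxE.
Qed.

Lemma toeplitzD n h g : cintble h -> cintble g ->
  toeplitz n (fun t => h t + g t) = toeplitz n h + toeplitz n g.
Proof. by move=> hh hg; apply/matrixP => i j; rewrite !mxE fourierD. Qed.

Lemma toeplitzZ n c h : cintble h -> toeplitz n (fun t => c * h t) = c *: toeplitz n h.
Proof. by move=> hh; apply/matrixP => i j; rewrite !mxE fourierZ. Qed.

Lemma cintble_tsum (s : seq (C * int)) : cintble (tsum s).
Proof.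
apply: (@cintble_sum _ _ _ _ _ mI _ s (fun m t => m.1 * cis m.2 t)) => m.
by apply: cintbleZ; [exact: mI|exact: cintble_cis1].
Qed.

Lemma conj_realC (x : R) : ((x%:C)%C)^* = (x%:C)%C.
Proof. exact: conjc_real. Qed.

Section Positive.
Variable g : R -> R.
Hypothesis ig : cm.-integrable I (fun t => (g t)%:E).
Hypothesis g0 : forall t, 0 <= g t.
Let gC (t : R) : C := ((g t)%:C)%C.

Let cg : cintble gC.
Proof. by split => //; exact: integrable0. Qed.

Lemma toeplitz_herm n : (toeplitz n gC)^t* = toeplitz n gC.
Proof.
apply/matrixP => r s; rewrite !mxE !fourierE rmorphM /=.
congr (_ * _); first by rewrite conj_realC.
rewrite -(cI_conj mI (cintble_cis _ cg)); apply: eq_cI => t.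
rewrite rmorphM /= -cisN opprK opprB; congr (_ * _).
by rewrite /gC conj_realC.
Qed.

(** <T(g) x, x> is the mean of g |S|^2, where S is the trigonometric polynomial
    with coefficients x. *)
Lemma toeplitz_psd n (x : 'cV[C]_n) : 0 <= (x^t* *m (toeplitz n gC *m x)) ord0 ord0.
Proof.
have pip : 0 < 2 * pi :> R by rewrite mulr_gt0// pi_gt0.
pose S (t : R) : C := \sum_(s < n) x s ord0 * cis (s : nat)%:Z t.
have -> : (x^t* *m (toeplitz n gC *m x)) ord0 ord0 =
  (((2 * pi)^-1)%:C)%C * cI (fun t => gC t * (S t * (S t)^*)).
  transitivity (\sum_(r < n) \sum_(s < n) (((2 * pi)^-1)%:C)%C *
     cI (fun t => ((x r ord0)^* * x s ord0) * (gC t * cis (- ((r : nat)%:Z - (s : nat)%:Z)) t))).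
    rewrite mxE; apply: eq_bigr => r _; rewrite [X in _ * X]mxE mulr_sumr; apply: eq_bigr => s _.
    rewrite !mxE fourierE (cIZ mI _ (cintble_cis _ cg)).
    by move: (cint _ _ _) (_%:C)%C ((x r ord0)^*) => w1 w2 w3; ring.
  have hc (r s : 'I_n) : cintble (fun t => ((x r ord0)^* * x s ord0) * (gC t * cis (- ((r : nat)%:Z - (s : nat)%:Z)) t)).
    by apply: cintbleZ; [exact: mI|exact: cintble_cis].
  under eq_bigr => r _ do rewrite -mulr_sumr -(cI_sum mI _ (hc r)).
  rewrite -mulr_sumr -(@cI_sum _ _ _ _ _ mI _ _ (fun r t => \sum_(s < n) ((x r ord0)^* * x s ord0) * (gC t * cis (- ((r : nat)%:Z - (s : nat)%:Z)) t))); last first.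
    by move=> r; apply: (cintble_sum mI _ (hc r)).
  congr (_ * _); apply: eq_cI => t.
  rewrite /S rmorph_sum /= mulrC mulr_suml exchange_big /= mulr_suml.
  apply: eq_bigr => s _; rewrite mulr_sumr mulr_suml; apply: eq_bigr => r _.
  by rewrite rmorphM /= -cisN opprB cisD /=; ring.
rewrite mulr_ge0//; first by rewrite ler0c invr_ge0 ltW.
apply: cI_ge0; first exact: mI.
move=> t; rewrite mulr_ge0//; first by rewrite ler0c.
by rewrite -normCK exprn_ge0.
Qed.

Lemma trace_toeplitz n : \tr (toeplitz n gC) =
  (((2 * pi)^-1 * (\int[cm]_(t in I) g t) * n%:R)%:C)%C.
Proof.
rewrite /mxtrace.
transitivity (\sum_(i < n) (((2 * pi)^-1 * (\int[cm]_(t in I) g t))%:C)%C : C).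
  apply: eq_bigr => i _; rewrite mxE subrr fourierE rmorphM; congr (_ * _).
  rewrite (@eq_cI _ _ _ cm I _ gC); last by move=> t; rewrite oppr0 cis0 mulr1.
  by rewrite /cint /= Rintegral_cst ?mul0r//; exact: mI.
by rewrite sumr_const card_ord mulr_natr rmorphMn.
Qed.

(** The eigenvalues are nonnegative and their mean is that of g, hence at most
    d^2; so at most d n of them exceed d. *)
Lemma toeplitz_pos_small (d : R) : 0 < d -> (\int[cm]_(t in I) (g t)%:E <= (d ^+ 2)%:E)%E ->
  small d (fun n => toeplitz n gC).
Proof.
move=> d0 hd; have pip : 2 <= pi :> R by exact: pi_ge2.
have hG : \int[cm]_(t in I) g t <= d ^+ 2.
  rewrite -lee_fin /Rintegral fineK//; apply: integrable_fin_num => //; exact: mI.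
exists 0%N => n _.
have [V [e [hV hT]]] := hermitian_spectral (toeplitz_herm n).
have e0 i : 0 <= e i.
  have := toeplitz_psd (V^t* *m (delta_mx i ord0 : 'cV_n)).
  rewrite hT -lecR; congr (_ <= _).
  rewrite trmxCM trmxCK -!mulmxA (mulmxA V (V^t*) (delta_mx _ _)) unitary_mulV// mul1mx.
  rewrite (mulmxA V (V^t*)) unitary_mulV// mul1mx mulmxA.
  rewrite /diagC mul_mx_diag mxE (bigD1 i)//= big1 ?addr0 => [|j ji].
    by rewrite !mxE !eqxx conjC1 mul1r mulr1.
  by rewrite !mxE (negbTE ji) mulr0.
have se : \sum_i e i <= d ^+ 2 * n%:R.
  have := trace_toeplitz n; rewrite hT mxtrace_mulC mulmxA unitary_mulV// mul1mx mxtrace_diagC.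
  move=> /complexI ->; rewrite ler_wpM2r//.
  apply: (@le_trans _ _ ((2 * pi)^-1 * d ^+ 2)).
    by rewrite ler_wpM2l// invr_ge0; lra.
  rewrite ler_piMl ?sqr_ge0// invf_le1; lra.
have hX : (toeplitz n gC)^t* *m toeplitz n gC = V^t* *m diagC (fun i => e i * e i) *m V.
  rewrite toeplitz_herm hT -diagCM.
  exact: (conj_mulmx _ _ (unitary_mulV hV)).
pose S := [pred i | d < e i].
have [|Rn [Nn [hY hr hN]]] := @gram_split _ _ _ _ _ hV hX S (d ^+ 2) (sqr_ge0 d).
  move=> i; rewrite /= -leNgt => h; rewrite -expr2 ler_pXn2r ?nnegrE ?(ltW d0)//.
exists Rn, Nn; split=> //; last by move: hN; rewrite sqrtr_sqr gtr0_norm.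
apply: (@le_trans _ _ (#|S|)%:R); first by rewrite ler_nat.
rewrite -(ler_pM2l d0) mulrA -expr2 (le_trans _ se)//.
rewrite -sum1_card natr_sum mulr_sumr big_mkcond ler_sum// => i _.
by case: ifP => [|_]; rewrite ?mulr1// unfold_in /= => /ltW.
Qed.

End Positive.

End Toep.

Section PosPart.
Context {R : realType} disp (T : measurableType disp) (mu : {measure set T -> \bar R}).
Variables (I : set T) (mI : measurable I).

(** The sign s selects the positive or the negative part of u. *)
Lemma half_part (u : T -> R) (s : bool) : mu.-integrable I (fun x => (u x)%:E) ->
  let g x := (`|u x| + (-1) ^+ s * u x) / 2 in
  [/\ mu.-integrable I (fun x => (g x)%:E), (forall x, 0 <= g x) &
    (\int[mu]_(x in I) (g x)%:E <= \int[mu]_(x in I) (`|u x|)%:E)%E].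
Proof.
move=> iu g.
have mu' : measurable_fun I u by apply/measurable_EFinP; exact: measurable_int iu.
have le1 x : `|(-1) ^+ s * u x| <= `|u x| by rewrite normrM normrX normrN1 expr1n mul1r.
have g0 x : 0 <= g x.
  rewrite /g divr_ge0//; have := le1 x; rewrite ler_norml => /andP[+ _]; lra.
have gle x : g x <= `|u x|.
  rewrite /g; have := le1 x; rewrite ler_norml => /andP[_ +]; lra.
have mg : measurable_fun I g.
  apply: measurable_funM => //; apply: measurable_funD; first exact: measurableT_comp.
  exact: measurable_funM.
split=> //.
- apply: (le_integrable mI _ _ (integrable_abse iu)).
    exact/measurable_EFinP.
  move=> x _; have : (`|g x| <= `| `|u x| |)%R by rewrite normr_id ger0_norm.
  by rewrite -lee_fin.
- apply: ge0_le_integral => //.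
  + by move=> x _; rewrite lee_fin.
  + exact/measurable_EFinP.
  + by apply/measurable_EFinP; exact: measurableT_comp.
  + by move=> x _; rewrite lee_fin.
Qed.

Lemma jordan_parts (u : T -> R) : mu.-integrable I (fun x => (u x)%:E) ->
  exists p q : T -> R, [/\ forall x, u x = p x - q x,
    mu.-integrable I (fun x => (p x)%:E) /\ mu.-integrable I (fun x => (q x)%:E),
    (forall x, 0 <= p x) /\ (forall x, 0 <= q x) &
    (\int[mu]_(x in I) (p x)%:E <= \int[mu]_(x in I) (`|u x|)%:E)%E /\
    (\int[mu]_(x in I) (q x)%:E <= \int[mu]_(x in I) (`|u x|)%:E)%E].
Proof.
move=> iu; have [i1 g1 h1] := half_part false iu; have [i2 g2 h2] := half_part true iu.
do 2 eexists; split; [|split; [exact: i1|exact: i2]|split; [exact: g1|exact: g2]|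
  split; [exact: h1|exact: h2]].
by move=> x /=; rewrite expr0 expr1 mul1r mulN1r; field.
Qed.

End PosPart.

Section ToepSmall.
Context {R : realType}.
Local Notation C := R[i].
Local Notation cT := (caratheodory_type ((@wlength R idfun)^*)%mu).
Local Notation cm := (@completed_lebesgue_measure R).
Local Notation I := (@circ R).
Let mI : measurable I := measurable_circ.

Lemma toeplitz_real_small (u : R -> R) (d : R) : 0 < d ->
  cm.-integrable I (fun t => (u t)%:E) ->
  (\int[cm]_(t in I) (`|u t|)%:E <= (d ^+ 2)%:E)%E ->
  small (2 * d) (fun n => toeplitz n (fun t => ((u t)%:C)%C)).
Proof.
move=> d0 iu hu.
have [p [q [upq [i1 i2] [g1 g2] [h1 h2]]]] := jordan_parts mI iu.
have s1 := toeplitz_pos_small i1 g1 d0 (le_trans h1 hu).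
have s2 := toeplitz_pos_small i2 g2 d0 (le_trans h2 hu).
have cb g : cm.-integrable I (fun t => (g t)%:E) -> @cintble R _ cT cm I (fun t => ((g t)%:C)%C).
  by move=> ig; split => //; exact: integrable0.
apply: eq_small (small_le _ (smallB s1 s2)) => [n|]; last by lra.
rewrite -scaleN1r -(toeplitzZ n (-1) (cb _ i2)) -(toeplitzD n (cb _ i1) (cintbleZ mI (-1) (cb _ i2))).
by congr toeplitz; apply/funext => t; rewrite mulN1r -rmorphB upq.
Qed.

(** Decompose into real and imaginary, positive and negative parts. *)
Lemma toeplitz_small (h : R -> C) (d : R) : 0 < d -> cintegrable_pi h ->
  (\int[cm]_(t in I) (`|Re (h t)|)%:E <= (d ^+ 2)%:E)%E ->
  (\int[cm]_(t in I) (`|Im (h t)|)%:E <= (d ^+ 2)%:E)%E ->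
  small (4 * d) (fun n => toeplitz n h).
Proof.
move=> d0 [i1 i2] h1 h2.
have s1 := toeplitz_real_small d0 i1 h1.
have s2 := toeplitz_real_small d0 i2 h2.
have n1 : normc (0 +i* 1 : C)%C <= 1 by rewrite /= expr0n expr1n add0r sqrtr1.
have d2 : 0 <= 2 * d by lra.
have s3 := smallZ (lexx 1) d2 n1 s2.
have cb g : cm.-integrable I (fun t => (g t)%:E) -> @cintble R _ cT cm I (fun t => ((g t)%:C)%C).
  by move=> ig; split => //; exact: integrable0.
apply: eq_small (small_le _ (smallD s1 s3)) => [n|]; last by lra.
rewrite -(toeplitzZ n _ (cb _ i2)) -(toeplitzD n (cb _ i1) (cintbleZ mI _ (cb _ i2))).
congr toeplitz; apply/funext => t; case: (h t) => a b.
by apply/eqP; rewrite eq_complex /=; apply/andP; split; apply/eqP; ring.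
Qed.

Lemma ctrig_dense (h : R -> C) (d : R) : 0 < d -> cintegrable_pi h ->
  exists s : seq (C * int),
    (\int[cm]_(t in I) (`|Re (h t - tsum s t)|)%:E <= d%:E)%E /\
    (\int[cm]_(t in I) (`|Im (h t - tsum s t)|)%:E <= d%:E)%E.
Proof.
move=> d0 [i1 i2].
have [t1 [s1 ht1] h1] := trig_dense i1 d0; have [t2 [s2 ht2] h2] := trig_dense i2 d0.
have [s hs] := ctrigD (ex_intro _ s1 ht1) (ctrigM (ctrig_cst (0 +i* 1 : C)%C) (ex_intro _ s2 ht2)).
have e t : tsum s t = (t1 t +i* t2 t)%C.
  rewrite -hs; apply/eqP; rewrite eq_complex /=; apply/andP; split; apply/eqP; ring.
exists s; split.
- apply: le_trans h1; rewrite le_eqVlt; apply/orP; left; apply/eqP.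
  by apply: eq_integral => t _; rewrite e; case: (h t).
- apply: le_trans h2; rewrite le_eqVlt; apply/orP; left; apply/eqP.
  by apply: eq_integral => t _; rewrite e; case: (h t).
Qed.

Lemma cintegrableB (h : R -> C) s : cintegrable_pi h -> cintegrable_pi (fun t => h t - tsum s t).
Proof.
move=> hh; have h1 := cintbleZ mI (-1) (cintble_tsum s).
have := cintbleD mI hh h1; apply: eq_cintble => t.
by rewrite mulN1r.
Qed.

Lemma toeplitzB n (h : R -> C) s : cintegrable_pi h ->
  toeplitz n h = toeplitz n (tsum s) + toeplitz n (fun t => h t - tsum s t).
Proof.
move=> hh; rewrite -(toeplitzD n (cintble_tsum s) (cintegrableB s hh)).
by congr toeplitz; apply/funext => t; rewrite addrC subrK.
Qed.

End ToepSmall.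

(** * Locally Toeplitz matrices are sums of diagonal Toeplitz blocks *)

Section LTmat.
Context {R : realType}.
Local Notation C := R[i].

(** The projector on the i-th of m consecutive blocks of coordinates of length
    n / m; the n mod m last coordinates are in no block. *)
Definition blockproj (m i n : nat) : 'M[C]_n :=
  step n (i.+1 * (n %/ m)) - step n (i * (n %/ m)).

Lemma itv_bool (i N r : nat) :
  (r < i.+1 * N)%N%:R - (r < i * N)%N%:R = (i * N <= r < i.+1 * N)%N%:R :> C.
Proof.
have h : (i * N <= i.+1 * N)%N by rewrite leq_mul2r leqnSn orbT.
case: (leqP (i * N) r) => h1 /=; first by rewrite [_%:R in X in _ - X]/(0) subr0.
by rewrite (leq_trans h1 h) subrr.
Qed.

Lemma blockproj_mul m i n p (A : 'M[C]_(n, p)) r s :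
  (blockproj m i n *m A) r s = (i * (n %/ m) <= r < i.+1 * (n %/ m))%N%:R * A r s.
Proof.
rewrite /blockproj mulmxBl mxE [X in _ + X]mxE !mul_step -mulrBl; congr (_ * _).
exact: itv_bool.
Qed.

Lemma mul_blockproj m i n p (A : 'M[C]_(p, n)) r s :
  (A *m blockproj m i n) r s = A r s * (i * (n %/ m) <= s < i.+1 * (n %/ m))%N%:R.
Proof.
rewrite /blockproj mulmxBr mxE [X in _ + X]mxE !mul_mx_step -mulrBr; congr (_ * _).
exact: itv_bool.
Qed.

Lemma LT_mxE n m a (h : R -> C) (r s : 'I_n) : (0 < m)%N ->
  LT_mx n m a h r s =
  if [&& (r < m * (n %/ m))%N, (s < m * (n %/ m))%N & (r %/ (n %/ m) == s %/ (n %/ m))%N]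
  then a ((r %/ (n %/ m)).+1%:R / m%:R) * fourier_coef h ((r : nat)%:Z - (s : nat)%:Z) else 0.
Proof.
move=> m0; rewrite /LT_mx castmxE.
set r' := cast_ord _ r; set s' := cast_ord _ s.
have er : (r : nat) = r' by []. have es : (s : nat) = s' by [].
rewrite er es; move: r' s' {er es} => r' s' {r s}.
rewrite block_mxEh mxE.
case: (split_ordP s') => s -> /=; rewrite mxE; case: (split_ordP r') => r -> /=.
- rewrite mxE /= /diag_sampling !mxE /=.
  rewrite -val_eqE /=; case: eqP => [e|_]; last by rewrite mulr0n mul0r.
  rewrite mulr1n; congr (_ * fourier_coef h _).
  rewrite [X in _ = X%:Z - _](divn_eq r (n %/ m)) [X in _ = _ - X%:Z](divn_eq s (n %/ m)) e.
  by rewrite !PoszD; ring.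
- by rewrite mxE.
- by rewrite mxE.
- by rewrite mxE.
Qed.

(** This replaces the Kronecker product of the definition by compressions of
    one Toeplitz matrix of size n to diagonal blocks. *)
Lemma LT_mx_blocks n m a (h : R -> C) : (0 < m)%N ->
  LT_mx n m a h = \sum_(i < m) a ((i : nat).+1%:R / m%:R) *:
    (blockproj m i n *m toeplitz n h *m blockproj m i n).
Proof.
move=> m0; apply/matrixP => r s; rewrite LT_mxE// summxE.
transitivity (\sum_(i < m) a ((i : nat).+1%:R / m%:R) *
   ((i * (n %/ m) <= r < i.+1 * (n %/ m))%N%:R * fourier_coef h ((r : nat)%:Z - (s : nat)%:Z) *
    (i * (n %/ m) <= s < i.+1 * (n %/ m))%N%:R)); last first.
  by apply: eq_bigr => i _; rewrite mxE mul_blockproj blockproj_mul [toeplitz _ _ _ _]mxE.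
set N := (n %/ m)%N.
have [N0|Np] := posnP N.
  rewrite N0 muln0 /= big1// => i _; rewrite !muln0 ltn0 andbF mul0r mul0r mulr0//.
have qE i (x : nat) : (i * N <= x < i.+1 * N)%N = (x %/ N == i)%N.
  by rewrite eqn_leq andbC leq_divRL// -[(x %/ N <= i)%N]ltnS ltn_divLR.
under eq_bigr => i _ do rewrite !qE.
have [rm|rm] := ltnP r (m * N); last first.
  rewrite big1 // => i _; rewrite (_ : (r %/ N == i)%N = false) ?mul0r ?mulr0//.
  apply/negbTE/negP => /eqP e; have := ltn_ord i; rewrite -e ltnNge leq_divRL//.
  by rewrite rm.
have hr : (r %/ N < m)%N by rewrite ltn_divLR.
rewrite (bigD1 (Ordinal hr))//= big1 ?addr0 => [|i ir]; last first.
  rewrite (_ : (r %/ N == i)%N = false) ?mul0r ?mulr0//.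
  by apply/negbTE; rewrite eq_sym; move: ir; rewrite -val_eqE.
rewrite eqxx mul1r [(s %/ N == _)%N]eq_sym; case: eqP => [e|_]; last first.
  by rewrite andbF !mulr0.
by rewrite mulr1 andbT (_ : (s < m * N)%N = true)// -ltn_divLR// -e.
Qed.

Lemma rank_stepB n T T' : (\rank (step n T - step n T' : 'M[C]_n)%R <= (T - T') + (T' - T))%N.
Proof.
apply: (@leq_trans #|[pred r : 'I_n | (minn T T' <= r < maxn T T')%N]|).
  apply: rank_rows => r /= hr s; rewrite !mxE; case: eqP => //= _; last by rewrite subrr.
  suff -> : (r < T)%N = (r < T')%N by rewrite subrr.
  by apply/idP/idP => ?; move: hr; lia.
by rewrite (leq_trans (card_ord_itv _ _ _))//; lia.
Qed.

(** Block ends are computed from n / m rounded down, truncations of the grid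
    point i / m from n; the rounding errors differ by at most i. *)
Lemma cut_grid m i n : (0 < m)%N -> (i * (n %/ m) <= cut n (i%:R / m%:R : R) <= i * (n %/ m) + i)%N.
Proof.
move=> m0; have mR : 0 < m%:R :> R by rewrite ltr0n.
have x0 : 0 <= i%:R / m%:R * n%:R :> R by rewrite !mulr_ge0// invr_ge0.
have e : i%:R / m%:R * n%:R = (i * n)%:R / m%:R :> R by rewrite natrM mulrAC.
apply/andP; split.
  rewrite /cut Num.Theory.truncn_ge_nat// e ler_pdivlMr// -natrM ler_nat -mulnA leq_mul//.
  exact: leq_trunc_div.
rewrite -ltnS /cut Num.Theory.truncn_lt_nat// e ltr_pdivrMr// -natrM ltr_nat.
have := divn_eq n m; have := ltn_pmod n m0; set q := (n %/ m)%N; set r := (n %% m)%N.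
move=> h1 h2; rewrite {1}h2; nia.
Qed.

Lemma bounded_rank_step_cut m i : (0 < m)%N -> @bounded_rank R (fun n => step n (i * (n %/ m)) - step n (cut n (i%:R / m%:R : R))).
Proof.
move=> m0; exists (i + i)%N => n.
apply: leq_trans (rank_stepB _ _ _) _.
have /andP[] := cut_grid i n m0; lia.
Qed.

(** The symbol c 1_(i/m < x <= (i+1)/m) e^(i j theta). *)
Definition gridcell (m i : nat) (c : C) (j : int) : seq (@mono R) :=
  [:: (c, i.+1%:R / m%:R, j); (- c, i%:R / m%:R, j)].

Lemma lmat_gridcell m i c j n : lmat (gridcell m i c j) n =
  c *: ((step n (cut n (i.+1%:R / m%:R : R)) - step n (cut n (i%:R / m%:R : R))) *m shift n j).
Proof.
by rewrite /lmat big_cons big_seq1 /mmat /= mulmxBl scalerBr scaleNr.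
Qed.

(** Replace the block projector by the truncations at the grid points, and
    commute one of them with the shift. *)
Lemma bounded_rank_cell m i c j : (0 < m)%N ->
  bounded_rank (fun n => c *: (blockproj m i n *m shift n j *m blockproj m i n) - lmat (gridcell m i c j) n).
Proof.
move=> m0.
have hZ T : @bounded_rank R (fun n => step n (T n) *m shift n j - shift n j *m step n (T n)).
  by exists (`|j| + `|j|)%N => n; exact: rank_step_shift.
have hZQ : @bounded_rank R (fun n => shift n j *m blockproj m i n - blockproj m i n *m shift n j).
  apply: eq_bounded_rank (bounded_rankD (hZ (fun n => i * (n %/ m))%N) (bounded_rankZ (-1) (hZ (fun n => i.+1 * (n %/ m))%N))) => n.
  rewrite /blockproj mulmxBr mulmxBl scaleN1r !opprB.
  by rewrite addrACA [RHS]addrACA; congr (_ + _); rewrite addrC.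
have hQ : @bounded_rank R (fun n => blockproj m i n - (step n (cut n (i.+1%:R / m%:R : R)) - step n (cut n (i%:R / m%:R : R)))).
  apply: eq_bounded_rank (bounded_rankD (bounded_rank_step_cut i.+1 m0) (bounded_rankZ (-1) (bounded_rank_step_cut i m0))) => n.
  by rewrite /blockproj scaleN1r !opprB addrACA [RHS]addrACA; congr (_ + _); rewrite addrC.
have h := bounded_rankZ c (bounded_rankD (bounded_rankMl (blockproj m i) hZQ) (bounded_rankMr (fun n => shift n j) hQ)).
apply: eq_bounded_rank h => n; rewrite lmat_gridcell -scalerBr; congr (_ *: _).
rewrite mulmxBr !mulmxA (mulmxBl (blockproj m i n)).
have -> : blockproj m i n *m blockproj m i n = blockproj m i n :> 'M[C]_n.
  apply/matrixP => r s; rewrite blockproj_mul /blockproj !mxE.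
  case: (r == s) => /=; last by rewrite subrr mulr0.
  by rewrite itv_bool -natrM mulnb andbb.
by rewrite addrA subrK.
Qed.

(** The step-trigonometric symbol that takes on each cell of the grid the value
    of a at its right end, times the trigonometric polynomial s. *)
Definition gridlist (m : nat) (a : R -> C) (s : seq (C * int)) : seq (@mono R) :=
  flatten [seq gridcell m i (a (i.+1%:R / m%:R) * p.1) p.2 | i <- iota 0 m, p <- s].

Lemma lmat_flatten (ls : seq (seq (@mono R))) n : lmat (flatten ls) n = \sum_(l <- ls) lmat l n.
Proof.
elim: ls => [|l ls ih]; first by rewrite /= /lmat !big_nil.
by rewrite /= lmat_cat ih big_cons.
Qed.

Lemma bounded_rank_gridlist m a s : (0 < m)%N ->
  bounded_rank (fun n => LT_mx n m a (tsum s) - lmat (gridlist m a s) n).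
Proof.
move=> m0.
have := bounded_rank_sum (iota 0 m) (fun i => bounded_rank_sum s (fun p => bounded_rank_cell i (a (i.+1%:R / m%:R) * p.1) p.2 m0)).
apply: eq_bounded_rank => n; rewrite LT_mx_blocks// /gridlist lmat_flatten big_allpairs_dep /=.
rewrite -(big_mkord xpredT (fun i => a (i.+1%:R / m%:R) *: (blockproj m i n *m toeplitz n (tsum s) *m blockproj m i n))).
rewrite /index_iota subn0 -sumrB; apply: eq_bigr => i _.
rewrite sumrB; congr (_ - _).
rewrite toeplitz_tsum mulmx_sumr mulmx_suml scaler_sumr; apply: eq_bigr => p _.
by rewrite -scalemxAr -scalemxAl scalerA.
Qed.

Lemma opb_blockproj m i n : opb (blockproj m i n) 1.
Proof.
move=> x; rewrite mul1r; apply: l2norm_le; apply: ler_sum => r _.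
rewrite blockproj_mul Normc.normcM normc_bool.
case: (_ <= _ < _)%N; first by rewrite mul1r.
by rewrite mul0r expr0n sqr_ge0.
Qed.

Lemma small_sum (J : Type) (s : seq J) (F : J -> mxseq R) (e : J -> R) (e0 : R) : 0 < e0 ->
  (forall j, small (e j) (F j)) -> small (e0 + \sum_(j <- s) e j) (fun n => \sum_(j <- s) F j n).
Proof.
move=> e00 h; elim: s => [|j s ih].
  by rewrite big_nil addr0; apply: small_zero => // n; rewrite big_nil.
rewrite big_cons addrCA; apply: eq_small (smallD (h j) ih) => n.
by rewrite big_cons.
Qed.

(** The summands are increased by 1 so that they bound each coefficient and
    are at least 1, as [smallZ] requires. *)
Definition asum (m : nat) (a : R -> C) : R := \sum_(i <- iota 0 m) (normc (a (i.+1%:R / m%:R)) + 1).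

Lemma small_LT_mx m a (h : R -> C) e : (0 < m)%N -> 0 < e ->
  small e (fun n => toeplitz n h) -> small (e + asum m a * e) (fun n => LT_mx n m a h).
Proof.
move=> m0 e0 hs.
have hi (i : nat) : small ((normc (a (i.+1%:R / m%:R)) + 1) * e)
  (fun n => a (i.+1%:R / m%:R) *: (blockproj m i n *m toeplitz n h *m blockproj m i n)).
  apply: smallZ; rewrite ?lerDl ?lerDr ?normc_ge0 ?ltW//.
  have h1 := smallMl (lexx 1) (ltW e0) (@opb_blockproj m i) hs.
  rewrite mul1r in h1.
  by have := smallMr (lexx 1) (ltW e0) (@opb_blockproj m i) h1; rewrite mul1r.
rewrite /asum mulr_suml; apply: eq_small (small_sum (iota 0 m) e0 hi) => n.
by rewrite LT_mx_blocks// -(big_mkord xpredT (fun i => a (i.+1%:R / m%:R) *: (blockproj m i n *m toeplitz n h *m blockproj m i n))) /index_iota subn0.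
Qed.

Lemma LT_mxB n m a (h : R -> C) s : (0 < m)%N -> cintegrable_pi h ->
  LT_mx n m a h = LT_mx n m a (tsum s) + LT_mx n m a (fun t => h t - tsum s t).
Proof.
move=> m0 hh; rewrite !LT_mx_blocks// -big_split; apply: eq_bigr => i _ /=.
by rewrite -scalerDr -mulmxDl -mulmxDr -toeplitzB.
Qed.

End LTmat.

(** * Riemann integrable functions on fine grids *)

Section Riemann.
Context {R : realType}.
Local Notation C := R[i].

(** The cell contains a point where a exceeds its value at the right end by
    more than eta, as measured by the functional phi. *)
Definition badcell (phi : C -> R) (a : R -> C) (m : nat) (eta : R) (i : nat) : Prop :=
  exists x, [/\ i%:R / m%:R <= x, x <= i.+1%:R / m%:R & eta < phi (a x - a (i.+1%:R / m%:R))].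

(** Compare two Riemann sums on the uniform grid, tagged at the right ends and,
    in the bad cells, at the bad points. Both are close to the integral, but
    phi of their difference is at least eta / m per bad cell. The functional
    must be real linear, hence the real and imaginary parts, with both signs,
    instead of the absolute value. *)
Lemma few_badcells_phi (phi : C -> R) (a : R -> C) :
  (forall z w, phi (z + w) = phi z + phi w) -> (forall z (r : R), phi (z * (r%:C)%C) = phi z * r) ->
  (forall z, phi z <= normc z) ->
  riemann_integrable01 a -> forall (eta e : R), 0 < eta -> 0 < e ->
  exists m0, forall m, (m0 <= m)%N -> (0 < m)%N ->
    (#|[pred i : 'I_m | `[< badcell phi a m eta i >]]|)%:R <= e * m%:R.
Proof.
move=> phiD phiZ phile [L hL] eta e eta0 e0.
have phi0 : phi 0 = 0 by have := phiZ 0 0; rewrite mul0r mulr0.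
pose e1 := eta * e / 2.
have e10 : 0 < e1 by rewrite !mulr_gt0// invr_gt0.
have [d d0 hd] := hL _ e10.
have [m0 hm0] := natr_large 2 d0.
exists m0 => m mm0 mp; have mR : 0 < m%:R :> R by rewrite ltr0n.
pose S := [pred i : 'I_m | `[< badcell phi a m eta i >]].
pose x (j : nat) : R := j%:R / m%:R.
pose t (j : nat) : R := j.+1%:R / m%:R.
have xt j : x j.+1 - x j = m%:R^-1 by rewrite /x -mulrBl -natr1 addrC addKr mul1r.
have md : m%:R^-1 < d.
  rewrite -[m%:R^-1]mul1r ltr_pdivrMr//; have := hm0 _ mm0; lra.
have ltx j : x j <= t j by rewrite /x /t ler_pM2r ?invr_gt0// ler_nat.
(* the second tagging: a bad point where there is one, else the right end *)
pose tg (j : nat) : R := if pselect (badcell phi a m eta j) is left h then projT1 (cid h) else t j.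
have tgP j : [/\ x j <= tg j, tg j <= x j.+1 & 0 <= phi (a (tg j) - a (t j))] /\
   (badcell phi a m eta j -> eta < phi (a (tg j) - a (t j))).
  rewrite /tg; case: pselect => [h|h]; last by split => //; split => //; rewrite subrr phi0.
  case: cid => y /= [y1 y2 y3]; split => //; split => //.
  exact: ltW (lt_trans eta0 y3).
have x0 : x 0%N = 0 by rewrite /x mul0r.
have xm : x m = 1 by rewrite /x divff ?gt_eqF.
have h1 : normc (\sum_(j < m) a (tg j) * ((x j.+1 - x j)%:C)%C - L) < e1.
  by apply: hd => // j _; rewrite xt; have [[]] := tgP j.
have h2 : normc (\sum_(j < m) a (t j) * ((x j.+1 - x j)%:C)%C - L) < e1.
  by apply: hd => // j _; rewrite xt; split.
have h3 : phi (\sum_(j < m) a (tg j) * ((x j.+1 - x j)%:C)%C -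
   \sum_(j < m) a (t j) * ((x j.+1 - x j)%:C)%C) < eta * e.
  apply: le_lt_trans (phile _) _.
  rewrite (_ : _ - _ = (\sum_(j < m) a (tg j) * ((x j.+1 - x j)%:C)%C - L) -
    (\sum_(j < m) a (t j) * ((x j.+1 - x j)%:C)%C - L)); last by rewrite opprB addrA subrK.
  apply: le_lt_trans (le_normcD _ _) _; rewrite normcN.
  by move: h1 h2; rewrite /e1; lra.
have phi_sum (F : nat -> C) k : phi (\sum_(j < k) F j) = \sum_(j < k) phi (F j).
  elim: k => [|k ih]; first by rewrite !big_ord0.
  by rewrite !big_ord_recr /= phiD ih.
have h4 : \sum_(j < m) phi (a (tg j) - a (t j)) / m%:R < eta * e.
  move: h3; rewrite -sumrB (phi_sum (fun j => a (tg j) * ((x j.+1 - x j)%:C)%C - a (t j) * ((x j.+1 - x j)%:C)%C)); congr (_ < _); apply: eq_bigr => j _.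
  by rewrite -mulrBl phiZ xt.
have h5 : eta * (#|S|)%:R <= \sum_(j < m) phi (a (tg j) - a (t j)).
  rewrite -sum1_card natr_sum mulr_sumr big_mkcond ler_sum// => j _.
  rewrite mulr1; case: ifP => [|_]; last by have [[]] := tgP j.
  by rewrite unfold_in /= => /asboolP /(tgP j).2 /ltW.
rewrite -(ler_pM2l eta0) (le_trans h5)// mulrA -ler_pdivrMr// mulr_suml.
exact: ltW.
Qed.

Definition bad := badcell (@Normc.normc R).

Lemma few_badcells (a : R -> C) : riemann_integrable01 a ->
  forall (eta e : R), 0 < eta -> 0 < e ->
  exists m0, forall m, (m0 <= m)%N -> (0 < m)%N ->
    (#|[pred i : 'I_m | `[< bad a m eta i >]]|)%:R <= e * m%:R.
Proof.
move=> ha eta e eta0 e0; have eta2 : 0 < eta / 2 by rewrite divr_gt0.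
have e4 : 0 < e / 4 by rewrite divr_gt0.
pose phi1 (z : C) := Re z. pose phi2 (z : C) := - Re z.
pose phi3 (z : C) := Im z. pose phi4 (z : C) := - Im z.
have [||| m1 h1] := @few_badcells_phi phi1 a _ _ _ ha _ _ eta2 e4.
- by move=> [x y] [x' y'].
- by move=> [x y] r; rewrite /phi1 /= mulr0 subr0.
- exact: re_le_normc.
have [||| m2 h2] := @few_badcells_phi phi2 a _ _ _ ha _ _ eta2 e4.
- by move=> [x y] [x' y']; rewrite /phi2 /= opprD.
- by move=> [x y] r; rewrite /phi2 /= mulr0 subr0 mulNr.
- by move=> z; rewrite -normcN -[phi2 z]/(- Re z) -raddfN; exact: re_le_normc.
have [||| m3 h3] := @few_badcells_phi phi3 a _ _ _ ha _ _ eta2 e4.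
- by move=> [x y] [x' y'].
- by move=> [x y] r; rewrite /phi3 /= mulr0 add0r.
- exact: im_le_normc.
have [||| m4 h4] := @few_badcells_phi phi4 a _ _ _ ha _ _ eta2 e4.
- by move=> [x y] [x' y']; rewrite /phi4 /= opprD.
- by move=> [x y] r; rewrite /phi4 /= mulr0 add0r mulNr.
- by move=> z; rewrite -normcN -[phi4 z]/(- Im z) -raddfN; exact: im_le_normc.
exists (maxn (maxn m1 m2) (maxn m3 m4)) => m; rewrite !geq_max => /andP[/andP[k1 k2] /andP[k3 k4]] m0.
have {}h1 := h1 m k1 m0; have {}h2 := h2 m k2 m0.
have {}h3 := h3 m k3 m0; have {}h4 := h4 m k4 m0.
have : (#|[pred i : 'I_m | `[< bad a m eta i >]]| <=
  (#|[pred i : 'I_m | `[< badcell phi1 a m (eta / 2) i >]]| + #|[pred i : 'I_m | `[< badcell phi2 a m (eta / 2) i >]]|) +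
  (#|[pred i : 'I_m | `[< badcell phi3 a m (eta / 2) i >]]| + #|[pred i : 'I_m | `[< badcell phi4 a m (eta / 2) i >]]|))%N.
  have cU (A B : {pred 'I_m}) : (#|[predU A & B]| <= #|A| + #|B|)%N.
    by rewrite -cardUI leq_addr.
  apply: leq_trans (leq_add (cU _ _) (cU _ _)); apply: leq_trans (cU _ _).
  apply: subset_leq_card; apply/fintype.subsetP => i hi.
  have /asboolP [x [x1 x2 x3]] : `[< bad a m eta i >] by exact: hi.
  rewrite !inE.
  have hh := lt_le_trans x3 (normc_le_ReIm _).
  set z := a x - _ in hh.
  have [hr|hr] := ltP (eta / 2) `|Re z|.
    move: hr; case: (ger0P (Re z)) => _ hr.
      by apply/orP; left; apply/orP; left; apply/asboolP; exists x.
    by apply/orP; left; apply/orP; right; apply/asboolP; exists x.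
  have hm : eta / 2 < `|Im z| by lra.
  move: hm; case: (ger0P (Im z)) => _ hm.
    by apply/orP; right; apply/orP; left; apply/asboolP; exists x.
  by apply/orP; right; apply/orP; right; apply/asboolP; exists x.
rewrite -(@ler_nat R) !natrD => h5; apply: le_trans h5 _; lra.
Qed.

End Riemann.

(** * Outer measure in the plane *)

Section Outer.
Context {R : realType}.
Local Notation C := R[i].
Local Notation mu := (@lebesgue_measure R).
Local Notation T2 := (measurableTypeR R * measurableTypeR R)%type.
Local Notation mu2 := (mu \x mu)%E.
Local Notation om := (@completed_lebesgue_measure2 R).
Local Notation cm := (@completed_lebesgue_measure R).

Local Notation U01 := (`[0%R, 1%R]%classic : set R).
Local Notation Ipi := (`[(- pi)%R, pi%R]%classic : set R).

Lemma om_le (A B : set (R * R)) : A `<=` B -> (om A <= om B)%E.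
Proof. exact: (@le_outer_measure _ _ (mu2^*)%mu). Qed.

Lemma om_ge0 (A : set (R * R)) : (0 <= om A)%E.
Proof. exact: (@outer_measure_ge0 _ _ (mu2^*)%mu). Qed.

Lemma om_U (A B : set (R * R)) : (om (A `|` B) <= om A + om B)%E.
Proof. exact: (@outer_measureU2 _ _ (mu2^*)%mu). Qed.

Lemma om_U_le (A B E : set (R * R)) (a b : R) : E `<=` A `|` B ->
  (om A <= a%:E)%E -> (om B <= b%:E)%E -> (om E <= (a + b)%:E)%E.
Proof.
move=> h ha hb; apply: le_trans (om_le h) _; apply: le_trans (om_U _ _) _.
by rewrite EFinD leeD.
Qed.

Lemma om0 : om set0 = 0%E.
Proof. exact: (@outer_measure0 _ _ (mu2^*)%mu). Qed.

Lemma om_rect (A B : set (measurableTypeR R)) : measurable A -> measurable B ->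
  om (A `*` B) = (mu A * mu B)%E.
Proof.
by move=> mA mB; rewrite outer2E ?product_measure1E//; exact: measurableX.
Qed.

(** A cover of E by intervals of almost the same total length, multiplied by
    [0, 1]. *)
Lemma om_strip (E : set R) (e : R) : (cm E <= e%:E)%E ->
  (om (U01 `*` E) <= e%:E)%E.
Proof.
move=> hE; apply/lee_addgt0Pr => d d0.
have fE : (cm E) \is a fin_num.
  rewrite ge0_fin_numE; first exact: le_lt_trans hE (ltry _).
  exact: (@outer_measure_ge0 _ _ ((wlength idfun)^*)%mu).
have /lb_ereal_inf_adherent := fE; move=> /(_ d d0) [_ /= [A [mA EA] <-] hA].
pose F : set (measurableTypeR R) := \bigcup_i A i.
have mF : measurable F.
  by apply: bigcupT_measurable => i; apply: sub_sigma_algebra; exact: mA.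
have muF : (mu F <= (e + d)%:E)%E.
  apply: (@le_trans _ _ (cm E + d%:E)%E); last by rewrite EFinD leeD2r.
  apply: le_trans (ltW hA).
  apply: (le_trans (outer_measure_sigma_subadditive (wlength idfun)^*%mu A)).
  apply: lee_nneseries => // n _.
  by rewrite -((measurable_mu_extE (wlength idfun)) (A n)).
apply: (@le_trans _ _ (om (U01 `*` F))).
  by apply: om_le => z [z1 z2]; split => //; exact: EA.
rewrite om_rect; [|exact: measurable_itv|exact: mF].
have -> : mu U01 = 1%E.
  by rewrite lebesgue_measure_itv /= lte_fin ltr01 oppr0 adde0.
by rewrite mul1e -EFinD.
Qed.

Lemma om_cells (m : nat) (P : nat -> bool) : (0 < m)%N ->
  (om (\big[setU/set0]_(i < m | P i)
    ((`](i%:R / m%:R)%R, (i.+1%:R / m%:R)%R]%classic : set R) `*` Ipi)) <=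
  ((#|[pred i : 'I_m | P i]|)%:R / m%:R * (2 * pi))%R%:E)%E.
Proof.
move=> m0; have mR : 0 < m%:R :> R by rewrite ltr0n.
have -> : (#|[pred i : 'I_m | P i]|)%:R / m%:R * (2 * pi) = \sum_(i < m | P i) (m%:R^-1 * (2 * pi)) :> R.
  rewrite (eq_bigl (mem [pred i : 'I_m | P i])) => [|i]; last by rewrite inE.
  by rewrite sumr_const -[RHS]mulr_natl mulrA.
rewrite -sumEFin.
elim/big_ind2: _ => [|A a B b hA hB|i _].
- by rewrite om0.
- by apply: le_trans (om_U _ _) _; exact: leeD.
- rewrite om_rect; [|exact: measurable_itv|exact: measurable_itv].
  have -> : mu `](i%:R / m%:R)%R, (i.+1%:R / m%:R)%R]%classic = (m%:R^-1)%:E.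
    rewrite lebesgue_measure_itv /= lte_fin ltr_pM2r ?invr_gt0// ltr_nat ltnSn.
    by rewrite -EFinB -mulrBl -natr1 addrAC subrr add0r mul1r.
  by rewrite mu_I -EFinM.
Qed.

Lemma om_zero_line : om (([set 0%R] : set R) `*` Ipi) = 0%E.
Proof.
rewrite om_rect; [|exact: measurable_set1|exact: measurable_itv].
by rewrite lebesgue_measure_set1 mul0e.
Qed.

End Outer.

Section Markov.
Context {R : realType} disp (T : measurableType disp) (mu : {measure set T -> \bar R}).
Variables (I : set T) (mI : measurable I).

Lemma markov_L1 (u : T -> R) (H c : R) : measurable_fun I u -> 0 < H ->
  (\int[mu]_(x in I) (`|u x|)%:E <= c%:E)%E ->
  (mu (I `&` [set x | (H < `|u x|)%R]) <= (c / H)%R%:E)%E.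
Proof.
move=> mu' H0 hc; pose E := I `&` [set x | H < `|u x|].
have mE : measurable E.
  have mabs : measurable_fun I (fun x => `|u x|) by exact: measurableT_comp.
  have := mabs mI `]H, +oo[%classic (measurable_itv _).
  congr (measurable _); apply/seteqP; split => x [Ix /=]; rewrite in_itv /= andbT; by split.
have h : (H%:E * mu E <= c%:E)%E.
  apply: le_trans hc; rewrite -integral_cst//.
  apply: (@le_trans _ _ (\int[mu]_(x in E) (`|u x|)%:E)%E).
    apply: ge0_le_integral => //.
    - by move=> x _; rewrite lee_fin ltW.
    - apply/measurable_EFinP; apply: measurableT_comp => //.
      by apply: measurable_funS mu' => // x [].
    - by move=> x [_ /ltW]; rewrite lee_fin.
  apply: ge0_subset_integral => //.
  - by apply/measurable_EFinP; exact: measurableT_comp.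
  - by move=> x [].
have fE : mu E \is a fin_num.
  rewrite ge0_fin_numE// ltey; apply/negP => /eqP E'.
  by move: h; rewrite E' gt0_muley ?lte_fin// leye_eq.
move: h; rewrite -(fineK fE) -EFinM !lee_fin => h.
by rewrite ler_pdivlMr// mulrC.
Qed.

End Markov.

(** * Locally Toeplitz sequences *)

Section LTapprox.
Context {R : realType}.
Local Notation C := R[i].
Local Notation om := (@completed_lebesgue_measure2 R).
Local Notation cm := (@completed_lebesgue_measure R).
Local Notation I := (@circ R).
Local Notation U01 := (`[0%R, 1%R]%classic : set R).
Local Notation Ipi := (`[(- pi)%R, pi%R]%classic : set R).

Definition badset (f g : R * R -> C) (e : R) : set (R * R) :=
  (U01 `*` Ipi) `&` [set z | (e < normc (f z - g z))%R].

(** f and g are d-close outside a subset of D of outer measure at most e. For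
    e = 0 this says that they are d-close almost everywhere. *)
Definition far (f g : R * R -> C) (d e : R) := (om (badset f g d) <= e%:E)%E.

Lemma far_sub f g (d e : R) (E : set (R * R)) : (om E <= e%:E)%E ->
  (forall z, (U01 `*` Ipi) z -> ~ E z -> normc (f z - g z) <= d) -> far f g d e.
Proof.
move=> hE h; apply: le_trans hE; apply: om_le => z [Dz /= hz].
by apply: contrapT => /(h z Dz); rewrite leNgt hz.
Qed.

Lemma far_imp2 f g f1 g1 f2 g2 (d d1 d2 e1 e2 : R) :
  far f1 g1 d1 e1 -> far f2 g2 d2 e2 ->
  (forall z, normc (f1 z - g1 z) <= d1 -> normc (f2 z - g2 z) <= d2 ->
     normc (f z - g z) <= d) -> far f g d (e1 + e2).
Proof.
move=> h1 h2 h; apply: far_sub (om_U_le (@subset_refl _ _) h1 h2) _ => z Dz nE.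
by apply: h; rewrite leNgt; apply/negP => hz; apply: nE; [left|right].
Qed.

Lemma far_imp f g f1 g1 (d d1 e : R) : far f1 g1 d1 e ->
  (forall z, normc (f1 z - g1 z) <= d1 -> normc (f z - g z) <= d) -> far f g d e.
Proof.
move=> h1 h; apply: far_sub h1 _ => z Dz nE.
by apply: h; rewrite leNgt; apply/negP => hz; apply: nE.
Qed.

Lemma far_le f g d d' e e' : d <= d' -> e <= e' -> far f g d e -> far f g d' e'.
Proof.
move=> dd ee h; apply: (@le_trans _ _ e%:E); last by rewrite lee_fin.
by apply: far_imp h _ => z /le_trans; exact.
Qed.

Lemma far_pw f g d e : 0 <= e -> (forall z, normc (f z - g z) <= d) -> far f g d e.
Proof. by move=> e0 h; apply: (@far_sub _ _ _ _ set0) => //; rewrite om0 lee_fin. Qed.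

Lemma far_refl f d e : 0 <= d -> 0 <= e -> far f f d e.
Proof. by move=> d0 e0; apply: far_pw => // z; rewrite subrr Normc.normc0. Qed.

Lemma farC f g d e : far f g d e -> far g f d e.
Proof. by move=> h; apply: far_imp h _ => z; rewrite -normcN opprB. Qed.

Lemma farD f g f1 g1 (d d' e e' : R) : far f f1 d e -> far g g1 d' e' ->
  far (fun z => f z + g z) (fun z => f1 z + g1 z) (d + d') (e + e').
Proof.
move=> h1 h2; apply: far_imp2 h1 h2 _ => z k k'.
by rewrite opprD addrACA (le_trans (le_normcD _ _))// lerD.
Qed.

Lemma far_trans f g h d d' e e' : far f g d e -> far g h d' e' -> far f h (d + d') (e + e').
Proof.
move=> h1 h2; apply: far_imp (farD h1 h2) _ => z.
by rewrite [f z + _]addrC opprD addrACA subrr add0r.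
Qed.

Lemma farZ (c : C) f g d e : far f g d e ->
  far (fun z => c * f z) (fun z => c * g z) (normc c * d) e.
Proof.
by move=> h; apply: far_imp h _ => z k; rewrite -mulrBr Normc.normcM ler_wpM2l ?normc_ge0.
Qed.

Lemma far_conj f g d e : far f g d e -> far (fun z => (f z)^*) (fun z => (g z)^*) d e.
Proof. by move=> h; apply: far_imp h _ => z k; rewrite -rmorphB normc_conj. Qed.

(** f g - f1 g1 = f (g - g1) + (f - f1) g1. *)
Lemma farM f g f1 g1 (c c' d d' e e' k k' : R) :
  far f f1 d e -> far g g1 d' e' -> far f (fun=> 0) c k -> far g1 (fun=> 0) c' k' ->
  far (fun z => f z * g z) (fun z => f1 z * g1 z) (c * d' + d * c') (k + e' + (e + k')).
Proof.
move=> h1 h2 h3 h4.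
have mul0 u v p q a b : far u (fun=> 0) p a -> far v (fun=> 0) q b ->
    far (fun z => u z * v z) (fun=> 0) (p * q) (a + b).
  move=> hu hv; apply: far_imp2 hu hv _ => z; rewrite !subr0 => x y.
  by rewrite Normc.normcM ler_pM// normc_ge0.
have sub0 u v p a : far u v p a -> far (fun z => u z - v z) (fun=> 0) p a.
  by move=> hu; apply: far_imp hu _ => z; rewrite subr0.
apply: far_imp (farD (mul0 _ _ _ _ _ _ h3 (sub0 _ _ _ _ h2))
  (mul0 _ _ _ _ _ _ (sub0 _ _ _ _ h1) h4)) _ => z; rewrite addr0 subr0.
by congr (normc _ <= _); ring.
Qed.

(** A has the symbol f. *)
Definition approx (A : mxseq R) (f : R * R -> C) := forall e : R, 0 < e ->
  exists2 l, far f (pval l) e e & small e (fun n => A n - lmat l n).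

(** The step function equal on each cell to the value of a at the right end. *)
Definition stepf (m : nat) (a : R -> C) (x : R) : C :=
  \sum_(i <- iota 0 m) a (i.+1%:R / m%:R) *
    (((x <= i.+1%:R / m%:R)%R)%:R - ((x <= i%:R / m%:R)%R)%:R).

Lemma pval_gridlist m a s z : pval (gridlist m a s) z = stepf m a z.1 * tsum s z.2.
Proof.
have pf (ls : seq (seq (@mono R))) : pval (flatten ls) z = \sum_(l <- ls) pval l z.
  elim: ls => [|l ls ih]; first by rewrite /pval !big_nil.
  by rewrite /= pval_cat ih big_cons.
rewrite /gridlist pf big_allpairs_dep /stepf mulr_suml; apply: eq_bigr => i _.
rewrite /tsum mulr_sumr; apply: eq_bigr => p _.
by rewrite /pval /gridcell big_cons big_seq1 /mval /=; ring.
Qed.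

Lemma stepf_cell m a i x : (0 < m)%N -> (i < m)%N -> i%:R / m%:R < x -> x <= i.+1%:R / m%:R ->
  stepf m a x = a (i.+1%:R / m%:R).
Proof.
move=> m0 im x1 x2; have mR : 0 < m%:R :> R by rewrite ltr0n.
rewrite /stepf (bigD1_seq i)/= ?mem_iota ?iota_uniq//= x2 leNgt x1 /= subr0 mulr1.
rewrite big1_seq ?addr0// => j /andP[ji _].
suff -> : (x <= j.+1%:R / m%:R) = (x <= j%:R / m%:R) by rewrite subrr mulr0.
have lem (p q : nat) : (p <= q)%N -> p%:R / m%:R <= q%:R / m%:R :> R.
  by move=> pq; rewrite ler_pM2r ?invr_gt0// ler_nat.
have [jlt|jgt|e] := ltngtP j i; last by rewrite e eqxx in ji.
  have h1 := le_lt_trans (lem _ _ jlt) x1; have h2 := le_lt_trans (lem _ _ (ltnW jlt)) x1.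
  by rewrite (leNgt x) h1 (leNgt x) h2.
by rewrite (le_trans x2 (lem _ _ jgt)) (le_trans x2 (lem i.+1 j.+1 (ltnW jgt))).
Qed.

Lemma stepf_le m a x : normc (stepf m a x) <= asum m a.
Proof.
rewrite (le_trans (normc_sum _ _ _))// ler_sum// => i _.
rewrite Normc.normcM -[leRHS]mulr1 ler_pM ?normc_ge0 ?lerDl//.
case: (x <= i.+1%:R / m%:R); case: (x <= i%:R / m%:R);
  by rewrite ?subrr ?subr0 ?sub0r ?normcN ?Normc.normc0 ?Normc.normc1.
Qed.

Lemma asum_ge0 m (a : R -> C) : 0 <= asum m a.
Proof. by rewrite sumr_ge0// => i _; rewrite addr_ge0// normc_ge0. Qed.

Lemma cell_ex m (x : R) : (0 < m)%N -> 0 < x -> x <= 1 ->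
  exists i, [/\ (i < m)%N, i%:R / m%:R < x & x <= i.+1%:R / m%:R].
Proof.
move=> m0 x0 x1; have mR : 0 < m%:R :> R by rewrite ltr0n.
have ex : exists i, x <= i.+1%:R / m%:R.
  by exists m.-1; rewrite prednK// divff// gt_eqF.
case: (ex_minnP ex) => i xi imin; exists i; split=> //.
  by have := imin m.-1; rewrite prednK// divff ?gt_eqF// => /(_ x1); lia.
case: i xi imin => [|i] xi imin; first by rewrite mul0r.
by rewrite ltNge; apply/negP => /imin; rewrite ltnn.
Qed.

(** Off the bad cells and the line x = 0, the step function is eta-close to a. *)
Lemma stepf_cvg (a : R -> C) : riemann_integrable01 a -> forall (eta e : R), 0 < eta -> 0 < e ->
  exists m0, forall m, (m0 <= m)%N -> (0 < m)%N ->
    exists S : set (R * R), (om S <= e%:E)%E /\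
      forall z, (U01 `*` Ipi) z -> ~ S z -> normc (a z.1 - stepf m a z.1) <= eta.
Proof.
move=> ha eta e eta0 e0; have pip := @pi_gt0 R.
have e1 : 0 < e / (2 * pi) by rewrite divr_gt0// mulr_gt0.
have [m0 hm0] := few_badcells ha eta0 e1.
exists m0 => m mm0 mp; have mR : 0 < m%:R :> R by rewrite ltr0n.
have hb := hm0 m mm0 mp.
pose P (i : nat) := `[< bad a m eta i >].
pose S1 : set (R * R) := ([set 0%R] : set R) `*` Ipi.
pose S2 : set (R * R) := \big[setU/set0]_(i < m | P i)
    ((`](i%:R / m%:R)%R, (i.+1%:R / m%:R)%R]%classic : set R) `*` Ipi).
exists (S1 `|` S2); split.
  rewrite -[e]add0r; apply: (@om_U_le _ S1 S2) => //.
    by rewrite /S1 om_zero_line.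
  apply: le_trans (om_cells _ mp) _; rewrite lee_fin -ler_pdivlMr ?mulr_gt0//.
  by rewrite ler_pdivrMr.
move=> z [/= z1 z2] nS; move: z1; rewrite in_itv /= => /andP[z10 z11].
have zpos : 0 < z.1.
  by rewrite lt_neqAle z10 andbT; apply/eqP => z0; apply: nS; left; split => //=; rewrite -z0.
have [i [im i1 i2]] := cell_ex mp zpos z11.
rewrite (stepf_cell a mp im i1 i2) leNgt; apply/negP => hbad.
have Pi : P i by apply/asboolP; exists z.1; split => //; exact: ltW.
apply: nS; right; rewrite /S2 (bigD1 (Ordinal im))//; left.
by split => //=; rewrite in_itv /= i1 i2.
Qed.

Lemma cm_le (A B : set R) : A `<=` B -> (cm A <= cm B)%E.
Proof. exact: (@le_outer_measure _ _ ((wlength idfun)^*)%mu). Qed.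

Lemma cm_U (A B : set R) : (cm (A `|` B) <= cm A + cm B)%E.
Proof. exact: (@outer_measureU2 _ _ ((wlength idfun)^*)%mu). Qed.

Lemma cm_normc_gt (h : R -> C) (c H : R) : cintegrable_pi h -> 0 < H ->
  (\int[cm]_(t in I) (`|Re (h t)|)%:E <= c%:E)%E ->
  (\int[cm]_(t in I) (`|Im (h t)|)%:E <= c%:E)%E ->
  (cm (I `&` [set t | (H < normc (h t))%R]) <= (4 * c / H)%R%:E)%E.
Proof.
move=> [i1 i2] H0 h1 h2; have H2 : 0 < H / 2 by rewrite divr_gt0.
have m1 : measurable_fun I (fun t => Re (h t)).
  by apply/measurable_EFinP; exact: measurable_int i1.
have m2 : measurable_fun I (fun t => Im (h t)).
  by apply/measurable_EFinP; exact: measurable_int i2.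
have k1 := markov_L1 measurable_circ m1 H2 h1.
have k2 := markov_L1 measurable_circ m2 H2 h2.
have -> : (4 * c / H)%:E = ((c / (H / 2))%:E + (c / (H / 2))%:E)%E.
  by rewrite -EFinD; congr (_%:E); field; rewrite gt_eqF.
apply: le_trans (leeD k1 k2); apply: le_trans (cm_U _ _); apply: cm_le => t [It /= ht].
have [hr|hr] := ltP (H / 2) `|Re (h t)|; first by left.
right; split => //=; have := normc_le_ReIm (h t).
by clear -ht hr => hn; lra.
Qed.

Lemma fin_L1 (u : R -> R) : cm.-integrable I (fun t => (u t)%:E) ->
  exists2 c : R, 0 <= c & (\int[cm]_(t in I) (`|u t|)%:E <= c%:E)%E.
Proof.
move=> /integrableP[mu hu].
have f : (\int[cm]_(t in I) (`|u t|)%:E)%E \is a fin_num.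
  rewrite ge0_fin_numE; first exact: hu.
  by apply: integral_ge0 => t _; rewrite lee_fin.
exists (fine (\int[cm]_(t in I) (`|u t|)%:E)%E).
  by apply: fine_ge0; apply: integral_ge0 => t _; rewrite lee_fin.
by rewrite fineK.
Qed.

Lemma far_strip (u v : R -> C) (d e : R) :
  (cm (I `&` [set t | (d < normc (u t - v t))%R]) <= e%:E)%E ->
  far (fun z => u z.2) (fun z => v z.2) d e.
Proof. by move=> /om_strip; apply: le_trans; apply: om_le => z [[z1 z2] hz]. Qed.

(** Three sources of error, controlled in this order: a bound H for h off a small
    set; a grid so fine that a is close, relatively to H, to its step function
    and that the a.c.s. error is small; a trigonometric polynomial so close to
    h that the values of a on this grid do no harm. *)
Lemma is_LT_approx (A : mxseq R) a h : is_LT A a h -> approx A (fun z => a z.1 * h z.2).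
Proof.
move=> [ha hh [nm [c [w [hc hw hacs]]]]] e e0.
have e4 : 0 < e / 4 by rewrite divr_gt0.
(* Markov: |h| <= H off a set of measure e / 4. *)
have [c1 c10 hc1] := fin_L1 hh.1; have [c2 c20 hc2] := fin_L1 hh.2.
pose cc := c1 + c2; have cc0 : 0 <= cc by rewrite addr_ge0.
pose H := 16 * cc / e + 1.
have H0 : 0 < H by rewrite /H ltr_wpDl// divr_ge0 ?mulr_ge0// ltW.
have hH : (cm (I `&` [set t | (H < normc (h t))%R]) <= (e / 4)%R%:E)%E.
  apply: le_trans (cm_normc_gt (c := cc) hh H0 _ _) _.
  - by apply: le_trans hc1 _; rewrite lee_fin lerDl.
  - by apply: le_trans hc2 _; rewrite lee_fin lerDr.
  - rewrite lee_fin ler_pdivrMr//.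
    have -> : e / 4 * H = 4 * cc + e / 4 by rewrite /H; field; rewrite gt_eqF.
    by rewrite lerDl ltW.
have eta0 : 0 < e / (2 * H) by rewrite divr_gt0// mulr_gt0.
have [m1 hm1] := stepf_cvg ha eta0 e4.
have [N1 _ hN1] := cvgr_lt (0 : R) hc (e / 4) e4.
have [N2 _ hN2] := cvgr_lt (0 : R) hw (e / 4) e4.
have [m [mp lem1 leN1 leN2]] : exists m, [/\ 0 < m, m1 <= m, N1 <= m & N2 <= m]%N.
  by exists (m1 + N1 + N2).+1; clear; split; lia.
have cm' : c m < e / 4 by exact: hN1.
have wm' : w m < e / 4 by exact: hN2.
have [S [omS hS]] := hm1 m lem1 mp.
have hLT := hacs m mp.
have as0 := asum_ge0 m a.
pose d := e / (16 * (1 + asum m a)).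
have d0 : 0 < d by rewrite divr_gt0// mulr_gt0// ltr_wpDr.
pose rho := e / (2 * (1 + asum m a)).
have rho0 : 0 < rho by rewrite divr_gt0// mulr_gt0// ltr_wpDr.
(* d^2 makes the Toeplitz part small, e rho / 16 bounds h minus its
   approximant by rho off a set of measure e / 4, by Markov. *)
pose D := Num.min (d ^+ 2) (e * rho / 16).
have D0 : 0 < D by rewrite lt_min exprn_gt0// divr_gt0// mulr_gt0.
have [s [hs1 hs2]] := ctrig_dense D0 hh.
have hB := cintegrableB s hh.
have Dd : (D%:E <= (d ^+ 2)%:E)%E by rewrite lee_fin ge_min lexx.
have hT := toeplitz_small d0 hB (le_trans hs1 Dd) (le_trans hs2 Dd).
have hrho : (cm (I `&` [set t | (rho < normc (h t - tsum s t))%R]) <= (e / 4)%R%:E)%E.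
  apply: le_trans (cm_normc_gt hB rho0 hs1 hs2) _.
  rewrite lee_fin ler_pdivrMr//.
  have -> : e / 4 * rho = 4 * (e * rho / 16) by field.
  by rewrite ler_pM2l// ge_min lexx orbT.
exists (gridlist m a s).
  have f1 : far (fun z => h z.2) (fun=> 0) H (e / 4).
    by apply: (@far_strip h (fun=> 0)); under eq_fun do rewrite subr0.
  have f2 : far (fun z => a z.1) (fun z => stepf m a z.1) (e / (2 * H)) (e / 4).
    exact: far_sub omS hS.
  have f3 : far (fun z => stepf m a z.1) (fun=> 0) (asum m a) 0.
    by apply: far_pw => // z; rewrite subr0; exact: stepf_le.
  have f4 := farM (far_strip hrho) f2 f1 f3.
  have d1 : H * (e / (2 * H)) + rho * asum m a <= e.
    have -> : H * (e / (2 * H)) = e / 2 by field; rewrite gt_eqF.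
    have rE : rho * (1 + asum m a) = e / 2.
      by rewrite /rho; move: (asum m a) as0 => q q0; field; rewrite gt_eqF// ltr_wpDr.
    by move: rE; rewrite mulrDr mulr1 => rE; clear -rho0 rE; lra.
  have d2 : e / 4 + e / 4 + (e / 4 + 0) <= e by clear -e0; lra.
  apply: far_imp (far_le d1 d2 f4) _ => z.
  by rewrite pval_gridlist [a _ * _]mulrC [stepf _ _ _ * _]mulrC.
have t1 : small (e / 4) (fun n => A n - LT_mx n m a h).
  exists (nm m) => n hn; have [Rn [Nn [hA hr hN]]] := hLT n hn.
  exists Rn, Nn; split.
  - by apply/eqP; rewrite subr_eq hA -addrA addrC.
  - by rewrite (le_trans hr)// ler_wpM2r// ltW.
  - have e40 := ltW e4.
    by apply/(spectral_normP _ e40); rewrite (le_trans hN)// ltW.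
have t2 := small_LT_mx a mp (mulr_gt0 (ltr0n R 4) d0) hT.
have [K hK] := bounded_rank_gridlist a s mp.
have t3 := small_rank hK e4.
have t := smallD (smallD t1 t2) t3.
have se : e / 4 + (4 * d + asum m a * (4 * d)) + e / 4 <= e.
  have -> : 4 * d + asum m a * (4 * d) = 4 * (d * (1 + asum m a)) by ring.
  have -> : d * (1 + asum m a) = e / 16.
    by rewrite /d; move: (asum m a) as0 => q q0; field; rewrite gt_eqF// ltr_wpDr.
  by clear -e0; lra.
apply: small_le se _.
apply: eq_small t => n.
rewrite (LT_mxB n a s mp hh).
by rewrite opprD !addrA subrK subrK.
Qed.

End LTapprox.

(** * The algebra of sequences with a symbol *)

Section Symbols.
Context {R : realType}.
Local Notation C := R[i].
Local Notation om := (@completed_lebesgue_measure2 R).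
Local Notation D := (`[0%R, 1%R]%classic `*` `[(- pi)%R, pi%R]%classic : set (R * R)).
Implicit Types A B : mxseq R.
Implicit Types f g : R * R -> C.

Lemma approx0 : approx (fun n => 0 : 'M[C]_n) (fun=> 0).
Proof.
move=> e e0; exists [::].
  by apply: far_pw => [|z]; [exact: ltW | rewrite /pval big_nil subrr Normc.normc0 ltW].
by apply: small_zero => // n; rewrite /lmat big_nil subr0.
Qed.

Lemma approxD A B f g : approx A f -> approx B g ->
  approx (fun n => A n + B n) (fun z => f z + g z).
Proof.
move=> hA hB e e0; have e2 : 0 < e / 2 by rewrite divr_gt0.
have [l h1 h2] := hA _ e2; have [l' h1' h2'] := hB _ e2.
exists (l ++ l').
  have h := farD h1 h1'; rewrite -splitr in h.
  by apply: far_imp h _ => z; rewrite pval_cat.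
rewrite (splitr e); apply: eq_small (smallD h2 h2') => n.
by rewrite lmat_cat opprD addrACA.
Qed.

Lemma approx_sum k (A : nat -> mxseq R) (f : nat -> R * R -> C) :
  (forall i, (i < k)%N -> approx (A i) (f i)) ->
  approx (fun n => \sum_(i < k) A i n) (fun z => \sum_(i < k) f i z).
Proof.
elim: k => [|k ih] h.
  have -> : (fun n => \sum_(i < 0) A i n) = (fun n => 0 : 'M[C]_n) :> mxseq R.
    by apply: functional_extensionality_dep => n; rewrite big_ord0.
  have -> : (fun z => \sum_(i < 0) f i z) = (fun=> 0) by apply/funext => z; rewrite big_ord0.
  exact: approx0.
have -> : (fun n => \sum_(i < k.+1) A i n) = (fun n => \sum_(i < k) A i n + A k n) :> mxseq R.
  by apply: functional_extensionality_dep => n; rewrite big_ord_recr.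
have -> : (fun z => \sum_(i < k.+1) f i z) = (fun z => \sum_(i < k) f i z + f k z).
  by apply/funext => z; rewrite big_ord_recr.
apply: approxD; last exact: h.
by apply: ih => i ik; apply: h; rewrite ltnS ltnW.
Qed.

Lemma approx_adj A f : approx A f -> approx (fun n => (A n)^t*) (fun z => (f z)^*).
Proof.
move=> hA e e0; have e2 : 0 < e / 2 by rewrite divr_gt0.
have ee : e / 2 <= e by rewrite ler_pdivrMr// ler_pMr// ler1n.
have [l h1 h2] := hA _ e2; exists (lconj l).
  by apply: far_imp (far_conj (far_le ee ee h1)) _ => z; rewrite pval_conj.
have [K hK] := lmat_adj l.
rewrite (splitr e).
apply: eq_small (smallD (small_adj (ltW e2) h2) (small_rank hK e2)) => n.
by rewrite trmxCD trmxCN addrA subrK.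
Qed.

Lemma approxZ (c : C) A f : approx A f -> approx (fun n => c *: A n) (fun z => c * f z).
Proof.
move=> hA e e0.
pose c' := 1 + normc c; have c1 : 1 <= c' by rewrite lerDl normc_ge0.
have c0 : 0 < c' by apply: lt_le_trans c1.
have ec : 0 < e / c' by rewrite divr_gt0.
have cc : normc c <= c' by rewrite lerDr.
have eE : e = c' * (e / c') by rewrite mulrC divfK// gt_eqF.
have [l h1 h2] := hA _ ec; exists (lscale c l).
  have k1 : normc c * (e / c') <= e by rewrite [leRHS]eE ler_wpM2r// ltW.
  have k2 : e / c' <= e by rewrite ler_pdivrMr// ler_peMr// ltW.
  by apply: far_imp (far_le k1 k2 (farZ c h1)) _ => z; rewrite pval_scale.
rewrite [in small _]eE.
by apply: eq_small (smallZ c1 (ltW ec) cc h2) => n; rewrite lmat_scale scalerBr.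
Qed.

(** The approximant of B is chosen first, since the accuracy required from
    that of A depends on its bound. *)
Lemma approxM A B f g (cf : R) : bounded A -> 0 <= cf -> far f (fun=> 0) cf 0 ->
  approx A f -> approx B g -> approx (fun n => A n *m B n) (fun z => f z * g z).
Proof.
move=> /bounded_ge1[cA cA1 hcA] cf0 hf hA hB e e0.
have cA0 : 0 <= cA by rewrite (le_trans _ cA1).
have q0 : 0 < 1 + cA + cf by rewrite ltr_wpDr// ltr_wpDr.
pose d' := e / (4 * (1 + cA + cf)).
have d'0 : 0 < d' by rewrite divr_gt0// mulr_gt0.
have d'E : (1 + cA + cf) * d' = e / 4 by rewrite /d'; field; rewrite gt_eqF.
have [l' h1' h2'] := hB _ d'0.
pose c' := 1 + lnorm l'; have c'1 : 1 <= c' by rewrite lerDl lnorm_ge0.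
have c'0 : 0 < c' by apply: lt_le_trans c'1.
have l'c : lnorm l' <= c' by rewrite lerDr.
pose d := e / (4 * c'); have d0 : 0 < d by rewrite divr_gt0// mulr_gt0.
have dE : c' * d = e / 4 by rewrite /d; field; rewrite gt_eqF.
have [l h1 h2] := hA _ d0.
have k1 : cf * d' <= e / 4 by rewrite -d'E ler_pM2r// lerDr addr_ge0.
have k2 : cA * d' <= e / 4 by rewrite -d'E ler_pM2r// -addrA addrCA lerDl addr_ge0.
have k3 : d' <= e / 4 by rewrite -d'E; apply: ler_peMl; [exact: ltW | rewrite -addrA lerDl addr_ge0].
have k4 : d <= e / 4 by rewrite -dE; apply: ler_peMl => //; exact: ltW.
have e4 : 0 < e / 4 by rewrite divr_gt0.
exists (lmul l l').
  have hp : far (pval l') (fun=> 0) c' 0.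
    by apply: far_pw => // z; rewrite subr0 (le_trans (pval_le _ _)).
  have k5 : cf * d' + d * c' <= e.
    by rewrite [d * c']mulrC dE; move: k1 e0; clear; move: (cf * d') => x; lra.
  have k6 : 0 + d' + (d + 0) <= e by move: k3 k4 e0; clear; move: d' d => x y; lra.
  by apply: far_imp (far_le k5 k6 (farM h1 h1' hf hp)) _ => z; rewrite pval_mul.
have [K hK] := lmat_mul l l'.
have s3 := small_rank hK e4.
have bl' : bounded_by (lmat l') c'.
  by move=> n; refine (@opb_le _ _ _ _ _ (@opb_lmat _ l' n) _).
have s1 := smallMl cA1 (ltW d'0) hcA h2'.
have s2 := smallMr c'1 (ltW d0) bl' h2.
have s := smallD (smallD s1 s2) s3.
have se : cA * d' + c' * d + e / 4 <= e.
  by rewrite dE; move: k2 e0; clear; move: (cA * d') => x; lra.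
apply: small_le se _; apply: eq_small s => n.
by rewrite mulmxBr mulmxBl !addrA !subrK.
Qed.

(** The difference of approximants is a step-trigonometric symbol close to f - g,
    hence small in measure, so [small_of_measure] applies. *)
Lemma approx_small A B f g (e : R) : 0 < e -> 3 * e <= 1 / 2 ->
  approx A f -> approx B g -> far f g e 0 ->
  small (2 * e + 10 * Num.sqrt (3 * e)) (fun n => A n - B n).
Proof.
move=> e0 e1 hA hB hfg.
have [l h1 h2] := hA _ e0; have [l' h1' h2'] := hB _ e0.
have h3 := far_trans (far_trans (farC h1) hfg) h1'.
have e3 : 0 < 3 * e by rewrite mulr_gt0.
have hl : (om (domD R `&` [set z | (3 * e < normc (pval (lsub l l') z))%R]) <= (3 * e)%:E)%E.
  have h4 : far (pval l) (pval l') (3 * e) (3 * e).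
    by apply: far_le h3; move: e0; clear; lra.
  apply: le_trans h4; apply: om_le => z [Dz /= hz]; split => //=.
  by rewrite pval_sub in hz.
have s := smallB (smallD h2 (small_of_measure e3 e1 hl)) h2'.
have -> : 2 * e + 10 * Num.sqrt (3 * e) = e + 10 * Num.sqrt (3 * e) + e by ring.
apply: eq_small s => n; rewrite lmat_sub !addrA subrK opprB addrA.
by rewrite -[A n - _ + _]addrA [- _ + _]addrC subrr addr0.
Qed.

Lemma infinite_ge (M : set nat) (N : nat) : infinite_set M -> exists2 m, M m & (N <= m)%N.
Proof.
move=> hM; apply: contrapT => h; apply: hM.
apply: (sub_finite_set _ (finite_II N)) => m Mm /=.
by rewrite ltnNge; apply/negP => Nm; apply: h; exists m.
Qed.

Lemma is_GLT_approx A (f : Dfun R) : is_GLT A f -> approx A f.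
Proof.
move=> [_ [M [k [a [h [L [hM hL hcvg [nm [c [w [hc hw hacs]]]]]]]]]]].
move=> e e0; have e4 : 0 < e / 4 by rewrite divr_gt0.
have [N1 _ hN1] := cvgr_lt (0 : R) hc (e / 4) e4.
have [N2 _ hN2] := cvgr_lt (0 : R) hw (e / 4) e4.
have [_ hmeas] := (fine_cvgP _ (0 : R)).1 (hcvg _ e4).
have [hfin _] := (fine_cvgP _ (0 : R)).1 (hcvg _ e4).
have [N3 _ hN3] := cvgr_lt (0 : R) hmeas (e / 4) e4.
have [N4 _ hN4] := hfin.
have [m Mm hm] := infinite_ge (N1 + N2 + N3 + N4)%N hM.
have [l1 l2 l3 l4] : [/\ N1 <= m, N2 <= m, N3 <= m & N4 <= m]%N by clear -hm; split; lia.
have cm := hN1 m l1 Mm; have wm := hN2 m l2 Mm.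
have om4 := hN3 m l3 Mm; have fin4 := hN4 m l4 Mm.
have hsum := approx_sum (fun i ik => is_LT_approx (hL m Mm i ik)).
have [l k1 k2] := hsum _ e4.
exists l.
  have hf : far (fun z => \sum_(i < k m) a m i z.1 * h m i z.2) f (e / 4) (e / 4).
    by rewrite /far -(fineK fin4) lee_fin ltW.
  apply: far_le (far_trans (farC hf) k1); by move: e0; clear; lra.
have s1 : small (e / 4) (fun n => A n - \sum_(i < k m) L m i n).
  exists (nm m) => n hn; have [Rn [Nn [hA hr hN]]] := hacs m Mm n hn.
  exists Rn, Nn; split.
  - by apply/eqP; rewrite subr_eq hA -addrA addrC.
  - by rewrite (le_trans hr)// ler_wpM2r// ltW.
  - have e40 := ltW e4.
    by apply/(spectral_normP _ e40); rewrite (le_trans hN)// ltW.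
have s := smallD s1 k2.
have se : e / 4 + e / 4 <= e by move: e0; clear; lra.
by apply: small_le se _; apply: eq_small s => n; rewrite addrA subrK.
Qed.

End Symbols.

(** * Matrices that are nearly diagonal in a unitary basis *)

Section Udiag.
Context {R : realType}.
Local Notation C := R[i].

(** The matrix with eigenvalues d in the basis of columns of U. *)
Definition udiag n (U : 'M[C]_n) (d : 'rV[C]_n) : 'M[C]_n := U *m diag_mx d *m U^t*.

Lemma diagonalized_byP n (U D : 'M[C]_n) : U \is unitarymx ->
  diagonalized_by U D <-> exists d, D = udiag U d.
Proof.
move=> hU; split=> [|[d ->]]; rewrite /diagonalized_by /=.
  have ex (M : 'M[C]_n) : is_diag_mx M -> exists d, M = diag_mx d.
    move=> /is_diag_mxP h; exists (\row_i M i i); apply/matrixP => i j; rewrite !mxE.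
    by have [->|ij] := eqVneq i j; rewrite ?mulr1n// mulr0n h.
  move=> /ex[d hd]; exists d; rewrite /udiag -hd.
  by rewrite !mulmxA unitary_mulV// mul1mx -mulmxA unitary_mulV// mulmx1.
rewrite /udiag !mulmxA unitary_mulVr// mul1mx -mulmxA unitary_mulVr// mulmx1.
exact: diag_mx_is_diag.
Qed.

Lemma udiagD n (U : 'M[C]_n) d d' : udiag U (d + d') = udiag U d + udiag U d'.
Proof. by rewrite /udiag linearD /= mulmxDr mulmxDl. Qed.

Lemma udiagZ n (U : 'M[C]_n) c d : udiag U (c *: d) = c *: udiag U d.
Proof. by rewrite /udiag linearZ /= -scalemxAr -scalemxAl. Qed.

Lemma udiagB n (U : 'M[C]_n) d d' : udiag U (d - d') = udiag U d - udiag U d'.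
Proof. by rewrite -scaleN1r udiagD udiagZ scaleN1r. Qed.

Lemma udiag_adj n (U : 'M[C]_n) d : (udiag U d)^t* = udiag U (map_mx Num.conj d).
Proof.
have e1 : (udiag U d)^t* = U^t*^t* *m (U *m diag_mx d)^t* by exact: trmxCM.
have e2 : (U *m diag_mx d)^t* = (diag_mx d)^t* *m U^t* by exact: trmxCM.
have e3 : U^t*^t* = U by exact: trmxCK.
have e4 : (diag_mx d)^t* = diag_mx (map_mx Num.conj d).
  apply/matrixP => i j; rewrite !mxE eq_sym.
  by case: eqP => [->|_]; rewrite ?mulr1n// !mulr0n conjC0.
rewrite e1 e2 e3 e4; exact: mulmxA.
Qed.

Lemma udiagM n (U : 'M[C]_n) d d' : U \is unitarymx ->
  udiag U d *m udiag U d' = udiag U (\row_i (d 0 i * d' 0 i)).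
Proof.
move=> hU; by rewrite /udiag !mulmxA -(mulmxA (U *m diag_mx d)) (unitary_mulVr hU) mulmx1 -(mulmxA U) mulmx_diag.
Qed.

Lemma l2norm_diag_mx n (d : 'rV[C]_n) (x : 'cV[C]_n) :
  l2norm (diag_mx d *m x) ^+ 2 = \sum_i (normc (d 0 i) * normc (x i ord0)) ^+ 2.
Proof. by rewrite sqr_l2norm; apply: eq_bigr => i _; rewrite mul_diag_mx mxE Normc.normcM. Qed.

Lemma l2norm_diag_ge n (d : 'rV[C]_n) (x : 'cV[C]_n) (K : R) : 0 <= K ->
  (forall i, x i ord0 != 0 -> K <= normc (d 0 i)) ->
  K * l2norm x <= l2norm (diag_mx d *m x).
Proof.
move=> K0 h; rewrite -(@ler_pXn2r _ 2)// ?nnegrE ?mulr_ge0 ?l2norm_ge0//.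
rewrite l2norm_diag_mx exprMn sqr_l2norm mulr_sumr.
apply: ler_sum => i _; rewrite exprMn.
have [->|xi] := eqVneq (x i ord0) 0; first by rewrite Normc.normc0 expr0n /= !mulr0.
by rewrite ler_wpM2r ?sqr_ge0// ler_pXn2r ?nnegrE ?normc_ge0 ?h.
Qed.

Lemma opb_udiag n (U : 'M[C]_n) (d : 'rV[C]_n) (K : R) : U \is unitarymx -> 0 <= K ->
  (forall i, normc (d 0 i) <= K) -> opb (udiag U d) K.
Proof.
move=> hU K0 h x; have hV : U^t* \is unitarymx by rewrite trmxC_unitary.
rewrite /udiag -!mulmxA opb_unitary// -(opb_unitary hV x).
set y := U^t* *m x.
rewrite -(@ler_pXn2r _ 2)// ?nnegrE ?mulr_ge0 ?l2norm_ge0// l2norm_diag_mx exprMn sqr_l2norm mulr_sumr.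
apply: ler_sum => i _; rewrite exprMn ler_wpM2r ?sqr_ge0//.
by rewrite ler_pXn2r ?nnegrE ?normc_ge0.
Qed.

(** On the span of the basis vectors with |d i| > K the diagonal matrix expands
    by at least K > c + e, while B - Nn expands by at most c + e. So Rn is
    injective there, and the dimension of that span is at most its rank. *)
Lemma udiag_trunc n (U B Rn Nn : 'M[C]_n) d (c e K : R) : U \is unitarymx ->
  opb B c -> opb Nn e -> B - udiag U d = Rn + Nn -> 0 <= K -> c + e < K ->
  exists d' : 'rV[C]_n, (forall i, normc (d' 0 i) <= K) /\
    (\rank (udiag U d - udiag U d')%R <= \rank Rn)%N.
Proof.
move=> hU hB hN hBD K0 cK.
pose s i : bool := K < normc (d 0 i).
pose d' : 'rV[C]_n := \row_i (if s i then 0 else d 0 i).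
pose E : 'M[C]_n := diag_mx (\row_i (s i)%:R).
exists d'; split=> [i|].
  rewrite mxE /s; case: ltP => // _; by rewrite Normc.normc0.
have -> : udiag U d - udiag U d' = U *m diag_mx (d - d') *m E *m U^t*.
  rewrite -udiagB /udiag -(mulmxA U _ E) /E mulmx_diag; congr (_ *m diag_mx _ *m _).
  apply/matrixP => i j; rewrite !ord1 !mxE; case: (s j); first by rewrite mulr1.
  by rewrite subrr mul0r.
apply: leq_trans (mxrankM_maxl _ _) _; apply: leq_trans (mxrankM_maxr _ _) _.
suff h : (\rank E <= \rank (Rn *m U *m E))%N.
  apply: leq_trans h _; apply: leq_trans (mxrankM_maxl _ _) _; exact: mxrankM_maxl.
set X := Rn *m U *m E.
have hker : (kermx X^T <= kermx E^T)%MS.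
  apply/rV_subP => v /sub_kermxP hv; apply/sub_kermxP.
  have {}hv : X *m v^T = 0 by rewrite -[X]trmxK -trmx_mul hv trmx0.
  suff : E *m v^T = 0 by move=> hE; rewrite -[v]trmxK -trmx_mul hE trmx0.
  set w := E *m v^T; apply: l2norm_eq0.
  have hw : Rn *m (U *m w) = 0 by rewrite /w !mulmxA.
  have hD : udiag U d *m (U *m w) = (B - Nn) *m (U *m w).
    have -> : udiag U d = B - Nn - Rn by rewrite -addrA -opprD [Nn + _]addrC -hBD subKr.
    by rewrite [LHS]mulmxBl hw subr0.
  have h1 : l2norm (udiag U d *m (U *m w)) <= (c + e) * l2norm w.
    by rewrite hD -(opb_unitary hU w); exact: (opbB hB hN).
  have h2 : K * l2norm w <= l2norm (udiag U d *m (U *m w)).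
    have -> : udiag U d *m (U *m w) = U *m (diag_mx d *m w).
      by rewrite /udiag -!mulmxA (mulmxA (U^t*) U w) (unitary_mulVr hU) mul1mx.
    rewrite (opb_unitary hU); apply: l2norm_diag_ge K0 _ => i.
    rewrite {1}/w mul_diag_mx !mxE /s; case: ltP => [/ltW//|_]; by rewrite mul0r eqxx.
  apply/eqP; rewrite eq_le l2norm_ge0 andbT leNgt; apply/negP => w0.
  have := le_trans h2 h1; rewrite ler_pM2r// leNgt cK //.
have := mxrankS hker; rewrite (mxrank_ker X^T) (mxrank_ker E^T) (mxrank_tr X) (mxrank_tr E) => h.
have := rank_leq_row E; have := rank_leq_row X; move: h; clear.
move: (\rank E) (\rank X) => a b; lia.
Qed.

Section near_diag.
Variables (U : mxseq R) (hU : forall n, U n \is unitarymx).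
Implicit Types A B : mxseq R.

Definition near_diag B := forall e : R, 0 < e ->
  exists d : forall n, 'rV[C]_n, small e (fun n => B n - udiag (U n) (d n)).

(** The bound K does not depend on e: this is what products require. *)
Lemma near_diag_trunc B : bounded B -> near_diag B ->
  exists2 K, 1 <= K & forall e : R, 0 < e -> exists d : forall n, 'rV[C]_n,
    bounded_by (fun n => udiag (U n) (d n)) K /\ small e (fun n => B n - udiag (U n) (d n)).
Proof.
move=> [c c0 hc] hB; exists (c + 1); first by rewrite lerDr.
move=> e e0; pose e' := Num.min (e / 2) (1 / 2).
have e'0 : 0 < e' by rewrite lt_min !divr_gt0.
have e'1 : e' <= 1 / 2 by rewrite ge_min lexx orbT.
have e'2 : e' <= e / 2 by rewrite ge_min lexx.
have K0 : 0 <= c + 1 by rewrite addr_ge0.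
have cK : c + e' < c + 1 by rewrite ltrD2l; move: e'1; clear; move: e' => x; lra.
have [d [n0 hd]] := hB _ e'0.
have ex n : exists d' : 'rV[C]_n, (forall i, normc (d' 0 i) <= c + 1) /\
    ((n0 <= n)%N -> exists Rn Nn : 'M[C]_n, [/\ B n - udiag (U n) d' = Rn + Nn,
       (\rank Rn)%:R <= e * n%:R & opb Nn e]).
  have [hn|hn] := leqP n0 n; last first.
    exists 0; split=> [i|//]; by rewrite mxE Normc.normc0.
  have [Rn [Nn [hBD hr hN]]] := hd n hn.
  have [d' [hd' hrk]] := udiag_trunc (hU n) (hc n) hN hBD K0 cK.
  exists d'; split=> // _; exists (Rn + (udiag (U n) (d n) - udiag (U n) d')), Nn; split.
  - by rewrite addrAC -hBD addrA subrK.
  - have h1 : (\rank (Rn + (udiag (U n) (d n) - udiag (U n) d'))%R <= \rank Rn + \rank Rn)%N.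
      by rewrite (leq_trans (mxrank_add _ _))// leq_add2l.
    rewrite (le_trans (y := (\rank Rn + \rank Rn)%N%:R))// ?ler_nat// natrD.
    apply: le_trans (lerD hr hr) _; rewrite -mulrDl ler_wpM2r//.
    by move: e'2; clear; move: e' => x; lra.
  - apply: (@opb_le _ _ _ _ _ hN); move: e'2 e0; clear; move: e' => x; lra.
exists (fun n => projT1 (cid (ex n))); split=> [n|].
  by case: (cid (ex n)) => d' /= [h _]; apply: opb_udiag.
by exists n0 => n hn; case: (cid (ex n)) => d' /= [_ /(_ hn)].
Qed.

Lemma near_diag0 : near_diag (fun n => 0 : 'M[C]_n).
Proof.
move=> e e0; exists (fun n => 0); apply: small_zero => // n.
by rewrite /udiag linear0 mulmx0 mul0mx subr0.
Qed.

Lemma near_diagD A B : near_diag A -> near_diag B -> near_diag (fun n => A n + B n).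
Proof.
move=> hA hB e e0; have e2 : 0 < e / 2 by rewrite divr_gt0.
have [d hd] := hA _ e2; have [d' hd'] := hB _ e2.
exists (fun n => d n + d' n); rewrite (splitr e); apply: eq_small (smallD hd hd') => n.
by rewrite udiagD opprD addrACA.
Qed.

Lemma near_diagZ (c : C) A : near_diag A -> near_diag (fun n => c *: A n).
Proof.
move=> hA e e0; pose c' := 1 + normc c.
have c1 : 1 <= c' by rewrite lerDl normc_ge0.
have c0 : 0 < c' by apply: lt_le_trans c1.
have ec : 0 < e / c' by rewrite divr_gt0.
have cc : normc c <= c' by rewrite lerDr.
have [d hd] := hA _ ec; exists (fun n => c *: d n).
have -> : e = c' * (e / c') by rewrite mulrC divfK// gt_eqF.
apply: eq_small (smallZ c1 (ltW ec) cc hd) => n.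
by rewrite udiagZ scalerBr.
Qed.

Lemma near_diag_adj A : near_diag A -> near_diag (fun n => (A n)^t*).
Proof.
move=> hA e e0; have [d hd] := hA _ e0; exists (fun n => map_mx Num.conj (d n)).
by apply: eq_small (small_adj (ltW e0) hd) => n; rewrite trmxCD trmxCN udiag_adj.
Qed.

Lemma near_diagM A B : bounded A -> bounded B -> near_diag A -> near_diag B -> near_diag (fun n => A n *m B n).
Proof.
move=> /bounded_ge1[c c1 hc] bB hA /(near_diag_trunc bB)[K K1 hB] e e0.
have c0 : 0 < c by apply: lt_le_trans c1.
have K0 : 0 < K by apply: lt_le_trans K1.
have e1 : 0 < e / 2 / c by rewrite !divr_gt0.
have e2 : 0 < e / 2 / K by rewrite !divr_gt0.
have [d hd] := hA _ e2; have [d' [hat' hd']] := hB _ e1.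
exists (fun n => \row_i (d n 0 i * d' n 0 i)).
have s1 := smallMl c1 (ltW e1) hc hd'.
have s2 := smallMr K1 (ltW e2) hat' hd.
have -> : e = c * (e / 2 / c) + K * (e / 2 / K) by field; rewrite !gt_eqF.
apply: eq_small (smallD s1 s2) => n.
by rewrite -udiagM// mulmxBr mulmxBl addrA subrK.
Qed.

Lemma near_diag_close B : (forall e : R, 0 < e -> exists2 A, near_diag A & small e (fun n => B n - A n)) ->
  near_diag B.
Proof.
move=> h e e0; have e2 : 0 < e / 2 by rewrite divr_gt0.
have [A hA hBA] := h _ e2; have [d hd] := hA _ e2; exists d.
by rewrite (splitr e); apply: eq_small (smallD hBA hd) => n; rewrite addrA subrK.
Qed.

End near_diag.
End Udiag.

(** * The C*-algebra of symbols with nearly diagonal sequences *)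

Section Cstar.
Context {R : realType}.
Local Notation C := R[i].
Local Notation om := (@completed_lebesgue_measure2 R).
Local Notation D := (`[0%R, 1%R]%classic `*` `[(- pi)%R, pi%R]%classic : set (R * R)).
Implicit Types A B : mxseq R.
Implicit Types f g : R * R -> C.

Definition essb f := exists2 c : R, 0 <= c & far f (fun=> 0) c 0.

(** A subset of a null set is measurable for the completed measure. *)
Lemma Linfty_normP (f : Dfun R) (c : R) : 0 <= c ->
  (Linfty_norm f <= c%:E)%E <-> far f (fun=> 0) c 0.
Proof.
move=> c0; split => [/ess_supP|h].
  move=> [N [mN N0 hN]]; rewrite /far.
  have N0' : om N = 0%E by exact: N0.
  apply: (@le_trans _ _ (om N)); last by rewrite N0'.
  apply: om_le => z [Dz /= hz]; apply: hN => /=; apply/negP; rewrite -ltNge lte_fin.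
  by rewrite patchE mem_set//; rewrite subr0 in hz.
apply/ess_supP.
have h0 : om (badset f (fun=> 0%R) c) = 0%E.
  by apply/eqP; rewrite eq_le om_ge0 andbT.
exists (badset f (fun=> 0%R) c); split.
- apply: le_caratheodory_measurable => X.
  apply: (@le_trans _ _ (om (badset f (fun=> 0%R) c) + om X)%E).
    apply: leeD; apply: om_le; [exact: subIsetr|exact: subIsetl].
  by rewrite h0 add0e.
- exact: h0.
- move=> z /= /negP; rewrite -ltNge lte_fin patchE.
  case: ifPn => [/set_mem Dz hz|_]; last by rewrite ltNge (_ : point = 0 :> R)// c0.
  by split=> //=; rewrite subr0.
Qed.

Lemma LinftyP (f : Dfun R) : Linfty R f <-> measurable_on_D f /\ essb f.
Proof.
split=> [[mf hf]|[mf [c c0 hf]]]; split=> //; last first.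
  by apply: le_lt_trans (ltry c); apply/Linfty_normP.
have [c c0 hc] : exists2 c : R, 0 <= c & (Linfty_norm f <= c%:E)%E.
  case: (Linfty_norm f) hf => [r _| //|_].
  - by exists (Num.max 0 r); rewrite ?lee_fin le_max lexx ?orbT.
  - by exists 0 => //; rewrite leNye.
by exists c => //; apply/Linfty_normP.
Qed.

Lemma essbD f g : essb f -> essb g -> essb (fun z => f z + g z).
Proof.
move=> [c c0 hc] [c' c'0 hc']; exists (c + c'); first exact: addr_ge0.
rewrite -[0 in X in far _ _ _ X]addr0; apply: far_imp (farD hc hc') _ => z.
by rewrite addr0.
Qed.

Lemma essbZ (c : C) f : essb f -> essb (fun z => c * f z).
Proof.
move=> [k k0 hk]; exists (normc c * k); first by rewrite mulr_ge0// normc_ge0.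
by apply: far_imp (farZ c hk) _ => z; rewrite mulr0.
Qed.

Lemma essbM f g : essb f -> essb g -> essb (fun z => f z * g z).
Proof.
move=> [c c0 hc] [c' c'0 hc']; exists (c * c'); first exact: mulr_ge0.
rewrite -[0 in X in far _ _ _ X]addr0; apply: far_imp2 hc hc' _ => z.
by rewrite !subr0 => k k'; rewrite Normc.normcM ler_pM// normc_ge0.
Qed.

Lemma essb_conj f : essb f -> essb (fun z => (f z)^*).
Proof. by move=> [c c0 hc]; exists c => //; apply: far_imp (far_conj hc) _ => z; rewrite conjC0. Qed.

Lemma measurable_on_D0 : measurable_on_D (fun=> 0 : C).
Proof. by split; exact: measurable_cst. Qed.

Lemma measurable_on_DD (f g : Dfun R) : measurable_on_D f -> measurable_on_D g ->
  measurable_on_D (fun z => f z + g z).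
Proof.
move=> [f1 f2] [g1 g2]; split.
  by apply: eq_measurable_fun (measurable_funD f1 g1) => z _ /=; case: (f z) => a b; case: (g z).
by apply: eq_measurable_fun (measurable_funD f2 g2) => z _ /=; case: (f z) => a b; case: (g z).
Qed.

Lemma ReM (x y : C) : Re (x * y) = Re x * Re y - Im x * Im y.
Proof. by case: x => a b; case: y. Qed.

Lemma ImM (x y : C) : Im (x * y) = Re x * Im y + Im x * Re y.
Proof. by case: x => a b; case: y. Qed.

Lemma measurable_on_DM (f g : Dfun R) : measurable_on_D f -> measurable_on_D g ->
  measurable_on_D (fun z => f z * g z).
Proof.
move=> [f1 f2] [g1 g2]; split.
  apply: eq_measurable_fun (measurable_funB (measurable_funM f1 g1) (measurable_funM f2 g2)) => z _ /=.
  by rewrite ReM.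
apply: eq_measurable_fun (measurable_funD (measurable_funM f1 g2) (measurable_funM f2 g1)) => z _ /=.
by rewrite ImM.
Qed.

Lemma measurable_on_D_conj (f : Dfun R) : measurable_on_D f -> measurable_on_D (fun z => (f z)^*).
Proof.
move=> [f1 f2]; split; first by apply: eq_measurable_fun f1 => z _; case: (f z).
by apply: eq_measurable_fun (measurable_funN f2) => z _ /=; case: (f z).
Qed.

Section Model.
Variables (U : mxseq R) (hU : forall n, U n \is unitarymx).

Definition cluster_model A f := [/\ bounded A, approx A f, near_diag U A & essb f].

(** Closing up under uniform limits on the side of symbols means that no
    sequence has to be constructed for the limit symbol. *)
Definition cluster_algebra : set (Dfun R) := Linfty R `&`
  [set g | forall e : R, 0 < e -> exists A f, cluster_model A f /\ far g f e 0].

Lemma cluster_algebra_Cstar : is_Cstar_subalgebra cluster_algebra.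
Proof.
split.
- by move=> g [].
- split.
    apply/LinftyP; split; first exact: measurable_on_D0.
    by exists 0 => //; exact: far_refl.
  move=> e e0; exists (fun n => 0 : 'M[C]_n), (fun=> 0); split; last exact: far_refl (ltW e0) _.
  split; [exact: bounded0|exact: approx0|exact: near_diag0|].
  by exists 0 => //; exact: far_refl.
- move=> f g [/LinftyP[mf bf] hf] [/LinftyP[mg bg] hg]; split.
    by apply/LinftyP; split; [exact: measurable_on_DD|exact: essbD].
  move=> e e0; have e2 : 0 < e / 2 by rewrite divr_gt0.
  have [A [f' [[a1 a2 a3 a4] a5]]] := hf _ e2; have [B [g' [[b1 b2 b3 b4] b5]]] := hg _ e2.
  exists (fun n => A n + B n), (fun z => f' z + g' z); split.
    by split; [exact: boundedD|exact: approxD|exact: near_diagD|exact: essbD].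
  by have := farD a5 b5; rewrite -splitr addr0.
- move=> c f [/LinftyP[mf bf] hf]; split.
    apply/LinftyP; split; last exact: essbZ.
    by apply: measurable_on_DM => //; split; exact: measurable_cst.
  move=> e e0; have c0 : 0 < 1 + normc c by rewrite ltr_wpDr// normc_ge0.
  have ec : 0 < e / (1 + normc c) by rewrite divr_gt0.
  have [A [f' [[a1 a2 a3 a4] a5]]] := hf _ ec.
  exists (fun n => c *: A n), (fun z => c * f' z); split.
    by split; [exact: boundedZ|exact: approxZ|exact: near_diagZ|exact: essbZ].
  apply: far_le (farZ c a5) => //.
  by rewrite mulrCA ler_piMr ?(ltW e0)// ler_pdivrMr// mul1r lerDr.
- move=> f g [/LinftyP[mf bf] hf] [/LinftyP[mg bg] hg]; split.
    by apply/LinftyP; split; [exact: measurable_on_DM|exact: essbM].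
  move=> e e0; have [c c0 hc] := bf; have [c' c'0 hc'] := bg.
  (* With e2 <= 1 the approximant of g is bounded by c' + 1. *)
  pose e2 := Num.min 1 (e / (2 * (1 + c))).
  have e20 : 0 < e2 by rewrite lt_min ltr01 divr_gt0// mulr_gt0// ltr_wpDr.
  pose e1 := e / (2 * (2 + c')).
  have e10 : 0 < e1 by rewrite divr_gt0// mulr_gt0// ltr_wpDr.
  have [A [f' [[a1 a2 a3 a4] a5]]] := hf _ e10; have [B [g' [[b1 b2 b3 b4] b5]]] := hg _ e20.
  exists (fun n => A n *m B n), (fun z => f' z * g' z); split.
    split; [exact: boundedM| |exact: near_diagM|exact: essbM].
    by have [k k0 hk] := a4; exact: approxM a1 k0 hk a2 b2.
  have hg' := far_trans (farC b5) hc'; rewrite addr0 in hg'.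
  apply: far_le (farM a5 b5 hc hg'); last by rewrite !addr0.
  have k1 : c * e2 <= e / 2.
    apply: (@le_trans _ _ ((1 + c) * (e / (2 * (1 + c))))).
      by apply: ler_pM => //; rewrite ?(ltW e20) ?lerDr ?ge_min ?lexx ?orbT.
    rewrite le_eqVlt; apply/orP; left; apply/eqP; field.
    by rewrite gt_eqF// ltr_wpDr.
  have k2 : e1 * (e2 + c') <= e / 2.
    apply: (@le_trans _ _ (e1 * (2 + c'))).
      apply: ler_wpM2l; first exact: ltW.
      rewrite lerD2r; apply: (@le_trans _ _ 1); first by rewrite ge_min lexx.
      by rewrite ler1n.
    rewrite le_eqVlt; apply/orP; left; apply/eqP; rewrite /e1; field.
    by rewrite gt_eqF// ltr_wpDr.
  by rewrite (splitr e) lerD.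
- move=> f [/LinftyP[mf bf] hf]; split.
    by apply/LinftyP; split; [exact: measurable_on_D_conj|exact: essb_conj].
  move=> e e0; have [A [f' [[a1 a2 a3 a4] a5]]] := hf _ e0.
  exists (fun n => (A n)^t*), (fun z => (f' z)^*); split; last exact: far_conj.
  by split; [exact: bounded_adj|exact: approx_adj|exact: near_diag_adj|exact: essb_conj].
- move=> g f hg Lf hlim; split=> // e e0.
  have e2 : 0 < e / 2 by rewrite divr_gt0.
  have [hfin hcv] := (fine_cvgP _ (0 : R)).1 hlim.
  have [N1 _ h1] := cvgr_lt (0 : R) hcv (e / 2) e2.
  have [N2 _ h2] := hfin.
  pose j := (N1 + N2)%N.
  have l1 := h1 j (leq_addr _ _); have l2 := h2 j (leq_addl _ _).
  have hj : far (fun z => g j z - f z) (fun=> 0) (e / 2) 0.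
    by apply/Linfty_normP; [exact: ltW|rewrite -(fineK l2) lee_fin ltW].
  have hj' : far f (g j) (e / 2) 0.
    by apply: farC; apply: far_imp hj _ => z; rewrite subr0.
  have [_ hgj] := hg j; have [A [f' [a1 a2]]] := hgj _ e2.
  exists A, f'; split=> //; have := far_trans hj' a2; by rewrite -splitr addr0.
Qed.

(** With e1 = s^2 / 3 the error of [approx_small] is 2 s^2 / 3 + 10 s. *)
Lemma cluster_algebra_near_diag (g : Dfun R) B : cluster_algebra g -> approx B g -> near_diag U B.
Proof.
move=> [_ hg] hB; apply: near_diag_close => e e0.
pose s := Num.min (e / 20) (1 / 2).
have s0 : 0 < s by rewrite lt_min !divr_gt0.
have s1 : s <= 1 / 2 by rewrite ge_min lexx orbT.
have s2 : s <= e / 20 by rewrite ge_min lexx.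
have e10 : 0 < s ^+ 2 / 3 by rewrite divr_gt0// exprn_gt0.
have e13 : 3 * (s ^+ 2 / 3) = s ^+ 2 by rewrite mulrC divfK.
have e1h : 3 * (s ^+ 2 / 3) <= 1 / 2.
  by rewrite e13; move: s1 s0; clear; move: s => x h1 h2; nra.
have [A [f' [[a1 a2 a3 a4] a5]]] := hg _ e10.
exists A => //; apply: small_le (approx_small e10 e1h hB a2 a5).
rewrite e13 sqrtr_sqr gtr0_norm//.
by move: s1 s2 s0; clear; move: s => x h1 h2 h3; nra.
Qed.

End Model.
End Cstar.

(** * Type 2 clustering *)

Section Final.
Context {R : realType}.
Local Notation C := R[i].
Implicit Types A B : mxseq R.

Lemma mxtrace_trmxC n (A : 'M[C]_n) : \tr (A^t*) = (\tr A)^*.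
Proof. by rewrite /mxtrace rmorph_sum; apply: eq_bigr => i _; rewrite !mxE. Qed.

Lemma frob2_pythagoras n (X Y : 'M[C]_n) : \tr (Y^t* *m X) = 0 ->
  frob2 (X + Y) = frob2 X + frob2 Y.
Proof.
move=> XY; have YX : \tr (X^t* *m Y) = 0.
  have -> : X^t* *m Y = (Y^t* *m X)^t* by rewrite (trmxCM (Y^t*) X) (trmxCK Y).
  by rewrite mxtrace_trmxC XY conjC0.
apply: (@complexI R); rewrite rmorphD /= !frob2E trmxCD mulmxDl !mulmxDr.
rewrite (mxtraceD (X^t* *m X + X^t* *m Y) (Y^t* *m X + Y^t* *m Y)).
by rewrite (mxtraceD (X^t* *m X) (X^t* *m Y)) (mxtraceD (Y^t* *m X) (Y^t* *m Y)) XY YX addr0 add0r.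
Qed.

(** Pythagoras, as the difference of diagonal matrices is orthogonal to
    A - P A. *)
Lemma frob2_proj n (U : 'M[C]_n) (P : 'M[C]_n -> 'M[C]_n) (A : 'M[C]_n) d : U \is unitarymx ->
  orthogonal_projection_onto (diagonalized_by U) P ->
  frob2 (A - P A) <= frob2 (A - udiag U d).
Proof.
move=> hU hP; have [hV hort] := hP A.
have [d0 hd0] := (diagonalized_byP (P A) hU).1 hV.
have hY : diagonalized_by U (udiag U (d0 - d)).
  by apply/(diagonalized_byP _ hU); exists (d0 - d).
have -> : A - udiag U d = (A - P A) + udiag U (d0 - d).
  by rewrite udiagB -hd0 addrA subrK.
by rewrite (frob2_pythagoras (hort _ hY)) lerDl frob2_ge0.
Qed.

Lemma frob2_opp n (A : 'M[C]_n) : frob2 (- A) = frob2 A.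
Proof. by apply: eq_bigr => i _; apply: eq_bigr => j _; rewrite mxE normcN. Qed.

Lemma type2_cluster_small A B : type2_weak_cluster A B ->
  forall e : R, 0 < e -> small e (fun n => A n - B n).
Proof.
move=> h e e0; have [n1 [n2 [hc hn]]] := h e e0.
have [N _ hN] := cvgr_lt (0 : R) hc e e0.
exists (maxn n2.+1 N) => n; rewrite geq_max => /andP[n2n Nn].
have [Rn [Nm [hAB hr hs]]] := hn n n2n; exists Rn, Nm; split=> //.
  have n0 : (0 < n)%N by exact: leq_ltn_trans n2n.
  apply: (@le_trans _ _ (n1 n)%:R); first by rewrite ler_nat.
  by rewrite -ler_pdivrMr ?ltr0n// ltW//; exact: hN.
by apply/(spectral_normP _ (ltW e0)); exact: ltW.
Qed.

(** The rank allowed is that of the singular values above e / 2, whose number is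
    at most the squared Frobenius norm divided by (e / 2)^2, which is o(n). *)
Lemma type2_cluster_frob2 A B :
  (forall e : R, 0 < e -> exists n0, forall n, (n0 <= n)%N -> frob2 (A n - B n) <= e * n%:R) ->
  type2_weak_cluster A B.
Proof.
move=> h e e0; have e2 : 0 < e / 2 by rewrite divr_gt0.
have q0 : 0 < (e / 2) ^+ 2 by rewrite exprn_gt0.
pose n1 n := Num.truncn (frob2 (A n - B n) / (e / 2) ^+ 2).
exists n1, 0%N; split.
  apply/cvgrPdist_le => /= a a0.
  have [n0 hn0] := h _ (mulr_gt0 a0 q0).
  exists n0 => //= n /= /hn0 hn; rewrite sub0r normrN ger0_norm ?divr_ge0//.
  have [->|npos] := posnP n; first by rewrite invr0 mulr0 ltW.
  rewrite ler_pdivrMr ?ltr0n//; apply: (@le_trans _ _ (frob2 (A n - B n) / (e / 2) ^+ 2)).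
    by rewrite Num.Theory.truncn_le divr_ge0 ?frob2_ge0 ?ltW.
  by rewrite ler_pdivrMr// mulrAC.
move=> n _; set X := A n - B n.
have [V [d [hV hX]]] := gram_spectral X.
pose S : pred 'I_n := fun i => (e / 2) ^+ 2 < d i.
have hS i : ~~ S i -> d i <= (e / 2) ^+ 2 by rewrite -leNgt.
have [Rn [Nn [hXE hr hN]]] := gram_split hV hX (ltW q0) hS.
rewrite sqrtr_sqr gtr0_norm// in hN.
exists Rn, Nn; split=> //; last first.
  apply: (@le_lt_trans _ _ (e / 2)); first by apply/(spectral_normP _ (ltW e2)).
  by rewrite ltr_pdivrMr// ltr_pMr// ltr1n.
apply: leq_trans hr _; rewrite /n1 Num.Theory.truncn_ge_nat; last by rewrite divr_ge0 ?frob2_ge0 ?ltW.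
rewrite ler_pdivlMr// -/X (gram_sum hV hX) (bigID S)/= ler_wpDr//.
  by apply: sumr_ge0 => i _; exact: gram_ge0 hV hX i.
rewrite -sum1_card natr_sum mulr_suml; apply: ler_sum => i Si; rewrite mul1r; exact: ltW.
Qed.

(** A bounded diagonal approximant is at Frobenius distance o(sqrt n), and the
    projection is at least as close. *)
Lemma near_diag_cluster (U : mxseq R) (hU : forall n, U n \is unitarymx)
  (P : forall n : nat, 'M[R[i]]_n -> 'M[R[i]]_n)
  (hP : forall n, orthogonal_projection_onto (diagonalized_by (U n)) (P n)) B :
  bounded B -> near_diag U B -> type2_weak_cluster (fun n => P n (B n)) B.
Proof.
move=> bB gB; have [K K1 hK] := near_diag_trunc hU bB gB; have [c c0 hc] := bB.
apply: type2_cluster_frob2 => e e0.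
have K0 : 0 <= K by rewrite (le_trans _ K1).
pose M := 2 * (c + K + 1) ^+ 2 + 2.
have M0 : 0 < M by rewrite ltr_wpDl// mulr_ge0// sqr_ge0.
pose e1 := Num.min 1 (e / M).
have e10 : 0 < e1 by rewrite lt_min ltr01 divr_gt0.
have [d [hat hd]] := hK _ e10.
have bY : bounded_by (fun n => B n - udiag (U n) (d n)) (c + K).
  by move=> n; exact: opbB (hc n) (hat n).
have [n0 hn0] := small_frob2 (ltW e10) (addr_ge0 c0 K0) bY hd.
exists n0 => n hn; rewrite -[frob2 _]frob2_opp opprB.
apply: le_trans (frob2_proj (B n) (d n) (hU n) (hP n)) _.
apply: le_trans (hn0 n hn) _; rewrite ler_wpM2r//.
have e11 : e1 <= 1 by rewrite ge_min lexx.
have e1M : e1 * M <= e by rewrite -ler_pdivlMr// ge_min lexx orbT.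
apply: le_trans e1M; rewrite /M.
have cK := addr_ge0 c0 K0.
move: e10 e11 cK; clear; move: e1 (c + K) => x y h1 h2 h3.
have : (y + x) ^+ 2 <= (y + 1) ^+ 2 by rewrite ler_pXn2r ?nnegrE ?addr_ge0 ?lerD2l// ltW.
by move: ((y + x) ^+ 2) ((y + 1) ^+ 2) => p q h4; nra.
Qed.

End Final.

Theorem theorem4p4 (R : realType)
  (U : mxseq R) (hU : forall n, U n \is unitarymx)
  (P : forall n : nat, 'M[R[i]]_n -> 'M[R[i]]_n)
  (hP : forall n, orthogonal_projection_onto (diagonalized_by (U n)) (P n))
  (k : nat) (hk : (0 < k)%N)
  (f : 'I_k -> Dfun R) (hf : forall i, Linfty R (f i))
  (A : 'I_k -> mxseq R)
  (hA : forall i, is_GLT (A i) (f i))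
  (hAb : forall i, norm_bounded (A i))
  (Asum : mxseq R)
  (hS : is_GLT Asum (fun z : R * R => \sum_(i < k) f i z * (f i z)^*))
  (hSb : norm_bounded Asum)
  (hclA : forall i, type2_weak_cluster (fun n => P n (A i n)) (A i))
  (hclS : type2_weak_cluster (fun n => P n (Asum n)) Asum) :
  forall g : Dfun R, Cstar_generated (range f) g ->
  forall B : mxseq R, is_GLT B g -> norm_bounded B ->
    type2_weak_cluster (fun n => P n (B n)) B.
Proof.
move=> g hg B hB /norm_boundedP bB.
apply: (near_diag_cluster hU hP bB); apply: cluster_algebra_near_diag (is_GLT_approx hB).
apply: hg; split; first exact: cluster_algebra_Cstar.
move=> _ [i _ <-]; split; first exact: hf.
move=> e e0; exists (A i), (f i); split; last exact: far_refl (ltW e0) _.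
have bA := (norm_boundedP (A i)).1 (hAb i); have aA := is_GLT_approx (hA i).
split=> //; last exact: ((LinftyP (f i)).1 (hf i)).2.
move=> d d0.
have ex n : exists v : 'rV[R[i]]_n, P n (A i n) = udiag (U n) v.
  by apply/(diagonalized_byP _ (hU n)); exact: (hP n (A i n)).1.
exists (fun n => projT1 (cid (ex n))).
apply: eq_small (smallN (type2_cluster_small (hclA i) d0)) => n.
by rewrite opprB; case: (cid (ex n)) => v /= ->.
Qed.
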